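(* Let $\Phi:[0,\infty)\to\mathbb R$ be continuous, twice continuously differentiable on $(0,\infty)$, with $(s\Phi'(s))'>0$ on $(0,\infty)$, $(s\Phi'(s))'$ integrable near $0$ and $\lim_{s\to0}s\Phi'(s)=0$. Let $P(z)$ be a complex polynomial with $P'(z)=a_1+a_2z+\dots+a_dz^{d-1}$, $d\ge1$, and let $$W(z)=\Phi(z\bar z)-P(z)-\overline{P(z)} .$$ Let $D$ be the disk of radius $R$ centered at the origin, put $g(s)=\pi^{-1}(\Phi'(s)+s\Phi''(s))$ and $I(s)=s\Phi'(s)$. Suppose that the equilibrium measure for $W$ on $D$ equals $\chi_E(z)\,g(z\bar z)\,d^2z$, where $E$ is the closed region bounded by a smooth simple closed curve, $E$ lies in the interior of $D$, and $0$ lies in the interior of $E$. Let $f:\{|\zeta|<1\}\to\overline{\mathbb C}\setminus E$ be the conformal bijection with $f(0)=\infty$ and $(1/f)'(0)=a>0$. Then there are complex numbers $b_{-d},\dots,b_d$ with $\overline{b_j}=b_{-j}$ such that $I(|f(u)|^2)=\sum_{j=-d}^d b_ju^j$ for $|u|=1$, and $$f(\zeta)=a\zeta^{-1}\exp\left(\frac1{2\pi i}\int_{|u|=1}\frac{\log I^{-1}\big(\sum_{j=-d}^d b_ju^j\big)}{u-\zeta}\,du\right)\quad(|\zeta|<1),$$ $$a=\exp\left(-\frac1{4\pi i}\int_{|u|=1}\frac{\log I^{-1}\big(\sum_{j=-d}^d b_ju^j\big)}{u}\,du\right).$$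
   Context: Here $\overline{\mathbb C}$ is the Riemann sphere, $\chi_E$ is the characteristic function of $E$, and $f$ on the unit circle denotes the continuous extension of $f$. $I$ is strictly increasing on $(0,\infty)$ (since $I'=\pi g>0$), and $I^{-1}$ is its inverse; the circle $|u|=1$ is oriented counterclockwise. Equilibrium measure: for a Borel probability measure $\mu$ on $D$ without point masses put $I_\mu=\int_D W\,d\mu+\int_D\int_D\log|z-w|^{-1}\,d\mu(z)\,d\mu(w)$. The equilibrium measure for $W$ on $D$ is the (existing and unique) such measure minimizing $I_\mu$; calling it $\sigma$, it satisfies $W(z)-2\int_D\log|z-w|\,d\sigma(w)=C$ for some constant $C$, for $\sigma$-almost every $z$. *)

(* Defs.v *)
From HB Require Import structures.
From mathcomp Require Import all_boot all_order all_algebra.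
From mathcomp Require Import all_classical all_reals all_analysis.
From mathcomp Require Import complex.

Set Implicit Arguments.
Unset Strict Implicit.
Unset Printing Implicit Defensive.

Import Order.TTheory GRing.Theory Num.Theory.
Import numFieldNormedType.Exports.

Local Open Scope classical_set_scope.
Local Open Scope complex_scope.
Local Open Scope ring_scope.

(* The library equips [K] with the topology of [K^o] for an abstract field [K]
   only; this does the same for the concrete field [R[i]]. *)
#[non_forgetful_inheritance]
HB.instance Definition _ (R : realType) := NormedModule.copy R[i] R[i]^o.

(* The norm with values in [R]; the norm [`|z|] of [R[i]] is [(cabs z)%:C]. *)
Notation cabs := Normc.normc.

Section Complex.
Context {R : realType}.
Implicit Types (z : R[i]) (t : R).

Definition cis t : R[i] := cos t +i* sin t.

Definition cexp z : R[i] := (expR (complex.Re z))%:C * cis (complex.Im z).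

Definition open_disk (r : R) : set R[i] := [set z | cabs z < r].
Definition closed_disk (r : R) : set R[i] := [set z | cabs z <= r].

(* $\int_{|u|=1} h(u)\,du$, counterclockwise: the pullback by
   $u = e^{it}$, $t \in [0,2\pi]$, for which $du = i e^{it} dt$. *)
Definition circle_integral (h : R[i] -> R[i]) : R[i] :=
  let k t := h (cis t) * ((0 +i* 1) * cis t) in
  Rintegral (@lebesgue_measure R) `[0, 2 * pi] (fun t => complex.Re (k t)) +i*
  Rintegral (@lebesgue_measure R) `[0, 2 * pi] (fun t => complex.Im (k t)).

(* $\sum_{j=-d}^{d} b_j u^j$, with $j = k - d$. *)
Definition laurent (d : nat) (b : int -> R[i]) (u : R[i]) : R[i] :=
  \sum_(k < d.*2.+1) b (k%:Z - d%:Z) * u ^ (k%:Z - d%:Z).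

End Complex.

(* The Riemann sphere: [Some w] is the finite point [w], [None] is infinity. *)
Notation sphere R := (one_point_compactification R[i]).

Section Sphere.
Context {R : realType}.
Implicit Types (f : R[i] -> sphere R) (p : sphere R).

Definition sphere_inv p : sphere R :=
  match p with
  | None => Some 0
  | Some w => if w == 0 then None else Some w^-1
  end.

(* The affine chart; its value at infinity is never used. *)
Definition chart p : R[i] := odflt 0 p.

Definition finite_holomorphic_at f (z : R[i]) :=
  (\forall x \near z, f x <> None) /\ derivable (chart \o f) z 1.

(* Holomorphy as a map to the sphere, in one of the charts [w] and [1/w]. *)
Definition holomorphic_at f (z : R[i]) :=
  finite_holomorphic_at f z \/ finite_holomorphic_at (sphere_inv \o f) z.

Definition conformal_bijection (U : set R[i]) (V : set (sphere R)) f :=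
  (forall z, U z -> holomorphic_at f z) /\ set_bij U V f.

(* [F] extends [f] continuously from the open unit disk to the closed one. *)
Definition continuous_extension f (F : R[i] -> sphere R) :=
  {within closed_disk 1, continuous F} /\
  (forall z, open_disk 1 z -> F z = f z).

End Sphere.

Section Regions.
Context {R : realType}.

Definition smooth (x : R -> R) := forall n t, derivable (derive1n n x) t 1.

(* [G] is the image of a 1-periodic regular C^oo parametrization, injective on
   a period. *)
Definition smooth_simple_closed_curve (G : set R[i]) :=
  exists gamma : R -> R[i],
    [/\ smooth (fun t => complex.Re (gamma t)) /\
        smooth (fun t => complex.Im (gamma t)),
        forall t, (derive1 (fun s => complex.Re (gamma s)) t,
                   derive1 (fun s => complex.Im (gamma s)) t) <> (0, 0),
        forall t, gamma (t + 1) = gamma t,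
        {in `[0, 1[ &, injective gamma}
      & range gamma = G].

(* The closure of a bounded region (nonempty connected open set) whose boundary
   is [G]. *)
Definition closed_region_bounded_by (E G : set R[i]) :=
  exists U : set R[i],
    [/\ open U, connected U, U !=set0, bounded_set U
      & closure U = E /\ closure U `\` U = G].

End Regions.

(* Measures on the complex plane are measures on [R * R] with its product (that
   is, Borel) sigma-algebra, transported by [toC]. *)
Notation plane R := (measurableTypeR R * measurableTypeR R)%type.

Section Equilibrium.
Context {R : realType}.
Implicit Types (W : R[i] -> R) (D : set R[i]) (mu : probability (plane R) R).

Definition toC (p : plane R) : R[i] := p.1 +i* p.2.

Definition area := (@lebesgue_measure R \x @lebesgue_measure R)%E.

(* $\log|z-w|^{-1}$, equal to [+oo] on the diagonal since [lne 0 = -oo]. *)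
Definition log_kernel (z w : R[i]) : \bar R := (- lne (cabs (z - w))%:E)%E.

(* Borel probability measures on [D] without point masses. *)
Definition admissible D mu :=
  mu (toC @^-1` D) = 1%E /\ forall p, mu [set p] = 0%E.

Definition energy W D mu : \bar R :=
  (\int[mu]_(z in toC @^-1` D) (W (toC z))%:E +
   \int[mu]_(w in toC @^-1` D) \int[mu]_(z in toC @^-1` D)
      log_kernel (toC z) (toC w))%E.

Definition equilibrium_measure W D mu :=
  admissible D mu /\
  forall nu : probability (plane R) R,
    admissible D nu -> (energy W D mu <= energy W D nu)%E.

End Equilibrium.

Section Potential.
Context {R : realType}.
Variable Phi : R -> R.

Definition potential (P : {poly R[i]}) (z : R[i]) : R :=
  complex.Re ((Phi (complex.Re (z * z^*)))%:C - P.[z] - (P.[z])^*).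

Definition gdens (s : R) : R :=
  pi^-1 * (derive1 Phi s + s * derive1 (derive1 Phi) s).

Definition Ifun (s : R) : R := s * derive1 Phi s.

(* The inverse of the restriction of [Ifun] to the positive reals; it has the
   dummy value 0 outside the image. *)
Definition Iinv : R -> R := 'pinv_(fun=> 0) `]0, +oo[ Ifun.

(* $\log I^{-1}(\sum_j b_j u^j)$; the sum is real when $|u| = 1$ and
   $\overline{b_j} = b_{-j}$. *)
Definition log_Iinv_laurent (d : nat) (b : int -> R[i]) (u : R[i]) : R[i] :=
  (ln (Iinv (complex.Re (laurent d b u))))%:C.

End Potential.

(* Main.v *)
Require Import Defs.
From mathcomp Require Import all_boot all_order all_algebra.
From mathcomp Require Import all_classical all_reals all_analysis.
From mathcomp Require Import measurable_realfun complex zify ring lra.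

Set Implicit Arguments.
Unset Strict Implicit.
Unset Printing Implicit Defensive.

Import Order.TTheory GRing.Theory Num.Theory.
Import numFieldNormedType.Exports.

Local Open Scope classical_set_scope.
Local Open Scope complex_scope.
Local Open Scope ring_scope.

(** Let [h w] be the integral of [1 / (w - p)] against the equilibrium measure
[sigma]. Moving the mass of [sigma] a little inside [E] cannot lower the
energy, so the force [conj w * Phi' (|w|^2) - P' w - h w] vanishes inside [E]
away from the origin, hence by continuity on [E] without the origin
([residual_zero], [residual_zero_region]). Multiplied by [w] this reads
[I (|w|^2) = S w] on [E], where [S w = w * P' w + w * h w] is holomorphic
outside [E] ([field_balance]).

Write [f = 1 / k], so that [k] is a holomorphic injection of the disk with its
only zero at the origin. Then [S (f z)] is holomorphic in the punctured disk,
has a pole of order at most [d] at the origin, since [h] decays at infinity,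
and tends to the real number [I (|f z|^2)] at the circle. Real boundary values
make the Laurent coefficients of index [n] and [-n] conjugate to each other;
those of index below [-d] vanish, hence so do those above [d], and [S (f z)] is
the Laurent polynomial with coefficients [b] ([schwarz_laurent]). Consequently
[|f|^2] has the boundary values [I^-1 (sum b_j u^j)], which are Lipschitz on the
circle and bounded away from 0 ([modulus_limit], [log_modulus_lipschitz]).

Let [l] be the logarithm of these boundary values and [Psi] its Cauchy integral,
whose real part on the circle is half the sum of [l] and of its mean. The
function [m z = k z / z * a * exp (Psi z)] is zero free, [|m|^2] tends to the
constant [c = a^2 exp (mean l)] at the circle, and [m] itself tends to [c] at
the origin. So [c / m] and [m] have conjugate boundary values; both are
holomorphic at the origin, hence constant, and comparing their values there
gives [c = 1] and [m = 1] ([outer_const1]). This is the formula for [f] together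
with the formula for [a]; since [Psi] extends continuously to the closed disk,
so does [f].

The boundary values of [f] are not known beforehand to exist. Every statement
about the circle is therefore a statement about limits, and the link between the
circle and [E] is [boundary_approach]: whatever holds near each point of [E]
holds for [f z] as soon as [z] is close to the circle. Coefficients of functions
on the punctured disk ([lcoef]) are means over circles, which depend on the
radius only through the expected power ([circular_mean_cst]), so that limits at
the circle can be taken under the mean. *)

(** * The modulus *)
Section Modulus.
Context {R : realType}.
Implicit Types (z w : R[i]) (x y : R).

Lemma cabs_norm z : `|z| = (cabs z)%:C.
Proof. by rewrite normc_def; case: z. Qed.

Lemma cabs_ge0 z : 0 <= cabs z.
Proof. by case: z => a b /=; exact: sqrtr_ge0. Qed.

Lemma cabsM z w : cabs (z * w) = cabs z * cabs w.
Proof. exact: Normc.normcM. Qed.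

Lemma cabsV z : cabs z^-1 = (cabs z)^-1.
Proof. exact: Normc.normcV. Qed.

Lemma cabs0 : cabs (0 : R[i]) = 0.
Proof. exact: Normc.normc0. Qed.

Lemma cabs1 : cabs (1 : R[i]) = 1.
Proof. exact: Normc.normc1. Qed.

Lemma cabsD z w : cabs (z + w) <= cabs z + cabs w.
Proof. exact: le_normcD. Qed.

Lemma cabsN z : cabs (- z) = cabs z.
Proof. exact: normcN. Qed.

Lemma cabsB z w : cabs (z - w) <= cabs z + cabs w.
Proof. by rewrite -(cabsN w); exact: cabsD. Qed.

Lemma cabsC z w : cabs (z - w) = cabs (w - z).
Proof. by rewrite -opprB cabsN. Qed.

Lemma cabs_eq0 z : (cabs z == 0) = (z == 0).
Proof. by apply/eqP/eqP => [/Normc.eq0_normc|->//]; rewrite ?cabs0. Qed.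

Lemma cabs_gt0 z : (0 < cabs z) = (z != 0).
Proof. by rewrite lt_def cabs_ge0 andbT cabs_eq0. Qed.

Lemma cabsX z n : cabs (z ^+ n) = cabs z ^+ n.
Proof. by elim: n => [|n ih]; rewrite ?expr0 ?cabs1// !exprS cabsM ih. Qed.

Lemma cabs_real x : cabs x%:C = `|x|.
Proof. by rewrite /= expr0n addr0 sqrtr_sqr. Qed.

Lemma cabs_realB x y : cabs (x%:C - y%:C) = `|x - y|.
Proof. by rewrite -rmorphB cabs_real. Qed.

Lemma cabs_sqr z : cabs z ^+ 2 = complex.Re z ^+ 2 + complex.Im z ^+ 2.
Proof. by case: z => a b /=; rewrite sqr_sqrtr // addr_ge0 // sqr_ge0. Qed.

Lemma cabs_conj z : cabs z^* = cabs z.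
Proof. by case: z => a b /=; rewrite sqrrN. Qed.

Lemma conjV z : (z^-1)^* = (z^*)^-1.
Proof. exact: fmorphV. Qed.

Lemma conj_real x : (x%:C)^* = x%:C.
Proof. by apply/eqP; rewrite eq_complex /= oppr0 !eqxx. Qed.

Lemma Re_conj z : complex.Re z^* = complex.Re z.
Proof. by case: z. Qed.

Lemma Im_conj z : complex.Im z^* = - complex.Im z.
Proof. by case: z. Qed.

Lemma mul_conj z : z * z^* = (cabs z ^+ 2)%:C.
Proof.
by rewrite cabs_sqr; case: z => a b; apply/eqP; rewrite eq_complex /=; apply/andP; split; apply/eqP; ring.
Qed.

Lemma Re_le_cabs z : `|complex.Re z| <= cabs z.
Proof.
rewrite -(@ler_pXn2r _ 2) ?nnegrE ?normr_ge0 ?cabs_ge0//.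
by rewrite cabs_sqr real_normK ?num_real// lerDl sqr_ge0.
Qed.

Lemma Im_le_cabs z : `|complex.Im z| <= cabs z.
Proof.
rewrite -(@ler_pXn2r _ 2) ?nnegrE ?normr_ge0 ?cabs_ge0//.
by rewrite cabs_sqr real_normK ?num_real// lerDr sqr_ge0.
Qed.

Lemma cabs_le_ReIm z : cabs z <= `|complex.Re z| + `|complex.Im z|.
Proof.
rewrite -(@ler_pXn2r _ 2) ?nnegrE ?addr_ge0 ?normr_ge0 ?cabs_ge0//.
rewrite cabs_sqr sqrrD !real_normK ?num_real// -addrA [leRHS]addrCA lerDr.
by rewrite mulrn_wge0 // mulr_ge0.
Qed.

Lemma cabs_tri z w v : cabs (z - v) <= cabs (z - w) + cabs (w - v).
Proof. by rewrite -[z - v](subrKA w) cabsD. Qed.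

Lemma cabs_sub z w : cabs z - cabs w <= cabs (z - w).
Proof. by rewrite lerBlDr; apply: le_trans (cabsD _ _); rewrite subrK. Qed.

Lemma cabs_sub_norm z w : `|cabs z - cabs w| <= cabs (z - w).
Proof.
by rewrite ler_norml cabs_sub andbT lerNl opprB cabsC cabs_sub.
Qed.

Lemma ReD z w : complex.Re (z + w) = complex.Re z + complex.Re w.
Proof. by case: z w => [? ?] [? ?]. Qed.
Lemma ImD z w : complex.Im (z + w) = complex.Im z + complex.Im w.
Proof. by case: z w => [? ?] [? ?]. Qed.
Lemma ReN z : complex.Re (- z) = - complex.Re z.
Proof. by case: z => [? ?]. Qed.
Lemma ImN z : complex.Im (- z) = - complex.Im z.
Proof. by case: z => [? ?]. Qed.
Lemma ReM z w : complex.Re (z * w) =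
  complex.Re z * complex.Re w - complex.Im z * complex.Im w.
Proof. by case: z w => [? ?] [? ?]. Qed.
Lemma ImM z w : complex.Im (z * w) =
  complex.Re z * complex.Im w + complex.Im z * complex.Re w.
Proof. by case: z w => [? ?] [? ?]. Qed.

End Modulus.

(** * Continuity and complex differentiability *)
Arguments Normc.normc : simpl never.

Section Continuity.
Context {R : realType}.

(** Stated for an arbitrary distance function, so that the same rules serve
functions of a real and of a complex variable. *)
Definition econt (T : Type) (d : T -> T -> R) (f : T -> R[i]) (z : T) :=
  forall e, 0 < e -> exists2 r, 0 < r &
    forall w, d w z < r -> cabs (f w - f z) < e.

Definition cdist (w z : R[i]) : R := cabs (w - z).
Definition rdist (s t : R) : R := `|s - t|.

Section Generic.
Context {T : Type} (d : T -> T -> R).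
Implicit Types (f g : T -> R[i]) (z : T).

Lemma econt_cst c z : econt d (fun=> c) z.
Proof. by move=> e e0; exists 1 => // w _; rewrite subrr cabs0. Qed.

Lemma econtN f z : econt d f z -> econt d (fun w => - f w) z.
Proof.
move=> cf e /cf[r r0 H]; exists r => // w /H.
by rewrite -opprD cabsN.
Qed.

Lemma econtD f g z : econt d f z -> econt d g z -> econt d (fun w => f w + g w) z.
Proof.
move=> cf cg e e0; have e20 : 0 < e / 2 by rewrite divr_gt0.
have [r r0 H] := cf _ e20; have [s s0 K] := cg _ e20.
exists (Order.min r s); first by rewrite lt_min r0.
move=> w; rewrite lt_min => /andP[/H fw /K gw].
rewrite opprD addrACA (le_lt_trans (cabsD _ _))// [ltRHS](splitr e).
exact: ltrD.
Qed.

Lemma econtB f g z : econt d f z -> econt d g z -> econt d (fun w => f w - g w) z.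
Proof. by move=> cf /econtN; exact: econtD. Qed.

Lemma econtM f g z : econt d f z -> econt d g z -> econt d (fun w => f w * g w) z.
Proof.
move=> cf cg e e0.
pose M := 1 + cabs (f z) + cabs (g z).
have M0 : 0 < M by have := cabs_ge0 (f z); have := cabs_ge0 (g z); rewrite /M; lra.
pose e' := Order.min 1 (e / (2 * M)).
have e'0 : 0 < e' by rewrite lt_min ltr01 divr_gt0// mulr_gt0.
have [r r0 H] := cf _ e'0; have [s s0 K] := cg _ e'0.
exists (Order.min r s); first by rewrite lt_min r0.
move=> w; rewrite lt_min => /andP[/H fw /K gw].
have -> : f w * g w - f z * g z = (f w - f z) * g w + f z * (g w - g z) by ring.
apply: le_lt_trans (cabsD _ _) _; rewrite !cabsM.
have gwM : cabs (g w) <= M.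
  have : cabs (g w) - cabs (g z) <= 1.
    by apply: le_trans (cabs_sub _ _) _; apply: ltW (lt_le_trans gw _); rewrite ge_min lexx.
  have := cabs_ge0 (f z); rewrite /M; lra.
have fzM : cabs (f z) <= M by have := cabs_ge0 (g z); rewrite /M; lra.
have e'e : e' <= e / (2 * M) by rewrite ge_min lexx orbT.
have -> : e = e / (2 * M) * M + M * (e / (2 * M)) by field; rewrite gt_eqF.
apply: ltr_leD; last first.
  by apply: ler_pM => //; rewrite ?cabs_ge0//; exact: ltW (lt_le_trans gw _).
apply: le_lt_trans (ler_wpM2l (cabs_ge0 _) gwM) _.
by rewrite ltr_pM2r//; exact: lt_le_trans fw _.
Qed.

Lemma econtV f z : f z != 0 -> econt d f z -> econt d (fun w => (f w)^-1) z.
Proof.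
rewrite -cabs_gt0 => fz0 cf e e0.
pose A := cabs (f z).
pose e' := Order.min (A / 2) (e * A ^+ 2 / 2).
have e'0 : 0 < e' by rewrite lt_min !divr_gt0// mulr_gt0// exprn_gt0.
have [r r0 H] := cf _ e'0; exists r => // w /H fw.
have fwA : A / 2 < cabs (f w).
  have : cabs (f z) - cabs (f w) < A / 2.
    by apply: le_lt_trans (cabs_sub _ _) _; rewrite cabsC (lt_le_trans fw)// ge_min lexx.
  by rewrite /A; lra.
have fw0 : 0 < cabs (f w) by apply: lt_trans fwA; rewrite divr_gt0.
have -> : (f w)^-1 - (f z)^-1 = - (f w - f z) / (f w * f z).
  by field; rewrite -!cabs_gt0 fw0 fz0.
rewrite cabsM cabsN cabsV cabsM ltr_pdivrMr ?mulr_gt0//.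
apply: lt_le_trans fw _; rewrite ge_min; apply/orP; right.
have -> : e * A ^+ 2 / 2 = e * (A / 2 * A) by field.
by rewrite ler_pM2l// ler_pM2r// ltW.
Qed.

Lemma econt_comp (h : R[i] -> R[i]) f z :
  econt d f z -> econt cdist h (f z) -> econt d (fun w => h (f w)) z.
Proof.
move=> cf ch e /ch[r r0 H]; have [s s0 K] := cf _ r0.
by exists s => // w /K /H.
Qed.

Lemma econt_near f g z : d z z = 0 -> (exists2 r, 0 < r & forall w, d w z < r -> f w = g w) ->
  econt d f z -> econt d g z.
Proof.
move=> dz [r r0 fg] cf e /cf[s s0 H].
exists (Order.min r s); first by rewrite lt_min r0.
move=> w; rewrite lt_min => /andP[wr ws].
by rewrite -!fg// ?dz//; exact: H.
Qed.

Lemma econt_conj f z : econt d f z -> econt d (fun w => (f w)^*) z.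
Proof.
move=> cf e /cf[r r0 H]; exists r => // w /H.
by rewrite -rmorphB cabs_conj.
Qed.

Lemma econt_Re f z : econt d f z -> econt d (fun w => (complex.Re (f w))%:C) z.
Proof.
move=> cf e /cf[r r0 H]; exists r => // w /H; apply: le_lt_trans.
by rewrite cabs_realB -ReN -ReD Re_le_cabs.
Qed.

Lemma econt_Im f z : econt d f z -> econt d (fun w => (complex.Im (f w))%:C) z.
Proof.
move=> cf e /cf[r r0 H]; exists r => // w /H; apply: le_lt_trans.
by rewrite cabs_realB -ImN -ImD Im_le_cabs.
Qed.

Lemma econt_real (u : R -> R) (f : T -> R) z : {for f z, continuous u} ->
  econt d (fun w => (f w)%:C) z -> econt d (fun w => (u (f w))%:C) z.
Proof.
move=> cu cf e e0.
have /cvgrPdist_lt /(_ e e0) := cu.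
move=> /nbhs_ballP[r /= r0 H].
have [s s0 K] := cf _ r0; exists s => // w /K.
rewrite cabs_realB => fw; rewrite cabs_realB.
by rewrite distrC; apply: H; rewrite /ball /= distrC.
Qed.

End Generic.

Lemma ccont_id z : econt cdist id z.
Proof. by move=> e e0; exists e. Qed.

Lemma rcontP (f : R -> R) t :
  econt rdist (fun s => (f s)%:C) t <-> {for t, continuous f}.
Proof.
split.
  move=> cf; apply/cvgrPdist_lt => e e0.
  have [r r0 H] := cf _ e0.
  apply/nbhs_ballP; exists r => //= s.
  rewrite /ball /= distrC => /H; rewrite -rmorphB cabs_real.
  by rewrite distrC.
move=> cf; apply: (econt_real cf) => e e0; exists e => // s.
by rewrite cabs_realB.
Qed.

Lemma rcont_Re (f : R -> R[i]) t : econt rdist f t ->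
  {for t, continuous (fun s => complex.Re (f s))}.
Proof. by move=> h; apply/rcontP; exact: econt_Re. Qed.

Lemma rcont_Im (f : R -> R[i]) t : econt rdist f t ->
  {for t, continuous (fun s => complex.Im (f s))}.
Proof. by move=> h; apply/rcontP; exact: econt_Im. Qed.

(** Caratheodory's form of complex differentiability: the difference quotient
   extends continuously. It makes the calculus rules purely algebraic. *)
Definition cdiff (f : R[i] -> R[i]) (z : R[i]) :=
  exists2 g, econt cdist g z & forall w, f w = f z + g w * (w - z).

Lemma cdiff_cont f z : cdiff f z -> econt cdist f z.
Proof.
case=> g cg fE.
have : econt cdist (fun w => f z + g w * (w - z)) z.
  apply: econtD; first exact: econt_cst.
  apply: econtM => //; apply: econtB; [exact: ccont_id|exact: econt_cst].
by under eq_fun do rewrite -fE.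
Qed.

Lemma cdiff_cst c z : cdiff (fun=> c) z.
Proof. by exists (fun=> 0); [exact: econt_cst|move=> w; rewrite mul0r addr0]. Qed.

Lemma cdiff_id z : cdiff id z.
Proof. by exists (fun=> 1); [exact: econt_cst|move=> w; rewrite mul1r addrC subrK]. Qed.

Lemma cdiffN f z : cdiff f z -> cdiff (fun w => - f w) z.
Proof.
case=> g cg fE; exists (fun w => - g w); first exact: econtN.
by move=> w; rewrite fE mulNr opprD.
Qed.

Lemma cdiffD f1 f2 z : cdiff f1 z -> cdiff f2 z -> cdiff (fun w => f1 w + f2 w) z.
Proof.
case=> g cg fE [g' cg' fE']; exists (fun w => g w + g' w); first exact: econtD.
by move=> w; rewrite fE fE'; ring.
Qed.

Lemma cdiffB f1 f2 z : cdiff f1 z -> cdiff f2 z -> cdiff (fun w => f1 w - f2 w) z.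
Proof. by move=> h1 /cdiffN; exact: cdiffD. Qed.

Lemma cdiffM f1 f2 z : cdiff f1 z -> cdiff f2 z -> cdiff (fun w => f1 w * f2 w) z.
Proof.
move=> [g cg fE] h2; have [g' cg' fE'] := h2.
exists (fun w => g w * f2 w + f1 z * g' w).
  apply: econtD; apply: econtM => //; [exact: cdiff_cont|exact: econt_cst].
by move=> w; rewrite (fE w) (fE' w); ring.
Qed.

Lemma cdiff_comp f1 f2 z : cdiff f1 z -> cdiff f2 (f1 z) ->
  cdiff (fun w => f2 (f1 w)) z.
Proof.
move=> h1 [g' cg' fE']; have [g cg fE] := h1.
exists (fun w => g' (f1 w) * g w).
  by apply: econtM => //; apply: (econt_comp _ cg'); exact: cdiff_cont.
by move=> w; rewrite (fE' (f1 w)) {2}(fE w); ring.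
Qed.

(** Away from the point itself the difference quotient is determined by the
function. *)
Lemma cdiff_near f1 f2 z : (exists2 r, 0 < r & forall w, cabs (w - z) < r -> f1 w = f2 w) ->
  cdiff f1 z -> cdiff f2 z.
Proof.
move=> [r r0 f12] [g cg fE].
exists (fun w => if w == z then g z else (f2 w - f2 z) / (w - z)); last first.
  move=> w; case: eqP => [->|/eqP wz]; first by rewrite subrr mulr0 addr0.
  by field; rewrite subr_eq0.
apply: (econt_near _ _ cg); first by rewrite /cdist subrr cabs0.
exists r => // w /f12 f2w; case: eqP => [->//|/eqP wz].
rewrite -f2w -f12 ?subrr ?cabs0// [in RHS]fE.
by field; rewrite subr_eq0.
Qed.

Lemma cdiff_inv z : z != 0 -> cdiff (fun w => w^-1) z.
Proof.
move=> z0; have z0' : 0 < cabs z by rewrite cabs_gt0.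
have fin : forall w, cabs (w - z) < cabs z -> w != 0.
  by move=> w; apply: contraTneq => ->; rewrite sub0r cabsN ltxx.
exists (fun w => if w == 0 then - z^-1 * (- z)^-1 else - z^-1 / w); last first.
  move=> w; case: eqP => [->|/eqP w0]; first by rewrite invr0 sub0r; field.
  by field; rewrite w0.
apply: (@econt_near _ _ (fun w => - z^-1 / w)); first by rewrite /cdist subrr cabs0.
  by exists (cabs z) => // w /fin/negPf ->.
by apply: econtM; [exact: econt_cst|apply: econtV => //; exact: ccont_id].
Qed.

Lemma cdiffV f z : f z != 0 -> cdiff f z -> cdiff (fun w => (f w)^-1) z.
Proof. by move=> fz0 df; apply: (cdiff_comp df); exact: cdiff_inv. Qed.

Lemma cdiff_horner (p : {poly R[i]}) z : cdiff (fun w => p.[w]) z.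
Proof.
elim/poly_ind: p => [|p c ih].
  by under eq_fun do rewrite horner0; exact: cdiff_cst.
under eq_fun do rewrite hornerD hornerM hornerX hornerC.
by apply: cdiffD; [apply: cdiffM => //; exact: cdiff_id|exact: cdiff_cst].
Qed.

Lemma cdiffX f z n : cdiff f z -> cdiff (fun w => f w ^+ n) z.
Proof.
move=> df; elim: n => [|n ih]; first exact: cdiff_cst.
by under eq_fun do rewrite exprS; exact: cdiffM.
Qed.

Lemma cdiff_expz z (n : int) : z != 0 -> cdiff (fun w => w ^ n) z.
Proof.
move=> z0; case: n => n; first by apply: cdiffX; exact: cdiff_id.
by apply: cdiffV; [rewrite expf_neq0|apply: cdiffX; exact: cdiff_id].
Qed.

Lemma nbhsC (z : R[i]) (A : set R[i]) : nbhs z A <->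
  exists2 e : R, 0 < e & forall w, cabs (w - z) < e -> A w.
Proof.
split=> [/nbhs_ballP[e e0 H]|[e e0 H]].
  exists (complex.Re e).
    by move: e0; rewrite /= ltcE => /andP[].
  move=> w wz; apply: H; rewrite /ball /=.
  have e0' : 0 < e := e0.
  move: e0'; rewrite ltcE => /andP[/eqP/= ei er].
  have -> : e = (complex.Re e)%:C by case: (e) ei => ? ? /= ->.
  by rewrite cabs_norm ltcR cabsC.
apply/nbhs_ballP; exists e%:C; first by rewrite /= ltcR.
move=> w; rewrite /ball /= cabs_norm ltcR => wz; apply: H.
by rewrite cabsC.
Qed.

(** The difference quotient, completed by the derivative at the point itself. *)
Lemma derivable_cdiff (f : R[i] -> R[i]) (z : R[i]) : derivable f z 1 ->
  exists2 g, econt cdist g z /\ g z = derive1 f z &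
    forall w, f w = f z + g w * (w - z).
Proof.
move=> df.
have -> : derive1 f z = derive f z 1.
  rewrite /derive1 /derive.
  suff -> : (fun h => h^-1 *: (f (h + z) - f z)) =
    (fun h => h^-1 *: ((f \o shift z) (h *: 1) - f z)) by [].
  by apply/funext => h /=; rewrite /GRing.scale /= mulr1.
exists (fun w => if w == z then derive f z 1 else (f w - f z) / (w - z)).
  split; last by rewrite eqxx.
  move=> e e0.
  have : nbhs (derive f z 1) [set w | cabs (w - derive f z 1) < e].
    by apply/nbhsC; exists e.
  move=> /df /nbhsC[r r0 H]; exists r => // w wr; rewrite eqxx.
  have [wz|/eqP wz] := pselect (w = z); first by rewrite wz eqxx subrr cabs0.
  rewrite (negPf wz); have := H (w - z); rewrite subr0 => /(_ wr); rewrite subr_eq0 => /(_ wz) /=.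
  rewrite [X in f (X + _)](_ : _ = w - z); last by rewrite /GRing.scale/= mulr1.
  by rewrite subrK /GRing.scale/= mulrC.
move=> w; have [->|wz] := eqVneq w z; first by rewrite subrr mulr0 addr0.
by field; rewrite subr_eq0.
Qed.

End Continuity.

(** * The complex exponential *)
Section Exponential.
Context {R : realType}.
Implicit Types (x y t : R) (z w : R[i]).

Lemma complexD (a b c e : R) : (a +i* b) + (c +i* e) = (a + c) +i* (b + e).
Proof. by []. Qed.

Lemma complexM (a b c e : R) :
  (a +i* b) * (c +i* e) = (a * c - b * e) +i* (a * e + b * c).
Proof. by []. Qed.

Lemma cisD t s : cis (t + s) = cis t * cis s.
Proof. by rewrite /cis complexM cosD sinD; congr (_ +i* _); ring. Qed.

Lemma cis0 : cis 0 = 1 :> R[i].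
Proof. by rewrite /cis cos0 sin0. Qed.

Lemma cabs_cis t : cabs (cis t) = 1.
Proof. by rewrite /cis /Normc.normc cos2Dsin2 sqrtr1. Qed.

Lemma cis_neq0 t : cis t != 0.
Proof. by rewrite -cabs_gt0 cabs_cis. Qed.

Lemma cisN t : cis (- t) = (cis t)^-1.
Proof. by apply: (mulIf (cis_neq0 t)); rewrite -cisD addNr cis0 mulVf// cis_neq0. Qed.

Lemma cis_conj t : (cis t)^* = (cis t)^-1.
Proof. by rewrite -cisN /cis cosN sinN. Qed.

Lemma cis_2pi : cis (2 * pi) = 1 :> R[i].
Proof. by rewrite /cis mulrC mulr_natr cos2pi sin2pi. Qed.

Lemma cisX t n : cis t ^+ n = cis (n%:R * t).
Proof.
elim: n => [|n ih]; first by rewrite mul0r cis0.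
by rewrite exprS ih -cisD -natr1 mulrDl mul1r addrC.
Qed.

Lemma cisXz t (n : int) : cis t ^ n = cis (n%:~R * t).
Proof.
case: n => n; first by rewrite -exprnP cisX.
by rewrite NegzE -exprz_inv -exprnP exprVn cisX -cisN mulrNz mulNr.
Qed.

Lemma cis_surj z : cabs z = 1 -> exists2 t, t \in `[0, 2 * pi] & z = cis t.
Proof.
case: z => a b ab; have /(congr1 (fun x => x ^+ 2)) := ab; rewrite cabs_sqr /= expr1n => ab1.
have a11 : -1 <= a <= 1.
  rewrite -ler_norml -(@ler_pXn2r _ 2) ?nnegrE// expr1n real_normK ?num_real//.
  by rewrite -ab1 lerDl sqr_ge0.
have [b0|b0] := leP 0 b.
  exists (acos a).
    by rewrite in_itv/= acos_ge0//=; have := acos_lepi a11; have := pi_ge0 R; lra.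
  rewrite /cis acosK// sin_acos//; congr (_ +i* _).
  by rewrite -ab1 addrAC subrr add0r sqrtr_sqr ger0_norm.
exists (2 * pi - acos a).
  rewrite in_itv/=; have := acos_ge0 a11; have := acos_lepi a11; have := pi_ge0 R; lra.
rewrite cisD cis_2pi mul1r /cis cosN sinN acosK// sin_acos//; congr (_ +i* _).
by rewrite -ab1 addrAC subrr add0r sqrtr_sqr ltr0_norm// opprK.
Qed.

Lemma rcont_cis t : econt rdist cis t.
Proof.
have -> : cis = (fun s => (cos s)%:C + (0 +i* 1) * (sin s)%:C) :> (R -> R[i]).
  by apply/funext => s; rewrite /cis complexM complexD; congr (_ +i* _); ring.
apply: econtD; first by apply/rcontP; exact: continuous_cos.
by apply: econtM; [exact: econt_cst|apply/rcontP; exact: continuous_sin].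
Qed.

Lemma cexpD z w : cexp (z + w) = cexp z * cexp w.
Proof.
rewrite /cexp ReD ImD expRD cisD rmorphM; ring.
Qed.

Lemma cexp0 : cexp 0 = 1 :> R[i].
Proof. by rewrite /cexp /= expR0 cis0 mulr1. Qed.

Lemma cabs_cexp z : cabs (cexp z) = expR (complex.Re z).
Proof. by rewrite /cexp cabsM cabs_cis mulr1 cabs_real ger0_norm// expR_ge0. Qed.

Lemma cexp_neq0 z : cexp z != 0.
Proof. by rewrite -cabs_gt0 cabs_cexp expR_gt0. Qed.

Lemma cexp_real x : cexp x%:C = (expR x)%:C.
Proof. by rewrite /cexp /= cis0 mulr1. Qed.

Lemma cexp_polar x y : cexp (x +i* y) = (expR x)%:C * cis y.
Proof. by []. Qed.

Lemma is_derive_estimate (f : R -> R) (l : R) : is_derive (0 : R) (1 : R) f l ->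
  forall e, 0 < e -> exists2 r, 0 < r & forall h, `|h| < r -> `|f h - f 0 - l * h| <= e * `|h|.
Proof.
move=> [df dfl] e e0.
have := df; rewrite /derivable => /cvgrPdist_le /(_ e e0).
rewrite -/(derive f 0 1) dfl => /nbhs_ballP[r /= r0 H]; exists r => // h hr.
have [->|h0] := eqVneq h 0; first by rewrite subrr mulr0 subr0 normr0 mulr0.
have : ball 0 r h by rewrite /ball /= sub0r normrN.
move=> /H /(_ h0) /=; rewrite /GRing.scale /= mulr1 addr0 => hh.
rewrite -ler_pdivrMr ?normr_gt0// -normf_div.
apply: le_trans hh; rewrite distrC le_eqVlt; apply/orP; left; apply/eqP; congr (`| _ |).
by field.
Qed.

(** By [cexpD] only the origin matters, where the real exponential and the two
trigonometric functions are compared with their linear parts. *)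
Lemma cdiff_cexp z : cdiff cexp z.
Proof.
have [g cg gE] : exists2 g : R[i] -> R[i], econt cdist g 0 & forall h, cexp h = 1 + g h * h.
  exists (fun h => if h == 0 then 1 else (cexp h - 1) / h); last first.
    move=> h; case: eqP => [->|/eqP h0]; first by rewrite mulr0 addr0 cexp0.
    by field.
  move=> e e0; rewrite eqxx.
  pose e' := Order.min 1 (e / 10); have e'0 : 0 < e' by rewrite lt_min ltr01 divr_gt0.
  have [r1 r10 H1] := is_derive_estimate (is_derive_expR 0) e'0.
  have [r2 r20 H2] := is_derive_estimate (is_derive_cos 0) e'0.
  have [r3 r30 H3] := is_derive_estimate (is_derive_sin 0) e'0.
  rewrite expR0 in H1; rewrite cos0 sin0 in H2; rewrite sin0 cos0 in H3.
  pose r4 := Order.min (1/2) (e' / 2).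
  have r40 : 0 < r4 by rewrite lt_min !divr_gt0.
  exists (Order.min (Order.min r1 r2) (Order.min r3 r4)); first by rewrite !lt_min r10 r20 r30 -lt_min.
  move=> w; rewrite /cdist subr0 !lt_min => /andP[/andP[w1 w2] /andP[w3 /andP[w4 w5]]].
  case: eqP => [_|/eqP w0]; first by rewrite subrr cabs0.
  have -> : (cexp w - 1) / w - 1 = (cexp w - 1 - w) / w by field.
  rewrite cabsM cabsV ltr_pdivrMr ?cabs_gt0//.
  have e'1 : e' <= 1 by rewrite ge_min lexx.
  have e'e : e' <= e / 10 by rewrite ge_min lexx orbT.
  have RX := Re_le_cabs w; have IX := Im_le_cabs w.
  set x := complex.Re w in RX *; set y := complex.Im w in IX *.
  have A := H1 _ (le_lt_trans RX w1); have B := H2 _ (le_lt_trans IX w2).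
  have C := H3 _ (le_lt_trans IX w3).
  have -> : cexp w - 1 - w = ((expR x - 1 - 1 * x) + expR x * (cos y - 1 - - 0 * y)) +i*
     (expR x * (sin y - 0 - 1 * y) + (expR x - 1) * y).
    rewrite /cexp /cis -/x -/y (_ : w = x +i* y); last by rewrite /x /y; case: (w).
    rewrite -[1 in LHS]/(1 +i* 0) complexM; congr (_ +i* _); ring.
  apply: le_lt_trans (cabs_le_ReIm _) _ => /=.
  set X := cabs w in w1 w2 w3 w4 w5 RX IX *.
  have X0 : 0 < X by rewrite cabs_gt0.
  have ex1 : `|expR x - 1| <= 2 * X.
    have -> : expR x - 1 = (expR x - 1 - 1 * x) + x by ring.
    apply: le_trans (ler_normD _ _) _.
    have : e' * `|x| <= 1 * X by apply: ler_pM => //; exact: ltW.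
    clear -A RX; lra.
  have ex2 : `|expR x| <= 2.
    have -> : expR x = (expR x - 1) + 1 by ring.
    apply: le_trans (ler_normD _ _) _; rewrite normr1; clear -ex1 w4; lra.
  have ey : e' * `|y| <= e' * X by rewrite ler_pM2l.
  have exx : e' * `|x| <= e' * X by rewrite ler_pM2l.
  have t1 : `|(expR x - 1 - 1 * x) + expR x * (cos y - 1 - - 0 * y)| <= 3 * (e' * X).
    apply: le_trans (ler_normD _ _) _; rewrite normrM.
    have : `|expR x| * `|cos y - 1 - - 0 * y| <= 2 * (e' * X).
      by apply: ler_pM => //; exact: le_trans B ey.
    clear -A exx; lra.
  have t2 : `|expR x * (sin y - 0 - 1 * y) + (expR x - 1) * y| <= 3 * (e' * X).
    apply: le_trans (ler_normD _ _) _; rewrite !normrM.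
    have : `|expR x| * `|sin y - 0 - 1 * y| <= 2 * (e' * X).
      by apply: ler_pM => //; exact: le_trans C ey.
    have : `|expR x - 1| * `|y| <= e' * X.
      by apply: ler_pM => //; apply: le_trans ex1 _; clear -w5; lra.
    clear -e; lra.
  have eX : e' * X <= e / 10 * X by rewrite ler_pM2r.
  have eX0 : 0 < e * X by exact: mulr_gt0.
  clear -t1 t2 eX eX0; lra.
exists (fun w => cexp z * g (w - z)).
  apply: econtM; first exact: econt_cst.
  apply: econt_comp; last by rewrite subrr.
  by apply: econtB; [exact: ccont_id|exact: econt_cst].
move=> w; have {1}-> : w = z + (w - z) by rewrite addrC subrK.
by rewrite cexpD (gE (w - z)); ring.
Qed.

End Exponential.

(** * Complex-valued integrals *)
Section ComplexIntegral.
Context {R : realType}.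

Lemma measurable_inv : measurable_fun [set: R] (fun x : R => x^-1).
Proof.
have -> : [set: R] = `]-oo, 0[%classic `|` ([set 0] `|` `]0, +oo[%classic).
  apply/seteqP; split => // x _ /=; rewrite !in_itv /= andbT.
  by case: (ltgtP x 0); [left|right; right|right; left].
apply/measurable_funU => //; first exact: measurableU.
split; last (apply/measurable_funU => //; split).
- apply: open_continuous_measurable_fun; first exact: interval_open.
  by move=> x; rewrite inE/= in_itv/= => x0; apply: inv_continuous; rewrite lt_eqF.
- exact: measurable_fun_set1.
- apply: open_continuous_measurable_fun; first exact: interval_open.
  by move=> x; rewrite inE/= in_itv/= andbT => x0; apply: inv_continuous; rewrite gt_eqF.
Qed.

Section Measurable.
Context d (T : measurableType d) (D : set T).
Implicit Types f g : T -> R[i].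

Definition cmeas f := measurable_fun D (fun t => complex.Re (f t)) /\
  measurable_fun D (fun t => complex.Im (f t)).

Lemma cmeas_cst c : cmeas (fun=> c).
Proof. by split; exact: measurable_cst. Qed.

Lemma cmeasD f g : cmeas f -> cmeas g -> cmeas (fun t => f t + g t).
Proof.
move=> [? ?] [? ?]; split.
  by under eq_fun do rewrite ReD; exact: measurable_funD.
by under eq_fun do rewrite ImD; exact: measurable_funD.
Qed.

Lemma cmeasN f : cmeas f -> cmeas (fun t => - f t).
Proof.
move=> [? ?]; split.
  by under eq_fun do rewrite ReN; exact: measurableT_comp.
by under eq_fun do rewrite ImN; exact: measurableT_comp.
Qed.

Lemma cmeasB f g : cmeas f -> cmeas g -> cmeas (fun t => f t - g t).
Proof. by move=> mf /cmeasN; exact: cmeasD. Qed.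

Lemma cmeasM f g : cmeas f -> cmeas g -> cmeas (fun t => f t * g t).
Proof.
move=> [? ?] [? ?]; split.
  under eq_fun do rewrite ReM.
  by apply: measurable_funB; exact: measurable_funM.
under eq_fun do rewrite ImM.
by apply: measurable_funD; exact: measurable_funM.
Qed.

Lemma cmeasV f : cmeas f -> cmeas (fun t => (f t)^-1).
Proof.
move=> [mR mI].
have mN : measurable_fun D (fun t => (complex.Re (f t) ^+ 2 + complex.Im (f t) ^+ 2)^-1).
  apply: (measurableT_comp measurable_inv).
  by apply: measurable_funD; exact: measurable_funX.
split.
  under eq_fun => t do have -> : complex.Re (f t)^-1 = complex.Re (f t) *
    (complex.Re (f t) ^+ 2 + complex.Im (f t) ^+ 2)^-1 by case: (f t).
  exact: measurable_funM.
under eq_fun => t do have -> : complex.Im (f t)^-1 = - (complex.Im (f t) *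
    (complex.Re (f t) ^+ 2 + complex.Im (f t) ^+ 2)^-1) by case: (f t).
by apply: measurableT_comp => //; exact: measurable_funM.
Qed.

Lemma cmeas_real (f : T -> R) : measurable_fun D f -> cmeas (fun t => (f t)%:C).
Proof. by move=> mf; split => //; exact: measurable_cst. Qed.

Lemma cmeas_conj f : cmeas f -> cmeas (fun t => (f t)^*).
Proof.
move=> [mR mI]; split.
  by under eq_fun => t do have -> : complex.Re (f t)^* = complex.Re (f t) by case: (f t).
under eq_fun => t do have -> : complex.Im (f t)^* = - complex.Im (f t) by case: (f t).
exact: measurableT_comp.
Qed.

Lemma cmeas_abs f : cmeas f -> measurable_fun D (fun t => cabs (f t)).
Proof.
move=> [mR mI].
under eq_fun => t do have -> : cabs (f t) =
  Num.sqrt (complex.Re (f t) ^+ 2 + complex.Im (f t) ^+ 2) by case: (f t).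
apply: (measurableT_comp (continuous_measurable_fun (@sqrt_continuous R))).
by apply: measurable_funD; exact: measurable_funX.
Qed.

End Measurable.

Section Integral.
Context d (T : measurableType d) (mu : {measure set T -> \bar R}) (D : set T).
Hypothesis mD : measurable D.
Implicit Types f g : T -> R[i].

Definition Cint (f : T -> R[i]) : R[i] :=
  Rintegral mu D (fun t => complex.Re (f t)) +i*
  Rintegral mu D (fun t => complex.Im (f t)).

Definition cintegrable f := mu.-integrable D (EFin \o (fun t => complex.Re (f t))) /\
  mu.-integrable D (EFin \o (fun t => complex.Im (f t))).

Lemma eq_Cint f g : (forall t, D t -> f t = g t) -> Cint f = Cint g.
Proof.
by move=> fg; rewrite /Cint; congr (_ +i* _); apply: eq_Rintegral => t /[!inE] /fg ->.
Qed.

Lemma cintegrableD f g : cintegrable f -> cintegrable g -> cintegrable (fun t => f t + g t).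
Proof.
move=> [f1 f2] [g1 g2]; split.
  rewrite (_ : _ \o _ = (EFin \o (fun t => complex.Re (f t))) \+
     (EFin \o (fun t => complex.Re (g t)))); last by apply/funext => t /=; rewrite ReD.
  exact: integrableD.
rewrite (_ : _ \o _ = (EFin \o (fun t => complex.Im (f t))) \+
   (EFin \o (fun t => complex.Im (g t)))); last by apply/funext => t /=; rewrite ImD.
exact: integrableD.
Qed.

Lemma CintD f g : cintegrable f -> cintegrable g ->
  Cint (fun t => f t + g t) = Cint f + Cint g.
Proof.
move=> [f1 f2] [g1 g2]; rewrite /Cint complexD; congr (_ +i* _).
  by under eq_Rintegral do rewrite ReD; rewrite RintegralD.
by under eq_Rintegral do rewrite ImD; rewrite RintegralD.
Qed.

Lemma cintegrableZ c f : cintegrable f -> cintegrable (fun t => c * f t).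
Proof.
move=> [f1 f2]; split.
  rewrite (_ : _ \o _ = (fun t => (complex.Re c)%:E * (EFin \o (fun t => complex.Re (f t))) t) \-
     (fun t => (complex.Im c)%:E * (EFin \o (fun t => complex.Im (f t))) t))%E; last first.
    by apply/funext => t /=; rewrite ReM EFinB !EFinM.
  by apply: integrableB => //; exact: integrableZl.
rewrite (_ : _ \o _ = (fun t => (complex.Re c)%:E * (EFin \o (fun t => complex.Im (f t))) t) \+
   (fun t => (complex.Im c)%:E * (EFin \o (fun t => complex.Re (f t))) t))%E; last first.
  by apply/funext => t /=; rewrite ImM EFinD !EFinM.
by apply: integrableD => //; exact: integrableZl.
Qed.

Lemma CintZ c f : cintegrable f -> Cint (fun t => c * f t) = c * Cint f.
Proof.
move=> [f1 f2]; case: c => a b; rewrite /Cint complexM.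
have Z r (h : T -> R) : mu.-integrable D (EFin \o h) ->
    mu.-integrable D (EFin \o (fun t => r * h t)).
  move=> ih; rewrite (_ : _ \o _ = (fun t => r%:E * (EFin \o h) t)%E).
    exact: integrableZl.
  by apply/funext => t /=; rewrite EFinM.
congr (_ +i* _).
  under eq_Rintegral do rewrite ReM /=.
  by rewrite RintegralB ?RintegralZl//; exact: Z.
under eq_Rintegral do rewrite ImM /=.
by rewrite RintegralD ?RintegralZl//; exact: Z.
Qed.

Lemma cintegrableN f : cintegrable f -> cintegrable (fun t => - f t).
Proof. by move=> /(cintegrableZ (-1)); under eq_fun do rewrite mulN1r. Qed.

Lemma cintegrableB f g : cintegrable f -> cintegrable g -> cintegrable (fun t => f t - g t).
Proof. by move=> ? /cintegrableN; exact: cintegrableD. Qed.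

Lemma CintB f g : cintegrable f -> cintegrable g ->
  Cint (fun t => f t - g t) = Cint f - Cint g.
Proof.
move=> fi gi; rewrite CintD//; last exact: cintegrableN.
congr (_ + _); rewrite -[RHS]mulN1r -CintZ//.
by apply: eq_Cint => t _; rewrite mulN1r.
Qed.

Lemma Cint_cst c : Cint (fun=> c) = c * (fine (mu D))%:C.
Proof.
case: c => a b; rewrite /Cint !Rintegral_cst//= complexM.
by congr (_ +i* _); rewrite mulr0 ?subr0 ?add0r.
Qed.

Lemma cmeas_integrable f M : (mu D < +oo)%E -> cmeas D f ->
  (forall t, D t -> cabs (f t) <= M) -> cintegrable f.
Proof.
move=> fD [mR mI] fM; split; apply: measurable_bounded_integrable => //;
  exists M; split; rewrite ?num_real// => x Mx y /= /fM fy.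
  exact: le_trans (Re_le_cabs _) (le_trans fy (ltW Mx)).
exact: le_trans (Im_le_cabs _) (le_trans fy (ltW Mx)).
Qed.

Lemma cintegrable_cst c : (mu D < +oo)%E -> cintegrable (fun=> c).
Proof. by move=> fD; apply: (@cmeas_integrable _ (cabs c)) => //; exact: cmeas_cst. Qed.

Lemma cintegrable_le f (u : T -> R) : cmeas D f -> mu.-integrable D (EFin \o u) ->
  (forall t, D t -> cabs (f t) <= u t) -> cintegrable f.
Proof.
move=> [mR mI] iu fu; split; apply: (le_integrable mD _ _ iu) => //;
  try exact/measurable_EFinP.
  move=> t Dt /=; have ft := fu _ Dt; rewrite lee_fin; apply: le_trans (Re_le_cabs _) _.
  by apply: le_trans ft _; exact: ler_norm.
move=> t Dt /=; have ft := fu _ Dt; rewrite lee_fin; apply: le_trans (Im_le_cabs _) _.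
by apply: le_trans ft _; exact: ler_norm.
Qed.

(** The factor 2 comes from bounding the real and the imaginary part separately. *)
Lemma Cint_le f (u : T -> R) : cintegrable f -> mu.-integrable D (EFin \o u) ->
  (forall t, D t -> cabs (f t) <= u t) ->
  cabs (Cint f) <= 2 * Rintegral mu D u.
Proof.
move=> [f1 f2] iu fu.
apply: le_trans (cabs_le_ReIm _) _ => /=; rewrite mulr_natl mulr2n.
by apply: lerD; (apply: le_trans (le_normr_Rintegral _ _) _ => //);
  apply: le_Rintegral => //; try exact: integrable_norm;
  move=> t /fu ft; apply: le_trans ft; [exact: Re_le_cabs|exact: Im_le_cabs].
Qed.

Lemma Cint_le_cst f M : (mu D < +oo)%E -> cintegrable f ->
  (forall t, D t -> cabs (f t) <= M) ->
  cabs (Cint f) <= 2 * M * fine (mu D).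
Proof.
move=> fD fi fM; rewrite -mulrA -Rintegral_cst//.
apply: Cint_le => //; apply: measurable_bounded_integrable => //.
exists `|M|; split; rewrite ?num_real// => x Mx y _ /=.
exact: ltW.
Qed.

End Integral.
End ComplexIntegral.

(** * Goursat's theorem and circular means *)
Section Goursat.
Context {R : realType}.
Notation mu := (@lebesgue_measure R).
Implicit Types (f g : R -> R[i]) (a b c : R).

Definition Lint a b f := Cint mu `[a, b]%classic f.

Lemma fine_itv a b : a <= b -> fine (mu `[a, b]%classic) = b - a.
Proof.
move=> ab; rewrite lebesgue_measure_itv /= lte_fin; case: ltP => //= ba.
by apply/esym/eqP; rewrite subr_eq0 eq_le ba ab.
Qed.

Lemma itv_lty a b : (mu `[a, b]%classic < +oo)%E.
Proof. by rewrite lebesgue_measure_itv /= lte_fin; case: ifP => // _; rewrite ltry. Qed.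

Lemma Lint_integrable a b f : (forall t, a <= t <= b -> econt rdist f t) ->
  cintegrable mu `[a, b]%classic f.
Proof.
move=> cf; split; apply: continuous_compact_integrable; try exact: segment_compact;
  apply: continuous_in_subspaceT => t; rewrite inE /= in_itv /= => /cf ct.
  exact: rcont_Re.
exact: rcont_Im.
Qed.

Lemma Lint_split a c b f : a <= c <= b -> (forall t, a <= t <= b -> econt rdist f t) ->
  Lint a b f = Lint a c f + Lint c b f.
Proof.
move=> /andP[ac cb] cf; have [iR iI] := Lint_integrable cf.
have S h : mu.-integrable `[a, b] (EFin \o h) ->
    Rintegral mu `[a, b] h = Rintegral mu `[a, c] h + Rintegral mu `[c, b] h.
  move=> ih; have := @Rintegral_itvB _ h (BLeft a) (BRight b) c ih.
  rewrite !bnd_simp => /(_ ac cb) /eqP; rewrite subr_eq addrC => /eqP ->.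
  congr (_ + _); apply: Rintegral_itv_obnd_cbnd.
  apply: integrableS ih => //; apply: subset_itvr; first by rewrite bnd_simp.
by rewrite /Lint /Cint complexD -!S.
Qed.

Lemma Lint_le a b f M : a <= b -> (forall t, a <= t <= b -> econt rdist f t) ->
  (forall t, a <= t <= b -> cabs (f t) <= M) -> cabs (Lint a b f) <= 2 * M * (b - a).
Proof.
move=> ab cf fM; rewrite -(fine_itv ab); apply: Cint_le_cst => //.
  exact: itv_lty.
exact: Lint_integrable.
Qed.

(** The integral of [phi] along the boundary of a rectangle with lower left
corner [x + i y] and sides [l] and [m], counterclockwise; opposite sides are
paired. *)
Definition rect_integral (phi : R[i] -> R[i]) (x y l m : R) : R[i] :=
  Lint x (x + l) (fun s => phi (s +i* y) - phi (s +i* (y + m))) +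
  (0 +i* 1) * Lint y (y + m) (fun t => phi ((x + l) +i* t) - phi (x +i* t)).

Definition in_rect (x y l m : R) (z : R[i]) :=
  x <= complex.Re z <= x + l /\ y <= complex.Im z <= y + m.

Lemma rcont_hline (y s : R) : econt rdist (fun s => s +i* y) s.
Proof.
move=> e e0; exists e => // w; rewrite /rdist => ws.
rewrite (_ : _ - _ = (w - s)%:C); first by rewrite cabs_real.
by apply/eqP; rewrite eq_complex /= subrr !eqxx.
Qed.

Lemma rcont_vline (x t : R) : econt rdist (fun t => x +i* t) t.
Proof.
move=> e e0; exists e => // w; rewrite /rdist => ws.
apply: le_lt_trans (cabs_le_ReIm _) _ => /=.
by rewrite subrr normr0 add0r.
Qed.

Lemma rcont_horiz phi x y l m s y' : (forall z, in_rect x y l m z -> cdiff phi z) ->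
  x <= s <= x + l -> y <= y' <= y + m -> econt rdist (fun s => phi (s +i* y')) s.
Proof.
move=> dphi xs yy; apply: (econt_comp (f := fun s => s +i* y')); first exact: rcont_hline.
by apply: cdiff_cont; apply: dphi.
Qed.

Lemma rcont_vert phi x y l m x' t : (forall z, in_rect x y l m z -> cdiff phi z) ->
  x <= x' <= x + l -> y <= t <= y + m -> econt rdist (fun t => phi (x' +i* t)) t.
Proof.
move=> dphi xs yy; apply: (econt_comp (f := fun t => x' +i* t)); first exact: rcont_vline.
by apply: cdiff_cont; apply: dphi.
Qed.

Lemma rect_integral_split phi x y l m : 0 <= l -> 0 <= m ->
  (forall z, in_rect x y l m z -> cdiff phi z) ->
  rect_integral phi x y l m =
  rect_integral phi x y (l / 2) (m / 2) + rect_integral phi (x + l / 2) y (l / 2) (m / 2) +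
  (rect_integral phi x (y + m / 2) (l / 2) (m / 2) +
   rect_integral phi (x + l / 2) (y + m / 2) (l / 2) (m / 2)).
Proof.
move=> l0 m0 dphi; rewrite /rect_integral.
have xl : x + l / 2 + l / 2 = x + l by field.
have ym : y + m / 2 + m / 2 = y + m by field.
rewrite xl ym.
have H y1 y2 : y <= y1 <= y + m -> y <= y2 <= y + m ->
   forall s, x <= s <= x + l -> econt rdist (fun s => phi (s +i* y1) - phi (s +i* y2)) s.
  by move=> ? ? s ?; apply: econtB; exact: (rcont_horiz dphi).
have V x1 x2 : x <= x1 <= x + l -> x <= x2 <= x + l ->
   forall t, y <= t <= y + m -> econt rdist (fun t => phi (x1 +i* t) - phi (x2 +i* t)) t.
  by move=> ? ? s ?; apply: econtB; exact: (rcont_vert dphi).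
have HL a b y1 y2 : x <= a -> b <= x + l -> y <= y1 <= y + m -> y <= y2 <= y + m ->
   Lint a b (fun s => phi (s +i* y1) - phi (s +i* y2)) =
   Lint a b (fun s => phi (s +i* y1)) - Lint a b (fun s => phi (s +i* y2)).
  move=> xa bx ? ?; apply: CintB => //; apply: Lint_integrable => t /andP[ta tb];
    by apply: (rcont_horiz dphi) => //; rewrite (le_trans xa ta) (le_trans tb bx).
have VL a b x1 x2 : y <= a -> b <= y + m -> x <= x1 <= x + l -> x <= x2 <= x + l ->
   Lint a b (fun t => phi (x1 +i* t) - phi (x2 +i* t)) =
   Lint a b (fun t => phi (x1 +i* t)) - Lint a b (fun t => phi (x2 +i* t)).
  move=> xa bx ? ?; apply: CintB => //; apply: Lint_integrable => t /andP[ta tb];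
    by apply: (rcont_vert dphi) => //; rewrite (le_trans xa ta) (le_trans tb bx).
have l2 : 0 <= l / 2 by rewrite divr_ge0.
have m2 : 0 <= m / 2 by rewrite divr_ge0.
have x1 : x <= x by [].
have x2 : x <= x + l / 2 by rewrite lerDl.
have x3 : x + l / 2 <= x + l by rewrite -xl lerDl.
have x4 : x + l <= x + l by [].
have x5 : x <= x + l by exact: le_trans x3.
have y1 : y <= y by [].
have y2 : y <= y + m / 2 by rewrite lerDl.
have y3 : y + m / 2 <= y + m by rewrite -ym lerDl.
have y4 : y + m <= y + m by [].
have y5 : y <= y + m by exact: le_trans y3.
rewrite !HL ?VL ?lexx ?x2 ?y2 ?x5 ?y5//.
have HS y' : y <= y' <= y + m -> Lint x (x + l) (fun s => phi (s +i* y')) =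
   Lint x (x + l / 2) (fun s => phi (s +i* y')) + Lint (x + l / 2) (x + l) (fun s => phi (s +i* y')).
  by move=> ?; apply: Lint_split => [|t tx]; [rewrite x2|exact: (rcont_horiz dphi)].
have VS x' : x <= x' <= x + l -> Lint y (y + m) (fun s => phi (x' +i* s)) =
   Lint y (y + m / 2) (fun s => phi (x' +i* s)) + Lint (y + m / 2) (y + m) (fun s => phi (x' +i* s)).
  by move=> ?; apply: Lint_split => [|t tx]; [rewrite y2|exact: (rcont_vert dphi)].
rewrite !HS ?VS ?lexx ?x2 ?y2 ?x5 ?y5//.
clear; ring.
Qed.

Lemma rect_integral_quarter phi x y l m : 0 <= l -> 0 <= m ->
  (forall z, in_rect x y l m z -> cdiff phi z) ->
  exists p : R * R, [/\ x <= p.1 <= x + l / 2, y <= p.2 <= y + m / 2 &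
    cabs (rect_integral phi x y l m) / 4 <= cabs (rect_integral phi p.1 p.2 (l / 2) (m / 2))].
Proof.
move=> l0 m0 dphi; apply: contrapT => H.
set T := cabs _ in H.
have K x' y' : x <= x' <= x + l / 2 -> y <= y' <= y + m / 2 ->
    cabs (rect_integral phi x' y' (l / 2) (m / 2)) < T / 4.
  by move=> hx hy; rewrite ltNge; apply/negP => h; apply: H; exists (x', y').
suff : T < T by rewrite ltxx.
rewrite {1}/T (rect_integral_split l0 m0 dphi).
have l2 : 0 <= l / 2 by rewrite divr_ge0.
have m2 : 0 <= m / 2 by rewrite divr_ge0.
have x1 : x <= x <= x + l / 2 by rewrite lexx lerDl.
have x2 : x <= x + l / 2 <= x + l / 2 by rewrite lexx lerDl l2.
have y1 : y <= y <= y + m / 2 by rewrite lexx lerDl.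
have y2 : y <= y + m / 2 <= y + m / 2 by rewrite lexx lerDl m2.
have A := K _ _ x1 y1; have B := K _ _ x2 y1.
have C := K _ _ x1 y2; have D := K _ _ x2 y2.
apply: le_lt_trans (cabsD _ _) _.
apply: le_lt_trans (lerD (cabsD _ _) (cabsD _ _)) _.
have := ltrD (ltrD A B) (ltrD C D); move=> h; apply: lt_le_trans h _.
clear; lra.
Qed.

(** Affine functions have vanishing boundary integrals; here this follows by
direct integration, since the integrand only sees differences across the
rectangle. *)
Lemma rect_integral_affine phi A B x y l m : 0 <= l -> 0 <= m ->
  (forall z, in_rect x y l m z -> cdiff phi z) ->
  rect_integral (fun z => phi z - (A + B * z)) x y l m = rect_integral phi x y l m.
Proof.
move=> l0 m0 dphi; rewrite /rect_integral.
rewrite [X in X + _ = _](_ : _ = Lint x (x + l) (fun s => phi (s +i* y) - phi (s +i* (y + m)))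
   + B * (0 +i* 1) * m%:C * l%:C); last first.
  rewrite /Lint (_ : (fun s => _) = (fun s => (phi (s +i* y) - phi (s +i* (y + m))) + B * (0 +i* 1) * m%:C)).
    rewrite CintD//; last first.
    - by apply: cintegrable_cst => //; exact: itv_lty.
    - apply: Lint_integrable => t tab; apply: econtB; apply: (rcont_horiz dphi) => //; lra.
    by congr (_ + _); rewrite Cint_cst// fine_itv ?lerDl// addrAC subrr add0r.
  apply/funext => s; have -> : s +i* (y + m) = (s +i* y) + (0 +i* 1) * m%:C.
    by rewrite complexM complexD; congr (_ +i* _); ring.
  ring.
rewrite [X in _ + _ * X = _](_ : _ = Lint y (y + m) (fun t => phi ((x + l) +i* t) - phi (x +i* t))
   + (- B) * l%:C * m%:C); last first.
  rewrite /Lint (_ : (fun t => _) = (fun t => (phi ((x + l) +i* t) - phi (x +i* t)) + (- B) * l%:C)).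
    rewrite CintD//; last first.
    - by apply: cintegrable_cst => //; exact: itv_lty.
    - apply: Lint_integrable => t tab; apply: econtB; apply: (rcont_vert dphi) => //; lra.
    by congr (_ + _); rewrite Cint_cst// fine_itv ?lerDl// addrAC subrr add0r.
  apply/funext => t; have -> : (x + l) +i* t = (x +i* t) + l%:C.
    by rewrite complexD addr0.
  ring.
ring.
Qed.

Lemma rect_integral_le phi x y l m M : 0 <= l -> 0 <= m ->
  (forall z, in_rect x y l m z -> cdiff phi z) ->
  (forall z, in_rect x y l m z -> cabs (phi z) <= M) ->
  cabs (rect_integral phi x y l m) <= 4 * M * (l + m).
Proof.
move=> l0 m0 dphi phiM; rewrite /rect_integral.
have xl : x <= x + l by rewrite lerDl.
have ym : y <= y + m by rewrite lerDl.
have ir s t : x <= s <= x + l -> y <= t <= y + m -> in_rect x y l m (s +i* t) by [].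
have y1 : y <= y <= y + m by rewrite lexx.
have y2 : y <= y + m <= y + m by rewrite lexx andbT.
have x1 : x <= x <= x + l by rewrite lexx.
have x2 : x <= x + l <= x + l by rewrite lexx andbT.
apply: le_trans (cabsD _ _) _; rewrite cabsM.
have -> : cabs (0 +i* 1 : R[i]) = 1.
  by rewrite /Normc.normc expr0n /= add0r expr1n sqrtr1.
rewrite mul1r.
have -> : 4 * M * (l + m) = 2 * (M + M) * (x + l - x) + 2 * (M + M) * (y + m - y) by ring.
apply: lerD; apply: Lint_le => // t tx.
- by apply: econtB; exact: (rcont_horiz dphi).
- by apply: le_trans (cabsB _ _) _; apply: lerD; apply: phiM; exact: ir.
- by apply: econtB; exact: (rcont_vert dphi).
- by apply: le_trans (cabsB _ _) _; apply: lerD; apply: phiM; exact: ir.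
Qed.

(** Repeated quartering shrinks to a point, near which the function is affine up
to a small multiple of the diameter; this contradicts the lower bound for the
integrals over the quarters unless the integral vanishes. *)
Theorem goursat phi x y l m : 0 <= l -> 0 <= m ->
  (forall z, in_rect x y l m z -> cdiff phi z) -> rect_integral phi x y l m = 0.
Proof.
move=> l0 m0 dphi.
pose T := cabs (rect_integral phi x y l m).
pose len n := l / 2 ^+ n; pose wid n := m / 2 ^+ n.
have len0 n : 0 <= len n by rewrite divr_ge0// exprn_ge0.
have wid0 n : 0 <= wid n by rewrite divr_ge0// exprn_ge0.
have lenS n : len n.+1 = len n / 2 by rewrite /len exprS; field; rewrite expf_neq0.
have widS n : wid n.+1 = wid n / 2 by rewrite /wid exprS; field; rewrite expf_neq0.
pose inv n (p : R * R) := [/\ x <= p.1 /\ p.1 + len n <= x + l, y <= p.2 /\ p.2 + wid n <= y + m &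
  T / 4 ^+ n <= cabs (rect_integral phi p.1 p.2 (len n) (wid n))].
pose next n (p q : R * R) := [/\ p.1 <= q.1 /\ q.1 + len n.+1 <= p.1 + len n,
   p.2 <= q.2 /\ q.2 + wid n.+1 <= p.2 + wid n & inv n.+1 q].
have step n p : inv n p -> exists q, next n p q.
  case=> [[h1 h2] [h3 h4] h5].
  have dphi' : forall z, in_rect p.1 p.2 (len n) (wid n) z -> cdiff phi z.
    by move=> z [zx zy]; apply: dphi; split; [clear -h1 h2 zx; lra|clear -h3 h4 zy; lra].
  have [q [q1 q2 q3]] := rect_integral_quarter (len0 n) (wid0 n) dphi'.
  exists q; rewrite /next /inv lenS widS.
  have {}q1 : p.1 <= q.1 /\ q.1 + len n / 2 <= p.1 + len n by clear -q1; lra.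
  have {}q2 : p.2 <= q.2 /\ q.2 + wid n / 2 <= p.2 + wid n by clear -q2; lra.
  have r1 : x <= q.1 /\ q.1 + len n / 2 <= x + l by clear -q1 h1 h2; lra.
  have r2 : y <= q.2 /\ q.2 + wid n / 2 <= y + m by clear -q2 h3 h4; lra.
  have q4 : T / 4 ^+ n.+1 <= cabs (rect_integral phi q.1 q.2 (len n / 2) (wid n / 2)).
    apply: le_trans q3; rewrite exprS invfM mulrA mulrAC.
    by rewrite ler_pM2r ?invr_gt0.
  by split.
have inv0 : inv 0%N (x, y).
  by rewrite /inv /len /wid !expr0 !divr1 /=; split.
pose st n (p : R * R) := if pselect (inv n p) is left h then projT1 (cid (step n p h)) else p.
have [s invs] : exists s : nat -> R * R, forall n, inv n (s n) /\ next n (s n) (s n.+1).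
  pose s := fix s n := if n is n'.+1 then st n' (s n') else (x, y).
  exists s.
  have N k : inv k (s k) -> next k (s k) (s k.+1).
    by move=> ik /=; rewrite /st; case: pselect => // h; case: cid.
  elim=> [|n [ih1 ih2]]; first by split; [exact: inv0|exact: N inv0].
  have ih : inv n.+1 (s n.+1) by case: ih2.
  by split; [exact: ih|exact: N _ ih].
have mono n k : (s n).1 <= (s (n + k)%N).1 /\ (s (n + k)%N).1 + len (n + k)%N <= (s n).1 + len n
  /\ (s n).2 <= (s (n + k)%N).2 /\ (s (n + k)%N).2 + wid (n + k)%N <= (s n).2 + wid n.
  elim: k => [|k ih]; first by rewrite addn0.
  by rewrite addnS; have [_ [? ? _]] := invs (n + k)%N; lra.
have cross n k : (s n).1 <= (s k).1 + len k /\ (s n).2 <= (s k).2 + wid k.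
  have [nk|/ltnW kn] := leqP n k.
    have := mono n (k - n)%N; rewrite subnKC//.
    by have := len0 k; have := wid0 k; lra.
  have := mono k (n - k)%N; rewrite subnKC//.
  by have := len0 n; have := wid0 n; lra.
pose X := sup (range (fun n => (s n).1)); pose Y := sup (range (fun n => (s n).2)).
have XP n : (s n).1 <= X <= (s n).1 + len n.
  apply/andP; split.
    apply: ub_le_sup; last by exists n.
    by exists ((s 0%N).1 + len 0%N) => _ [k _ <-]; case: (cross k 0%N).
  apply: ge_sup; first by exists (s 0%N).1; exists 0%N.
  by move=> _ [k _ <-]; case: (cross k n).
have YP n : (s n).2 <= Y <= (s n).2 + wid n.
  apply/andP; split.
    apply: ub_le_sup; last by exists n.
    by exists ((s 0%N).2 + wid 0%N) => _ [k _ <-]; case: (cross k 0%N).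
  apply: ge_sup; first by exists (s 0%N).2; exists 0%N.
  by move=> _ [k _ <-]; case: (cross k n).
have [g cg gE] : cdiff phi (X +i* Y).
  have [[[h1 h2] [h3 h4] _] _] := invs 0%N.
  have /andP[X1 X2] := XP 0%N; have /andP[Y1 Y2] := YP 0%N.
  apply: dphi; split => /=.
    by rewrite (le_trans h1 X1) (le_trans X2 h2).
  by rewrite (le_trans h3 Y1) (le_trans Y2 h4).
have main e : 0 < e -> T <= 4 * e * (l + m) ^+ 2.
  move=> e0; have [r r0 H] := cg _ e0.
  have [n hn] : exists n, (l + m) / 2 ^+ n < r.
    exists (Num.bound ((l + m) / r)).
    rewrite ltr_pdivrMr ?exprn_gt0// mulrC -ltr_pdivrMr//.
    apply: lt_trans (archi_boundP (divr_ge0 (addr_ge0 l0 m0) (ltW r0))) _.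
    by rewrite -natrX ltr_nat ltn_expl.
  have [[h1 h2] [h3 h4] h5] := (invs n).1.
  set p := s n in h1 h2 h3 h4 h5 *.
  have dphi' z : in_rect p.1 p.2 (len n) (wid n) z -> cdiff phi z.
    by move=> [zx zy]; apply: dphi; split; [clear -h1 h2 zx; lra|clear -h3 h4 zy; lra].
  pose A := phi (X +i* Y) - g (X +i* Y) * (X +i* Y).
  pose B := g (X +i* Y).
  have dd z : in_rect p.1 p.2 (len n) (wid n) z -> cdiff (fun z => phi z - (A + B * z)) z.
    move=> hz; apply: cdiffB; first exact: dphi'.
    by apply: cdiffD; [exact: cdiff_cst|apply: cdiffM; [exact: cdiff_cst|exact: cdiff_id]].
  have lw : len n + wid n = (l + m) / 2 ^+ n by rewrite /len /wid -mulrDl.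
  have small z : in_rect p.1 p.2 (len n) (wid n) z ->
     cabs (phi z - (A + B * z)) <= e * (len n + wid n).
    move=> [zx zy].
    have zXY : cabs (z - (X +i* Y)) <= len n + wid n.
      apply: le_trans (cabs_le_ReIm _) _.
      have := XP n; have := YP n; rewrite -/p => hY hX.
      rewrite ReD ReN ImD ImN /=; apply: lerD; rewrite ler_norml.
        by clear -zx hX; lra.
      by clear -zy hY; lra.
    have -> : phi z - (A + B * z) = (g z - g (X +i* Y)) * (z - (X +i* Y)).
      by rewrite (gE z) /A /B; ring.
    rewrite cabsM; apply: ler_pM => //; try exact: cabs_ge0.
    by apply/ltW/H; apply: le_lt_trans zXY _; rewrite lw.
  have : cabs (rect_integral phi p.1 p.2 (len n) (wid n)) <= 4 * e * (len n + wid n) ^+ 2.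
    rewrite -(rect_integral_affine A B (len0 n) (wid0 n) dphi').
    apply: le_trans (rect_integral_le (len0 n) (wid0 n) dd small) _.
    by rewrite expr2 !mulrA.
  move=> /(le_trans h5); rewrite lw ler_pdivrMr ?exprn_gt0// => /le_trans; apply.
  rewrite exprMn exprVn -exprM mulnC exprM (_ : 2 ^+ 2 = 4); last by ring.
  by rewrite mulrA mulfVK// expf_neq0.
apply/eqP; rewrite -cabs_eq0 eq_le cabs_ge0 andbT -/T.
apply/ler_addgt0Pr => e e0; rewrite add0r.
pose K := 4 * (l + m) ^+ 2 + 1.
have K0 : 0 < K by rewrite ltr_pwDr// mulr_ge0// sqr_ge0.
apply: le_trans (main (e / K) (divr_gt0 e0 K0)) _.
have -> : 4 * (e / K) * (l + m) ^+ 2 = e * ((4 * (l + m) ^+ 2) / K) by ring.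
by rewrite ler_piMr ?(ltW e0)// ler_pdivrMr// mul1r lerDl.
Qed.

End Goursat.

Section CircularMean.
Context {R : realType}.
Implicit Types (h : R -> R[i]) (c z w : R[i]).

Lemma twopi_gt0 : 0 < 2 * pi :> R.
Proof. by rewrite mulr_gt0// pi_gt0. Qed.

Definition mean h : R[i] := ((2 * pi)^-1)%:C * Lint 0 (2 * pi) h.

Definition meanable h := cintegrable (@lebesgue_measure R) `[0, 2 * pi]%classic h.

Lemma fine_2pi : fine ((@lebesgue_measure R) `[0, 2 * pi]%classic) = 2 * pi.
Proof. by rewrite fine_itv ?subr0// ltW// twopi_gt0. Qed.

Lemma cont_meanable h : (forall t, econt rdist h t) -> meanable h.
Proof. by move=> ch; apply: Lint_integrable. Qed.

Lemma mean_cst c : mean (fun=> c) = c.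
Proof.
rewrite /mean /Lint Cint_cst// fine_2pi mulrCA -rmorphM mulVf ?mulr1//.
by rewrite gt_eqF// twopi_gt0.
Qed.

Lemma meanD h1 h2 : meanable h1 -> meanable h2 ->
  mean (fun t => h1 t + h2 t) = mean h1 + mean h2.
Proof. by move=> i1 i2; rewrite /mean /Lint CintD// mulrDr. Qed.

Lemma meanB h1 h2 : meanable h1 -> meanable h2 ->
  mean (fun t => h1 t - h2 t) = mean h1 - mean h2.
Proof. by move=> i1 i2; rewrite /mean /Lint CintB// mulrBr. Qed.

Lemma meanZ c h : meanable h -> mean (fun t => c * h t) = c * mean h.
Proof. by move=> ih; rewrite /mean /Lint CintZ// mulrCA. Qed.

Lemma meanableZ c h : meanable h -> meanable (fun t => c * h t).
Proof. exact: cintegrableZ. Qed.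

Lemma meanableB h1 h2 : meanable h1 -> meanable h2 -> meanable (fun t => h1 t - h2 t).
Proof. exact: cintegrableB. Qed.

Lemma eq_mean h1 h2 : (forall t, h1 t = h2 t) -> mean h1 = mean h2.
Proof. by move=> h12; congr mean; apply/funext. Qed.

Lemma mean_conj h : meanable h -> mean (fun t => (h t)^*) = (mean h)^*.
Proof.
move=> [h1 h2]; rewrite /mean [RHS]rmorphM; congr (_ * _); first by rewrite [RHS]conjc_real.
rewrite /Lint /Cint /=; congr (_ +i* _).
  by apply: eq_Rintegral => t _; case: (h t).
rewrite -[RHS]mulN1r -RintegralZl//.
by apply: eq_Rintegral => t _; case: (h t) => ? ?; rewrite mulN1r.
Qed.

Lemma mean_Re h : complex.Re (mean h) = (2 * pi)^-1 * Rintegral (@lebesgue_measure R) `[0, 2 * pi]%classic (fun t => complex.Re (h t)).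
Proof. by rewrite /mean ReM /= mul0r subr0. Qed.

Lemma mean_le h M : meanable h -> (forall t, cabs (h t) <= M) -> cabs (mean h) <= 2 * M.
Proof.
move=> ih hM; rewrite /mean cabsM cabs_real ger0_norm ?invr_ge0 ?(ltW twopi_gt0)//.
rewrite ler_pdivrMl ?twopi_gt0// [leRHS]mulrC.
apply: le_trans (Cint_le_cst _ (itv_lty _ _) ih (fun t _ => hM t)) _ => //.
by rewrite fine_2pi.
Qed.

Lemma rcont_circle (f : R[i] -> R[i]) c (r t : R) :
  econt cdist f (c + r%:C * cis t) -> econt rdist (fun t => f (c + r%:C * cis t)) t.
Proof.
move=> cf; apply: (econt_comp (f := fun t => c + r%:C * cis t)) => //.
apply: econtD; first exact: econt_cst.
by apply: econtM; [exact: econt_cst|exact: rcont_cis].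
Qed.

Lemma cabs_circle c (r t : R) : 0 <= r -> cabs (c + r%:C * cis t - c) = r.
Proof. by move=> r0; rewrite addrAC subrr add0r cabsM cabs_cis mulr1 cabs_real ger0_norm. Qed.

(** In logarithmic coordinates an annulus is a rectangle whose horizontal sides
   carry the same values, so that Goursat's theorem compares its two vertical
   sides. *)
Lemma circular_mean_cst (phi : R[i] -> R[i]) c (r0 r1 r2 : R) :
  0 < r1 -> r1 <= r2 -> r2 < r0 ->
  (forall z, 0 < cabs (z - c) < r0 -> cdiff phi z) ->
  mean (fun t => phi (c + r1%:C * cis t)) = mean (fun t => phi (c + r2%:C * cis t)).
Proof.
move=> r10 r12 r20 dphi; have r2p := lt_le_trans r10 r12.
have dpsi z : in_rect (ln r1) 0 (ln r2 - ln r1) (2 * pi) z ->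
    cdiff (fun w => phi (c + cexp w)) z.
  move=> [zx _]; apply: (cdiff_comp (f1 := fun w => c + cexp w)).
    by apply: cdiffD; [exact: cdiff_cst|exact: cdiff_cexp].
  apply: dphi; rewrite addrAC subrr add0r cabs_cexp expR_gt0 /=.
  apply: le_lt_trans r20; rewrite -[leRHS](lnK (x := r2)) ?posrE// ler_expR.
  by clear -zx; lra.
have l0 : 0 <= ln r2 - ln r1 by rewrite subr_ge0 ler_ln ?posrE.
have := goursat l0 (ltW twopi_gt0) dpsi; rewrite /rect_integral.
rewrite [X in X + _](_ : _ = 0); last first.
  rewrite /Lint (_ : (fun s => _) = fun=> 0); last first.
    apply/funext => s; rewrite !cexp_polar add0r cis_2pi cis0 subrr//.
  by rewrite Cint_cst// mul0r.
rewrite !add0r addrC subrK => /eqP.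
rewrite mulf_eq0 => /orP[/eqP[/eqP]|]; first by rewrite oner_eq0.
rewrite /Lint CintB//; last 2 first.
- apply: Lint_integrable => t tt; apply: (rcont_vert dpsi).
    by rewrite addrC subrK lexx andbT -subr_ge0.
  by rewrite add0r.
- apply: Lint_integrable => t tt; apply: (rcont_vert dpsi).
    by rewrite addrC subrK lexx -subr_ge0.
  by rewrite add0r.
rewrite subr_eq0 => /eqP h; rewrite /mean; congr (_ * _).
rewrite /Lint.
transitivity (Cint (@lebesgue_measure R) `[0, 2 * pi]%classic (fun t => phi (c + cexp (ln r1 +i* t)))).
  by apply: eq_Cint => t _; rewrite cexp_polar lnK ?posrE.
by rewrite -h; apply: eq_Cint => t _; rewrite cexp_polar lnK ?posrE.
Qed.

Lemma circle_meanable (phi : R[i] -> R[i]) c (r r0 : R) : 0 < r < r0 ->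
  (forall z, 0 < cabs (z - c) < r0 -> cdiff phi z) ->
  meanable (fun t => phi (c + r%:C * cis t)).
Proof.
move=> /andP[rp rr] dphi; apply: cont_meanable => t; apply: rcont_circle.
by apply/cdiff_cont/dphi; rewrite cabs_circle ?(ltW rp)// rp.
Qed.

(** [v] is the limit of [phi] at the centre, where [phi] need not be
differentiable: circular means do not depend on the radius, which may shrink
to 0. *)
Theorem mean_value (phi : R[i] -> R[i]) c v (r r0 : R) : 0 < r < r0 ->
  (forall z, 0 < cabs (z - c) < r0 -> cdiff phi z) ->
  (forall e, 0 < e -> exists2 s, 0 < s & forall z, 0 < cabs (z - c) < s -> cabs (phi z - v) < e) ->
  mean (fun t => phi (c + r%:C * cis t)) = v.
Proof.
move=> /andP[rp rr] dphi phiv; apply/eqP; rewrite -subr_eq0 -cabs_eq0 eq_le cabs_ge0 andbT.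
apply/ler_addgt0Pr => e e0; rewrite add0r.
have [s s0 H] := phiv (e / 2) (divr_gt0 e0 (ltr0Sn _ 1)).
pose r1 := Order.min r (s / 2).
have r10 : 0 < r1 by rewrite lt_min rp divr_gt0.
have r1r : r1 <= r by rewrite ge_min lexx.
have r1s : r1 < s by rewrite gt_min ltr_pdivrMr// mulr_natr mulr2n ltrDl s0 orbT.
rewrite -(circular_mean_cst r10 r1r rr dphi).
have im : meanable (fun t => phi (c + r1%:C * cis t)).
  by apply: (circle_meanable (r0 := r0)) => //; rewrite r10 (le_lt_trans r1r).
have iv : meanable (fun=> v) by apply: cont_meanable => t; exact: econt_cst.
rewrite -[X in _ - X](mean_cst v) -meanB//.
have -> : e = 2 * (e / 2) by field.
apply: mean_le; first exact: meanableB.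
by move=> t; apply/ltW/H; rewrite cabs_circle ?(ltW r10)// r10.
Qed.

Lemma cdiff_limit (phi : R[i] -> R[i]) c : econt cdist phi c ->
  forall e, 0 < e -> exists2 s, 0 < s & forall z, 0 < cabs (z - c) < s -> cabs (phi z - phi c) < e.
Proof. by move=> cphi e /cphi[s s0 H]; exists s => // z /andP[_]; exact: H. Qed.

(** If a value near [k c] were omitted, the mean value property of
   [1 / (k - w)] on a small circle would bound [1 / |k c - w|] by the values
   on the circle, where [k] stays away from [k c] by injectivity. *)
Theorem open_mapping (k : R[i] -> R[i]) c (r0 : R) : 0 < r0 ->
  (forall z, cabs (z - c) < r0 -> cdiff k z) ->
  (forall z, cabs (z - c) < r0 -> k z = k c -> z = c) ->
  exists2 e, 0 < e & forall w, cabs (w - k c) < e -> exists2 z, cabs (z - c) < r0 & k z = w.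
Proof.
move=> r00 dk ik; pose r := r0 / 2.
have rp : 0 < r by rewrite divr_gt0.
have rr : r < r0 by rewrite ltr_pdivrMr// mulr_natr mulr2n ltrDl.
pose u t : R := cabs (k (c + r%:C * cis t) - k c).
have ku t : econt rdist (fun t => k (c + r%:C * cis t)) t.
  by apply: rcont_circle; apply/cdiff_cont/dk; rewrite cabs_circle// ltW.
have cu : {within `[0, 2 * pi], continuous u}.
  apply: continuous_in_subspaceT => t _; apply/rcontP => e e0.
  have [s s0 H] := ku t _ e0; exists s => // t' /H h.
  rewrite cabs_realB; apply: le_lt_trans h; apply: le_trans (cabs_sub_norm _ _) _.
  by rewrite (_ : _ - _ - _ = k (c + r%:C * cis t') - k (c + r%:C * cis t))//; ring.
have [t0 _ umin] := EVT_min (ltW twopi_gt0) cu.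
have u0 : 0 < u t0.
  rewrite cabs_gt0 subr_eq0; apply/eqP => /ik.
  rewrite cabs_circle ?(ltW rp)// => /(_ rr) /(congr1 (fun z => cabs (z - c))).
  by rewrite cabs_circle ?(ltW rp)// subrr cabs0 => /eqP; rewrite gt_eqF.
exists (u t0 / 8); first by rewrite divr_gt0.
move=> w wk; apply: contrapT => H.
have [kw|kw] := eqVneq (k c) w.
  by apply: H; exists c => //; rewrite subrr cabs0.
have nz z : cabs (z - c) < r0 -> k z - w != 0.
  by move=> zc; apply/eqP => /eqP; rewrite subr_eq0 => /eqP kz; apply: H; exists z.
have dphi z : cabs (z - c) < r0 -> cdiff (fun z => (k z - w)^-1) z.
  move=> zc; apply: cdiffV; first exact: nz.
  by apply: cdiffB; [exact: dk|exact: cdiff_cst].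
have dphi' z : 0 < cabs (z - c) < r0 -> cdiff (fun z => (k z - w)^-1) z.
  by move=> /andP[_]; exact: dphi.
have rrr : 0 < r < r0 by rewrite rp.
have cc : cabs (c - c) < r0 by rewrite subrr cabs0.
have mv := mean_value rrr dphi' (cdiff_limit (cdiff_cont (dphi c cc))).
have up t : t \in `[0, 2 * pi] -> cabs (k (c + r%:C * cis t) - w)^-1 <= 8 / (7 * u t0).
  move=> tt; rewrite cabsV -[leRHS]invrK lef_pV2 ?posrE ?invr_gt0 ?divr_gt0 ?mulr_gt0//; last first.
    by rewrite cabs_gt0 nz// cabs_circle ?(ltW rp).
  rewrite invf_div.
  have := umin t tt; rewrite /u; set A := k (c + r%:C * cis t); set B := k c => h.
  have : cabs (A - B) <= cabs (A - w) + cabs (w - B) by exact: cabs_tri.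
  have := wk; rewrite -/B; move: h; rewrite -/(u t0) => h h1 h2.
  clear -h h1 h2; lra.
have : cabs (k c - w)^-1 <= 2 * (8 / (7 * u t0)).
  rewrite -mv /mean cabsM cabs_real ger0_norm ?invr_ge0 ?(ltW twopi_gt0)//.
  rewrite ler_pdivrMl ?twopi_gt0// [leRHS]mulrC.
  apply: le_trans (Cint_le_cst _ (itv_lty _ _) (circle_meanable rrr dphi') up) _ => //.
  by rewrite fine_2pi.
have kw0 : 0 < cabs (k c - w) by rewrite cabs_gt0 subr_eq0.
rewrite cabsV -[leRHS]invrK lef_pV2 ?posrE ?invr_gt0 ?mulr_gt0 ?divr_gt0 ?mulr_gt0 ?invr_gt0 ?mulr_gt0//.
rewrite invfM invf_div cabsC => h; clear -h wk u0.
have : 2^-1 * (7 * u t0 / 8) = 7 / 16 * u t0 by field.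
by move=> h'; rewrite h' in h; lra.
Qed.

End CircularMean.

(** * Boundary values of Cauchy integrals *)
Section CauchyIntegral.
Context {R : realType}.

Lemma cdiff_local (f g : R[i] -> R[i]) z (r : R) : 0 < r -> econt cdist g z ->
  (forall w, cabs (w - z) < r -> f w = f z + g w * (w - z)) -> cdiff f z.
Proof.
move=> r0 cg fE; apply: (@cdiff_near _ (fun w => f z + g w * (w - z))).
  by exists r => // w /fE.
by exists g => // w; rewrite subrr mulr0 addr0.
Qed.

(** The difference quotient of the Cauchy kernel is again a bounded kernel, so the
difference quotient of the integral is an integral depending continuously on
the point. *)
Lemma cauchy_integral_cdiff d (T : measurableType d) (mu : {measure set T -> \bar R})
    (D : set T) (w phi : T -> R[i]) (M s : R) z0 :
  measurable D -> (mu D < +oo)%E -> cmeas D w -> cmeas D phi ->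
  (forall t, D t -> cabs (phi t) <= M) -> 0 < s -> (forall t, D t -> s <= cabs (w t - z0)) ->
  cdiff (fun z => Cint mu D (fun t => phi t / (w t - z))) z0.
Proof.
move=> mD fD mw mphi phiM s0 ws.
have wz z t : D t -> cabs (z - z0) < s / 2 -> s / 2 <= cabs (w t - z).
  move=> Dt zs; have := ws t Dt; have := cabs_tri (w t) z z0.
  by clear -zs; lra.
have s20 : 0 < s / 2 by rewrite divr_gt0.
have wn z t : D t -> cabs (z - z0) < s / 2 -> w t - z != 0.
  by move=> Dt zs; rewrite -cabs_gt0 (lt_le_trans s20)// wz.
have z00 : cabs (z0 - z0) < s / 2 by rewrite subrr cabs0.
have ge0M t : D t -> 0 <= M by move=> Dt; exact: le_trans (cabs_ge0 _) (phiM t Dt).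
have invb z t : D t -> cabs (z - z0) < s / 2 -> cabs (w t - z)^-1 <= (s / 2)^-1.
  by move=> Dt zs; rewrite cabsV lef_pV2 ?posrE ?cabs_gt0 ?wn// wz.
have mz z : cmeas D (fun t => w t - z) by apply: cmeasB => //; exact: cmeas_cst.
have int1 z : cabs (z - z0) < s / 2 -> cintegrable mu D (fun t => phi t / (w t - z)).
  move=> zs; apply: (@cmeas_integrable _ _ _ _ _ _ _ (M * (s / 2)^-1)) => //.
    by apply: cmeasM => //; exact: cmeasV.
  by move=> t Dt; rewrite cabsM; apply: ler_pM; rewrite ?cabs_ge0 ?phiM ?invb.
have int2 z : cabs (z - z0) < s / 2 ->
    cintegrable mu D (fun t => phi t / (w t - z0) / (w t - z)).
  move=> zs; apply: (@cmeas_integrable _ _ _ _ _ _ _ (M * (s / 2)^-1 * (s / 2)^-1)) => //.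
    by apply: cmeasM; [apply: cmeasM => //; exact: cmeasV|exact: cmeasV].
  move=> t Dt; rewrite cabsM; apply: ler_pM; rewrite ?cabs_ge0 ?invb//.
  by rewrite cabsM; apply: ler_pM; rewrite ?cabs_ge0 ?phiM ?invb.
have int3 z : cabs (z - z0) < s / 2 ->
    cintegrable mu D (fun t => phi t / (w t - z0) / (w t - z) / (w t - z0)).
  move=> zs; apply: (@cmeas_integrable _ _ _ _ _ _ _ (M * (s / 2)^-1 * (s / 2)^-1 * (s / 2)^-1)) => //.
    apply: cmeasM; last exact: cmeasV.
    by apply: cmeasM; [apply: cmeasM => //; exact: cmeasV|exact: cmeasV].
  move=> t Dt; rewrite cabsM; apply: ler_pM; rewrite ?cabs_ge0 ?invb//.
  rewrite cabsM; apply: ler_pM; rewrite ?cabs_ge0 ?invb//.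
  by rewrite cabsM; apply: ler_pM; rewrite ?cabs_ge0 ?phiM ?invb.
apply: (@cdiff_local _ (fun z => Cint mu D (fun t => phi t / (w t - z0) / (w t - z))) _ (s / 2)) => //.
  move=> e e0.
  pose K := 2 * (`|M| * (s / 2)^-1 * (s / 2)^-1 * (s / 2)^-1) * fine (mu D) + 1.
  have K0 : 0 < K.
    by rewrite ltr_pwDr// !mulr_ge0// ?invr_ge0 ?(ltW s20)// fine_ge0.
  exists (Order.min (s / 2) (e / K)); first by rewrite lt_min s20 divr_gt0.
  move=> z; rewrite lt_min => /andP[zs ze].
  rewrite -CintB//; [|exact: int2|exact: int2].
  rewrite (@eq_Cint _ _ _ mu D _ (fun t => (z - z0) * (phi t / (w t - z0) / (w t - z) / (w t - z0)))); last first.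
    by move=> t Dt; field; rewrite !wn.
  rewrite CintZ//; last exact: int3.
  rewrite cabsM.
  have Cb : cabs (Cint mu D (fun t => phi t / (w t - z0) / (w t - z) / (w t - z0))) <= K.
    apply: le_trans (_ : _ <= K - 1) _; last by rewrite gerBl.
    rewrite /K addrK; apply: Cint_le_cst => //; first exact: int3.
    move=> t Dt; rewrite cabsM; apply: ler_pM; rewrite ?cabs_ge0 ?invb//.
    rewrite cabsM; apply: ler_pM; rewrite ?cabs_ge0 ?invb//.
    rewrite cabsM; apply: ler_pM; rewrite ?cabs_ge0 ?invb//.
    by apply: le_trans (phiM t Dt) _; exact: ler_norm.
  apply: le_lt_trans (ler_wpM2l (cabs_ge0 _) Cb) _.
  by rewrite -ltr_pdivlMr.
move=> z zs; rewrite -[LHS](addrNK (Cint mu D (fun t => phi t / (w t - z0)))) addrC; congr (_ + _).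
rewrite -CintB//; [|exact: int1|exact: int1].
rewrite (@eq_Cint _ _ _ mu D _ (fun t => (z - z0) * (phi t / (w t - z0) / (w t - z)))); last first.
  by move=> t Dt; field; rewrite !wn.
by rewrite CintZ// 1?mulrC//; exact: int2.
Qed.

Lemma Cint_dominated d (T : measurableType d) (mu : {measure set T -> \bar R})
    (D : set T) (f_ : nat -> T -> R[i]) (f : T -> R[i]) (M : R) :
  measurable D -> (mu D < +oo)%E -> (forall n, cmeas D (f_ n)) -> cmeas D f ->
  (forall n t, D t -> cabs (f_ n t) <= M) -> (forall t, D t -> cabs (f t) <= M) ->
  {ae mu, forall t, D t -> forall e, 0 < e -> exists N, forall n, (N <= n)%N -> cabs (f_ n t - f t) < e} ->
  forall e, 0 < e -> exists N, forall n, (N <= n)%N -> cabs (Cint mu D (f_ n) - Cint mu D f) < e.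
Proof.
move=> mD fD mf_ mf f_M fM cv e e0.
have mB n : cmeas D (fun t => f_ n t - f t) by exact: cmeasB.
have mA n : measurable_fun D (fun t => cabs (f_ n t - f t)) by exact: cmeas_abs.
have bB n t : D t -> cabs (f_ n t - f t) <= M + M.
  by move=> Dt; apply: le_trans (cabsB _ _) _; apply: lerD; [exact: f_M|exact: fM].
have ig : mu.-integrable D (fun=> (M + M)%:E).
  apply: measurable_bounded_integrable => //.
  by exists `|M + M|; split; rewrite ?num_real// => x Mx y _ /=; exact: ltW.
have iA n : mu.-integrable D (EFin \o (fun t => cabs (f_ n t - f t))).
  apply: (le_integrable mD _ _ ig); first exact/measurable_EFinP.
  by move=> t Dt /=; rewrite lee_fin !ger0_norm ?cabs_ge0 ?bB// (le_trans (cabs_ge0 _) (bB n _ Dt)).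
have ae1 : {ae mu, forall x, D x -> (cabs (f_ n x - f x))%:E @[n --> \oo] --> 0%:E}.
  apply: filterS cv => t /= h Dt; apply/fine_cvgP; split; first exact: nearW.
  apply/cvgrPdist_lt => e' e'0; have [N hN] := h Dt _ e'0.
  by exists N => // n /= /hN; rewrite /= sub0r normrN ger0_norm// cabs_ge0.
have ae2 : {ae mu, forall x n, D x -> (`|(cabs (f_ n x - f x))%:E| <= (M + M)%:E)%E}.
  by apply: aeW => t n Dt /=; rewrite lee_fin ger0_norm ?cabs_ge0// bB.
have [_ _ H] := @dominated_convergence _ T R mu D mD (fun n t => (cabs (f_ n t - f t))%:E)
  (fun=> 0%:E) (fun=> (M + M)%:E) (fun n => (measurable_EFinP _ _).2 (mA n)) (measurable_cst _) ae1 ig ae2.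
rewrite integral0 in H.
move/fine_cvgP : H => [_ /cvgrPdist_lt /(_ (e / 2) (divr_gt0 e0 (ltr0Sn _ 1)))] [N _ hN].
exists N => n /hN /=; rewrite sub0r normrN => h.
have i_ k : cintegrable mu D (f_ k) by apply: (@cmeas_integrable _ _ _ _ _ _ _ M) => // t; exact: f_M.
have i0 : cintegrable mu D f by exact: (@cmeas_integrable _ _ _ _ _ _ _ M).
rewrite -CintB//.
have := Cint_le mD (cintegrableB mD (i_ n) i0) (iA n) (fun t _ => lexx _).
move=> /le_lt_trans; apply; rewrite -ltr_pdivlMl// mulrC.
by apply: le_lt_trans h; exact: ler_norm.
Qed.

(** The exceptional set for the pointwise convergence of Cauchy kernels whose pole
tends to [u]. *)
Lemma cis_fiber_null (u : R[i]) :
  (@lebesgue_measure R).-negligible [set t | `[0, 2 * pi]%classic t /\ cis t = u].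
Proof.
set A := [set t | _].
suff cA : countable A.
  exists A; split => //; last exact: countable_lebesgue_measure0.
  exact: countable_measurable.
have [[t0 [t0i t0u]]|nA] := pselect (A !=set0); last first.
  by rewrite (_ : A = set0)//; apply/seteqP; split => // t At; apply: nA; exists t.
apply: (sub_countable (B := [set t0; 0; 2 * pi])); last by apply: finite_set_countable.
apply: subset_card_le => t [ti tu].
have key (s s' : R) : `[0, 2 * pi]%classic s -> `[0, 2 * pi]%classic s' -> s < s' -> cis s = cis s' ->
    s = 0 /\ s' = 2 * pi.
  rewrite /= !in_itv /= => /andP[s0 s1] /andP[s'0 s'1] ss E.
  have : cis (s' - s) = 1 by rewrite cisD cisN E mulfV// cis_neq0.
  move=> /(congr1 (@complex.Re _)) /= c1.
  have ds : s' - s = (s' - s) / 2 + (s' - s) / 2 by rewrite -splitr.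
  have s2 : sin ((s' - s) / 2) = 0.
    move: c1 ds; set h := (s' - s) / 2 => c1 ds; move: c1; rewrite ds cosD -!expr2 => c1.
    have c2 := cos2Dsin2 h.
    by apply/eqP; rewrite -sqrf_eq0; apply/eqP; clear -c1 c2; lra.
  have [lt|ge] := ltP ((s' - s) / 2) pi.
    have : 0 < sin ((s' - s) / 2) by apply: sin_gt0_pi; rewrite lt divr_gt0 ?subr_gt0.
    by rewrite s2 ltxx.
  by clear -ge s0 s1 s'0 s'1; split; lra.
rewrite /=.
have [tt|tt|->] := ltgtP t t0; last by left; left.
- by have [-> _] := key _ _ ti t0i tt (etrans tu (esym t0u)); left; right.
- by have [_ ->] := key _ _ t0i ti tt (etrans t0u (esym tu)); right.
Qed.

Lemma cmeas_cis (D : set R) : cmeas D (@cis R).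
Proof.
by split; apply: measurable_funTS; apply: continuous_measurable_fun;
  [exact: continuous_cos|exact: continuous_sin].
Qed.

Lemma cmeas_cauchy (D : set R) z : cmeas D (fun t => cis t / (cis t - z)).
Proof.
apply: cmeasM; first exact: cmeas_cis.
by apply/cmeasV/cmeasB; [exact: cmeas_cis|exact: cmeas_cst].
Qed.

(** The integrands are bounded by the Lipschitz constant, so the integrals
   converge by domination even when the poles [z_ n] reach the circle. *)
Lemma plemelj (l : R -> R) (z_ : nat -> R[i]) (c_ : nat -> R) (u0 : R[i]) (c0 K : R) :
  measurable_fun `[0, 2 * pi]%classic l ->
  (forall n t, `|l t - c_ n| <= K * cabs (cis t - z_ n)) ->
  (forall t, `|l t - c0| <= K * cabs (cis t - u0)) ->
  (forall e, 0 < e -> exists N, forall n, (N <= n)%N -> cabs (z_ n - u0) < e) ->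
  (forall e, 0 < e -> exists N, forall n, (N <= n)%N -> `|c_ n - c0| < e) ->
  forall e, 0 < e -> exists N, forall n, (N <= n)%N ->
    cabs (mean (fun t => (l t - c_ n)%:C * (cis t / (cis t - z_ n))) -
          mean (fun t => (l t - c0)%:C * (cis t / (cis t - u0)))) < e.
Proof.
move=> ml lc_ lc0 zu cc e e0.
have bd z (c : R) t : `|l t - c| <= K * cabs (cis t - z) ->
    cabs ((l t - c)%:C * (cis t / (cis t - z))) <= `|K|.
  move=> h; rewrite !cabsM cabs_real cabs_cis mul1r cabsV.
  have [/eqP->|n0] := boolP (cabs (cis t - z) == 0); first by rewrite invr0 mulr0.
  rewrite ler_pdivrMr ?lt_def ?n0 ?cabs_ge0//.
  by apply: le_trans h _; apply: ler_wpM2r; [exact: cabs_ge0|exact: ler_norm].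
have mc z (c : R) : cmeas `[0, 2 * pi]%classic (fun t => (l t - c)%:C * (cis t / (cis t - z))).
  apply: cmeasM; last exact: cmeas_cauchy.
  by apply: cmeas_real; exact: measurable_funB.
have e1 : 0 < e * (2 * pi) by rewrite mulr_gt0// twopi_gt0.
have ae1 : {ae @lebesgue_measure R, forall t, `[0, 2 * pi]%classic t -> forall e, 0 < e -> exists N, forall n, (N <= n)%N ->
    cabs ((l t - c_ n)%:C * (cis t / (cis t - z_ n)) - (l t - c0)%:C * (cis t / (cis t - u0))) < e}.
  have := cis_fiber_null u0.
  apply: negligibleS => t /= nt; split; first by apply: contrapT => nI; apply: nt => /nI.
  apply: contrapT => /eqP tu; apply: nt => _ e' e'0.
  pose F (p : R * R[i]) : R[i] := (l t - p.1)%:C * (cis t / (cis t - p.2)).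
  have : econt (fun p q : R * R[i] => Order.max `|p.1 - q.1| (cabs (p.2 - q.2))) F (c0, u0).
    apply: econtM.
      move=> e2 e20; exists e2 => // p; rewrite gt_max => /andP[/= h _].
      by rewrite cabs_realB opprB addrC addrA subrK distrC.
    apply: econtM; first exact: econt_cst.
    apply: econtV; first by rewrite subr_eq0.
    move=> e2 e20; exists e2 => // p; rewrite gt_max => /andP[_ /= h].
    by rewrite opprB addrC addrA subrK cabsC.
  move=> /(_ e' e'0)[s s0 H].
  have [N1 h1] := cc _ s0; have [N2 h2] := zu _ s0.
  exists (maxn N1 N2) => n; rewrite geq_max => /andP[/h1 a1 /h2 a2].
  by apply: (H (c_ n, z_ n)); rewrite gt_max a1.
have [N hN] := @Cint_dominated _ _ (@lebesgue_measure R) `[0, 2 * pi]%classic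
  (fun n t => (l t - c_ n)%:C * (cis t / (cis t - z_ n))) (fun t => (l t - c0)%:C * (cis t / (cis t - u0)))
  `|K| (measurable_itv _) (itv_lty _ _) (fun n => mc _ _) (mc _ _)
  (fun n t _ => bd _ _ _ (lc_ n t)) (fun t _ => bd _ _ _ (lc0 t)) ae1 _ e1.
exists N => n /hN.
rewrite /mean -mulrBr cabsM cabs_real ger0_norm ?invr_ge0 ?(ltW twopi_gt0)// => h.
by rewrite ltr_pdivrMl ?twopi_gt0// [ltRHS]mulrC.
Qed.

End CauchyIntegral.

Section CauchyBoundary.
Context {R : realType}.
Implicit Types (z u w : R[i]).

Lemma conjM z w : (z * w)^* = z^* * w^*.
Proof. exact: rmorphM. Qed.

Lemma conjB z w : (z - w)^* = z^* - w^*.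
Proof. exact: rmorphB. Qed.

Lemma conjX z n : (z ^+ n)^* = z^* ^+ n.
Proof. exact: rmorphXn. Qed.

Lemma mean_cauchy_kernel z : cabs z < 1 -> mean (fun t => cis t / (cis t - z)) = 1.
Proof.
move=> z1; pose phi w : R[i] := (1 - z^* * w)^-1.
have phiE t : phi (0 + 1%:C * cis t) = (cis t / (cis t - z))^*.
  have aux (b c : R[i]) : c != 0 -> 1 - b * c != 0 -> (1 - b * c)^-1 = c^-1 / (c^-1 - b).
    by move=> c0 d0; field; rewrite c0 mulNr.
  rewrite add0r mul1r /phi conjM conjV conjB !cis_conj.
  have : 1 - z^* * cis t != 0.
    rewrite subr_eq0; apply/eqP => /(congr1 (fun w => cabs w)).
    by rewrite cabs1 cabsM cabs_conj cabs_cis mulr1 => h; rewrite -h ltxx in z1.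
  by move=> d0; apply: aux => //; exact: cis_neq0.
have nz w : cabs w * cabs z < 1 -> 1 - z^* * w != 0.
  move=> wz; rewrite subr_eq0; apply/eqP => /(congr1 (fun w => cabs w)).
  by rewrite cabs1 cabsM cabs_conj mulrC => h; rewrite -h ltxx in wz.
pose r0 : R := 2 / (1 + cabs z).
have zp : 0 < 1 + cabs z by rewrite ltr_pwDl// cabs_ge0.
have r01 : 0 < (1 : R) < r0.
  by rewrite ltr01 /= ltr_pdivlMr// mul1r; clear -z1; lra.
have dphi w : 0 < cabs (w - 0) < r0 -> cdiff phi w.
  rewrite subr0 => /andP[_ wr]; apply: cdiffV.
    apply: nz; move: wr; rewrite ltr_pdivlMr// => wr.
    have := cabs_ge0 w; have := cabs_ge0 z => a b.
    have : cabs w * (1 - cabs z) >= 0 by rewrite mulr_ge0// subr_ge0 ltW.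
    by clear -wr; lra.
  apply: cdiffB; first exact: cdiff_cst.
  by apply: cdiffM; [exact: cdiff_cst|exact: cdiff_id].
have c0 : econt cdist phi 0.
  apply: econtV; first by rewrite mulr0 subr0 oner_neq0.
  apply: econtB; first exact: econt_cst.
  by apply: econtM; [exact: econt_cst|exact: ccont_id].
have := mean_value r01 dphi (cdiff_limit c0).
rewrite {2}/phi mulr0 subr0 invr1 => h.
have ik : meanable (fun t => cis t / (cis t - z)).
  apply: cont_meanable => t; apply: econtM; first exact: rcont_cis.
  apply: econtV; last by apply: econtB; [exact: rcont_cis|exact: econt_cst].
  rewrite subr_eq0; apply/eqP => /(congr1 (fun w => cabs w)).
  by rewrite cabs_cis => h'; rewrite -h' ltxx in z1.
apply: (can_inj (@conjCK _)); rewrite -mean_conj// rmorph1 -[RHS]h.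
by apply: eq_mean => t; rewrite phiE.
Qed.

Lemma rcont_cisz (n : int) (t : R) : econt rdist (fun t => cis t ^ n) t.
Proof.
apply: (econt_comp (h := fun w => w ^ n)); first exact: rcont_cis.
by apply/cdiff_cont/cdiff_expz; exact: cis_neq0.
Qed.

Lemma conj_cisz (n : int) (t : R) : (cis t ^ n)^* = cis t ^ (- n).
Proof. by rewrite !cisXz cis_conj -cisN -mulNr -mulrNz. Qed.

Lemma mean_cis (n : int) : mean (fun t => cis t ^ n) = (n == 0)%:R :> R[i].
Proof.
have pos k : mean (fun t => cis t ^ k.+1%:Z) = 0 :> R[i].
  have d1 (w : R[i]) : 0 < cabs (w - 0) < 2 -> cdiff (fun w => w ^+ k.+1) w.
    by move=> _; apply: cdiffX; exact: cdiff_id.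
  have r01 : 0 < (1 : R) < 2 by rewrite ltr01 /= ltr1n.
  have c0 : econt cdist (fun w : R[i] => w ^+ k.+1) 0.
    by apply/cdiff_cont/cdiffX; exact: cdiff_id.
  have e0 : (0 : R[i]) ^+ k.+1 = 0 by rewrite expr0n.
  have := mean_value r01 d1 (cdiff_limit c0); rewrite e0 => h.
  by rewrite -[RHS]h; apply: eq_mean => t; rewrite add0r mul1r.
case: n => [[|k]|k].
- by rewrite -[RHS](mean_cst 1); apply: eq_mean => t.
- by rewrite pos.
- rewrite NegzE oppr_eq0 /=.
  apply: (can_inj (@conjCK _)); rewrite -mean_conj; last first.
    by apply: cont_meanable => t; exact: rcont_cisz.
  by rewrite rmorph0 -[RHS](pos k); apply: eq_mean => t; rewrite conj_cisz opprK.
Qed.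

Lemma mean_le_itv (h : R -> R[i]) (M : R) : meanable h ->
  (forall t, t \in `[0, 2 * pi] -> cabs (h t) <= M) -> cabs (mean h) <= 2 * M.
Proof.
move=> ih hM; rewrite /mean cabsM cabs_real ger0_norm ?invr_ge0 ?(ltW twopi_gt0)//.
rewrite ler_pdivrMl ?twopi_gt0// [leRHS]mulrC.
apply: le_trans (Cint_le_cst _ (itv_lty _ _) ih hM) _ => //.
by rewrite fine_2pi.
Qed.

Lemma kernel_den_neq0 z (t : R) : cabs z < 1 -> cis t - z != 0.
Proof.
move=> z1; rewrite subr_eq0; apply/eqP => /(congr1 (fun w => cabs w)).
by rewrite cabs_cis => h'; rewrite -h' ltxx in z1.
Qed.

Lemma rcont_kernel z (t : R) : cabs z < 1 -> econt rdist (fun t => cis t / (cis t - z)) t.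
Proof.
move=> z1; apply: econtM; first exact: rcont_cis.
apply: econtV; last by apply: econtB; [exact: rcont_cis|exact: econt_cst].
exact: kernel_den_neq0.
Qed.

Section ContinuousDensity.
Variable l : R -> R.
Hypothesis cl : forall t, econt rdist (fun t => (l t)%:C) t.

Lemma kernel_meanable z : cabs z < 1 ->
  meanable (fun t => (l t)%:C * (cis t / (cis t - z))).
Proof.
by move=> z1; apply: cont_meanable => t; apply: econtM; [exact: cl|exact: rcont_kernel].
Qed.

Lemma cauchy_shift (c : R) z : cabs z < 1 ->
  mean (fun t => (l t - c)%:C * (cis t / (cis t - z))) =
  mean (fun t => (l t)%:C * (cis t / (cis t - z))) - c%:C.
Proof.
move=> z1; rewrite -[X in _ - X]mulr1 -(mean_cauchy_kernel z1) -meanZ; last first.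
  by apply: cont_meanable => t; exact: rcont_kernel.
rewrite -meanB; last 2 first.
- exact: kernel_meanable.
- by apply: cont_meanable => t; apply: econtM; [exact: econt_cst|exact: rcont_kernel].
by apply: eq_mean => t; rewrite rmorphB mulrBl.
Qed.

Lemma cl_measurable : measurable_fun `[0, 2 * pi]%classic l.
Proof.
apply: measurable_funTS; apply: continuous_measurable_fun => t.
by apply/rcontP; exact: cl.
Qed.

Lemma cl_bounded : exists M, forall t, t \in `[0, 2 * pi] -> `|l t| <= M.
Proof.
have c : {within `[0, 2 * pi], continuous (fun t => `|l t|)}.
  apply: continuous_in_subspaceT => t _.
  by apply: continuous_comp; [apply/rcontP; exact: cl|exact: norm_continuous].
by have [t0 _ H] := EVT_max (ltW twopi_gt0) c; exists `|l t0|.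
Qed.

(** Expanding the Cauchy kernel in a geometric series; the remainder after [N]
   terms is of order [|z|^N]. *)
Lemma cauchy_integral_zero z : cabs z < 1 ->
  (forall n : int, mean (fun t => (l t)%:C * cis t ^ n) = 0) ->
  mean (fun t => (l t)%:C * (cis t / (cis t - z))) = 0.
Proof.
move=> z1 l0.
pose F N t : R[i] := (l t)%:C * (z ^+ N * cis t ^ (- N%:Z) * (cis t / (cis t - z))).
have cF N t : econt rdist (F N) t.
  apply: econtM; first exact: cl.
  apply: econtM; last exact: rcont_kernel.
  by apply: econtM; [exact: econt_cst|exact: rcont_cisz].
have FS N : mean (F N) = mean (F N.+1).
  apply/eqP; rewrite -subr_eq0 -meanB; try by apply: cont_meanable => t; exact: cF.
  rewrite (@eq_mean _ _ (fun t => z ^+ N * ((l t)%:C * cis t ^ (- N%:Z)))).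
    rewrite meanZ ?l0 ?mulr0//.
    by apply: cont_meanable => t; apply: econtM; [exact: cl|exact: rcont_cisz].
  move=> t; rewrite /F -[in N.+1%:Z]addn1 PoszD opprD expfzDr ?cis_neq0// exprS.
  rewrite exprN1; field.
  by rewrite cis_neq0 kernel_den_neq0.
have F0 N : mean (fun t => (l t)%:C * (cis t / (cis t - z))) = mean (F N).
  elim: N => [|N ->]; last exact: FS.
  by apply: eq_mean => t; rewrite /F expr0 expr0z !mul1r.
have [M lM] := cl_bounded.
have bF N : cabs (mean (F N)) <= 2 * (M / (1 - cabs z) * cabs z ^+ N).
  apply: mean_le_itv; first by apply: cont_meanable => t; exact: cF.
  move=> t ti; rewrite /F !cabsM cabs_real cabsX cisXz !cabs_cis mulr1 mul1r.
  rewrite mulrA [X in X <= _]mulrAC; apply: ler_wpM2r; first by rewrite exprn_ge0// cabs_ge0.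
  apply: ler_pM => //; first exact: cabs_ge0.
    exact: lM.
  rewrite cabsV lef_pV2 ?posrE ?subr_gt0 ?cabs_gt0 ?kernel_den_neq0//.
  by rewrite -(cabs_cis t) cabs_sub.
apply/eqP; rewrite -cabs_eq0 eq_le cabs_ge0 andbT.
apply/ler_addgt0Pr => e e0; rewrite add0r.
pose C := `|2 * (M / (1 - cabs z))| + 1.
have C0 : 0 < C by rewrite ltr_pwDr.
have : cabs z ^+ n @[n --> \oo] --> 0 by apply: cvg_expr; rewrite ger0_norm ?cabs_ge0.
move=> /cvgrPdist_lt /(_ (e / C) (divr_gt0 e0 C0)) [N _ /(_ N (leqnn N))] /=.
rewrite sub0r normrN ger0_norm ?exprn_ge0 ?cabs_ge0// => h.
rewrite (F0 N); apply: le_trans (bF N) _; rewrite mulrA.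
have -> : e = C * (e / C) by field; rewrite gt_eqF.
apply: ler_pM => //; last exact: ltW.
- rewrite mulr_ge0// divr_ge0 ?subr_ge0 ?(ltW z1)//.
  by apply: le_trans (normr_ge0 _) (lM 0 _); rewrite in_itv /= lexx ltW ?twopi_gt0.
- by rewrite exprn_ge0// cabs_ge0.
- by apply: le_trans (ler_norm _) _; rewrite lerDl.
Qed.

Lemma Re_kernel u (t : R) : cabs u = 1 -> cis t != u ->
  complex.Re (cis t / (cis t - u)) = 2^-1.
Proof.
move=> u1 tu.
have E : cis t / (cis t - u) + (cis t / (cis t - u))^* = 1.
  have [s _ us] := cis_surj u1; rewrite us in tu *.
  rewrite conjM conjV conjB !cis_conj.
  have aux (a b : R[i]) : a != 0 -> b != 0 -> a - b != 0 -> a / (a - b) + a^-1 / (a^-1 - b^-1) = 1.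
    move=> a0 b0 ab; have ba : b - a != 0 by rewrite -opprB oppr_eq0.
    by field; rewrite a0 b0 ab mulN1r ba.
  by apply: aux; rewrite ?cis_neq0// subr_eq0.
have /(congr1 (@complex.Re _)) := E; rewrite ReD Re_conj /= => h.
clear -h; lra.
Qed.

(** On the circle the Cauchy kernel has real part [1/2] throughout. *)
Lemma Re_boundary_mean (c : R) u : cabs u = 1 -> (forall t, cis t = u -> l t = c) ->
  complex.Re (mean (fun t => (l t - c)%:C * (cis t / (cis t - u)))) =
  (complex.Re (mean (fun t => (l t)%:C)) - c) / 2.
Proof.
move=> u1 lu.
have -> : (complex.Re (mean (fun t => (l t)%:C)) - c) / 2 =
    complex.Re (mean (fun t => (2^-1)%:C * ((l t)%:C - c%:C))).
  have ml : meanable (fun t => (l t)%:C) by exact: cont_meanable.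
  have mc : meanable (fun=> c%:C) by apply: cont_meanable => t; exact: econt_cst.
  rewrite meanZ; last exact: meanableB.
  have -> : mean (fun t => (l t)%:C - c%:C) = mean (fun t => (l t)%:C) - c%:C.
    by rewrite -[X in _ - X](mean_cst c%:C) -meanB.
  by case: (mean _) => x y; rewrite ReM /= mul0r subr0 mulrC.
rewrite !mean_Re; congr (_ * _); apply: eq_Rintegral => t _.
rewrite -rmorphB -rmorphM /=.
have [tu|tu] := eqVneq (cis t) u.
  by rewrite lu// subrr mulr0 mul0r.
by rewrite ReM /= mul0r subr0 Re_kernel// mulrC.
Qed.

(** The Cauchy integral of [l] vanishes in the disk; letting the point tend to
[cis t0] radially, [plemelj] identifies the limit, and its real part contains
half the value at [cis t0]. *)
Lemma fourier_zero_real t0 (K : R) :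
  (forall n : int, mean (fun t => (l t)%:C * cis t ^ n) = 0) ->
  (forall t, `|l t - l t0| <= K * cabs (cis t - cis t0)) -> l t0 = 0.
Proof.
move=> l0 lK.
pose z_ (n : nat) : R[i] := (1 - n.+2%:R^-1)%:C * cis t0.
have r1 n : 0 <= 1 - (n.+2%:R^-1 : R) < 1.
  by rewrite subr_ge0 invf_le1 ?ltr0n// ler1n /= gtrDl oppr_lt0 invr_gt0 ltr0n.
have cz n : cabs (z_ n) = 1 - n.+2%:R^-1.
  by rewrite cabsM cabs_cis mulr1 cabs_real ger0_norm//; case/andP: (r1 n).
have z1 n : cabs (z_ n) < 1 by rewrite cz; case/andP: (r1 n).
have zu n : cabs (z_ n - cis t0) = n.+2%:R^-1.
  rewrite /z_ (_ : _ - _ = (- n.+2%:R^-1)%:C * cis t0).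
    by rewrite cabsM cabs_cis mulr1 cabs_real normrN ger0_norm// invr_ge0.
  by rewrite rmorphB rmorphN rmorph1; ring.
have zb n t : cabs (cis t - cis t0) <= 2 * cabs (cis t - z_ n).
  have A := cabs_tri (cis t) (z_ n) (cis t0).
  have B := cabs_sub (cis t) (z_ n); rewrite cabs_cis cz in B.
  rewrite zu in A; move: A B; move: (n.+2%:R^-1) => q A B.
  by clear -A B; lra.
have lb' t : `|l t - l t0| <= (2 * `|K|) * cabs (cis t - cis t0).
  apply: le_trans (lK t) _; apply: ler_wpM2r; first exact: cabs_ge0.
  by apply: le_trans (ler_norm _) _; rewrite ler_peMl// ler1n.
have lb n t : `|l t - l t0| <= (2 * `|K|) * cabs (cis t - z_ n).
  apply: le_trans (lK t) _; apply: le_trans (_ : _ <= `|K| * cabs (cis t - cis t0)) _.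
    by apply: ler_wpM2r; [exact: cabs_ge0|exact: ler_norm].
  by rewrite [2 * _]mulrC -mulrA ler_wpM2l.
have zlim e : 0 < e -> exists N, forall n, (N <= n)%N -> cabs (z_ n - cis t0) < e.
  move=> e0; exists (Num.bound e^-1) => n Nn; rewrite zu.
  rewrite invf_plt ?posrE ?ltr0n//.
  apply: lt_trans (archi_boundP _) _; first by rewrite invr_ge0 ltW.
  by rewrite ltr_nat (leq_trans _ (leqnSn _))// ltnS.
have clim e : 0 < e -> exists N, forall n : nat, (N <= n)%N -> `|l t0 - l t0| < e.
  by move=> e0; exists 0%N => n _; rewrite subrr normr0.
have P := plemelj cl_measurable lb lb' zlim clim.
have Z n : mean (fun t => (l t - l t0)%:C * (cis t / (cis t - z_ n))) = - (l t0)%:C.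
  by rewrite cauchy_shift// cauchy_integral_zero// sub0r.
have {P}P : mean (fun t => (l t - l t0)%:C * (cis t / (cis t - cis t0))) = - (l t0)%:C.
  apply/eqP; rewrite eq_sym -subr_eq0 -cabs_eq0 eq_le cabs_ge0 andbT.
  apply/ler_addgt0Pr => e /P[N /(_ N (leqnn N))]; rewrite Z add0r => h.
  exact: ltW.
have lu t : cis t = cis t0 -> l t = l t0.
  move=> tt; have := lK t; rewrite tt subrr cabs0 mulr0 normr_le0 subr_eq0.
  by move=> /eqP.
have := Re_boundary_mean (cabs_cis t0) lu; rewrite P.
have -> : mean (fun t => (l t)%:C) = 0.
  by rewrite -[RHS](l0 0); apply: eq_mean => t; rewrite expr0z mulr1.
by rewrite ReN /= => h; clear -h; lra.
Qed.

End ContinuousDensity.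
End CauchyBoundary.

(** * Laurent coefficients on the punctured disk *)
Section LaurentCoefficients.
Context {R : realType}.
Implicit Types (z u w : R[i]) (phi : R[i] -> R[i]) (n : int).

(** Reduction to [fourier_zero_real] applied to the real and the imaginary part. *)
Lemma fourier_zero (h : R -> R[i]) (t0 K : R) : (forall t, econt rdist h t) ->
  (forall n : int, mean (fun t => h t * cis t ^ n) = 0) ->
  (forall t, cabs (h t - h t0) <= K * cabs (cis t - cis t0)) -> h t0 = 0.
Proof.
move=> ch h0 hK.
have ih n : meanable (fun t => h t * cis t ^ n).
  by apply: cont_meanable => t; apply: econtM; [exact: ch|exact: rcont_cisz].
have real c : complex.Re (c * h t0) = 0.
  apply: (@fourier_zero_real _ (fun t => complex.Re (c * h t)) _ t0 (cabs c * K)).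
  - move=> t; apply: econt_Re; apply: econtM; [exact: econt_cst|exact: ch].
  - move=> n.
    have E t : (complex.Re (c * h t))%:C * cis t ^ n =
        ((2^-1)%:C * c) * (h t * cis t ^ n) + ((2^-1)%:C * c^*) * (h t * cis t ^ (- n))^*.
      have H (X : R[i]) : (complex.Re X)%:C = (2^-1)%:C * (X + X^*).
        by case: X => x y; apply/eqP; rewrite eq_complex /=; apply/andP; split; apply/eqP; field.
      by rewrite H [(c * h t)^*]conjM [(h t * _)^*]conjM conj_cisz opprK; ring.
    have im : meanable (fun t => (h t * cis t ^ (- n))^*).
      apply: cont_meanable => t; apply: econt_conj.
      by apply: econtM; [exact: ch|exact: rcont_cisz].
    rewrite (eq_mean E) meanD; [|exact: meanableZ|exact: meanableZ].
    by rewrite meanZ// meanZ// mean_conj// !h0 rmorph0 !mulr0 addr0.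
  - move=> t; rewrite -ReN -ReD -mulrBr.
    apply: le_trans (Re_le_cabs _) _; rewrite cabsM -mulrA.
    by apply: ler_wpM2l; [exact: cabs_ge0|exact: hK].
have := real 1; have := real (0 +i* (- 1)).
case: (h t0) => x y; rewrite mul1r !complexM /= mul0r mulN1r sub0r opprK => -> ->.
by [].
Qed.

Definition holo0 phi := forall z, 0 < cabs z < 1 -> cdiff phi z.

(** The radius [1/2] is arbitrary: see [lcoefE]. *)
Definition lcoef phi n : R[i] :=
  mean (fun t => phi ((2^-1)%:C * cis t) * ((2^-1)%:C * cis t) ^ (- n)).

Lemma cabs_rcis (r t : R) : 0 <= r -> cabs (r%:C * cis t) = r.
Proof. by move=> r0; rewrite cabsM cabs_cis mulr1 cabs_real ger0_norm. Qed.

Lemma polar z : z != 0 -> exists2 t, t \in `[0, 2 * pi] & z = (cabs z)%:C * cis t.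
Proof.
rewrite -cabs_gt0 => z0.
have z0' : (cabs z)%:C != 0 by rewrite -cabs_gt0 cabs_real normr_gt0 gt_eqF.
have [t ti zt] : exists2 t, t \in `[0, 2 * pi] & z / (cabs z)%:C = cis t.
  by apply: cis_surj; rewrite cabsM cabsV cabs_real ger0_norm ?ltW// mulfV// gt_eqF.
by exists t => //; rewrite -zt mulrCA mulfV// mulr1.
Qed.

Lemma holo0_rcont phi (r t : R) : holo0 phi -> 0 < r < 1 ->
  econt rdist (fun t => phi (r%:C * cis t)) t.
Proof.
move=> hphi /andP[r0 r1]; apply: (econt_comp (f := fun t => r%:C * cis t)).
  by apply: econtM; [exact: econt_cst|exact: rcont_cis].
by apply/cdiff_cont/hphi; rewrite (cabs_rcis _ (ltW _))// r0.
Qed.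

Lemma exprzNK (a b : R[i]) n : a != 0 -> a ^ n * (a ^ (- n) * b) = b.
Proof. by move=> a0; rewrite mulrA -expfzDr// subrr expr0z mul1r. Qed.

Lemma lcoefE phi n (r : R) : holo0 phi -> 0 < r < 1 ->
  mean (fun t => phi (r%:C * cis t) * cis t ^ (- n)) = lcoef phi n * r%:C ^ n.
Proof.
move=> hphi r01; have /andP[r0 r1] := r01.
have rn0 : r%:C != 0 :> R[i] by rewrite -cabs_gt0 cabs_real normr_gt0 gt_eqF.
have h2 : 0 < (2^-1 : R) < 1 by rewrite invr_gt0 ltr0Sn invf_lt1 ?ltr1n.
have hpsi z : 0 < cabs (z - 0) < 1 -> cdiff (fun z => phi z * z ^ (- n)) z.
  rewrite subr0 => zz; apply: cdiffM; first exact: hphi.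
  by apply: cdiff_expz; rewrite -cabs_gt0; case/andP: zz.
have E : lcoef phi n = mean (fun t => phi (r%:C * cis t) * (r%:C * cis t) ^ (- n)).
  have Z (s : R) : mean (fun t => phi (s%:C * cis t) * (s%:C * cis t) ^ (- n)) =
      mean (fun t => phi (0 + s%:C * cis t) * (0 + s%:C * cis t) ^ (- n)).
    by apply: eq_mean => t; rewrite !add0r.
  have /andP[h20 h21] := h2.
  have E0 : lcoef phi n = mean (fun t => phi (0 + (2^-1)%:C * cis t) * (0 + (2^-1)%:C * cis t) ^ (- n)).
    by apply: eq_mean => t; rewrite !add0r.
  apply: (etrans E0 (etrans _ (esym (Z r)))); have [rh|/ltW hr] := leP r 2^-1.
    exact: esym (circular_mean_cst (phi := fun z => phi z * z ^ (- n)) r0 rh h21 hpsi).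
  exact: (circular_mean_cst (phi := fun z => phi z * z ^ (- n)) h20 hr r1 hpsi).
rewrite E mulrC -meanZ; last first.
  apply: cont_meanable => t; apply: econtM; first exact: holo0_rcont.
  apply: (econt_comp (f := fun t => r%:C * cis t) (h := fun w => w ^ (- n))).
    by apply: econtM; [exact: econt_cst|exact: rcont_cis].
  by apply/cdiff_cont/cdiff_expz; apply: mulf_neq0; [exact: rn0|exact: cis_neq0].
apply: eq_mean => t; rewrite expfzMl mulrCA; congr (_ * _).
exact: esym (exprzNK _ _ rn0).
Qed.

Lemma lcoefB phi1 phi2 n : holo0 phi1 -> holo0 phi2 ->
  lcoef (fun z => phi1 z - phi2 z) n = lcoef phi1 n - lcoef phi2 n.
Proof.
move=> h1 h2.
have r2 : 0 < (2^-1 : R) < 1 by rewrite invr_gt0 ltr0Sn invf_lt1 ?ltr1n.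
have i phi : holo0 phi -> meanable (fun t => phi ((2^-1)%:C * cis t) * ((2^-1)%:C * cis t) ^ (- n)).
  move=> h; apply: cont_meanable => t; apply: econtM; first exact: holo0_rcont.
  apply: (econt_comp (f := fun t => (2^-1)%:C * cis t) (h := fun w => w ^ (- n))).
    by apply: econtM; [exact: econt_cst|exact: rcont_cis].
  apply/cdiff_cont/cdiff_expz; rewrite -cabs_gt0 cabs_rcis; by case/andP: r2 => // /ltW.
rewrite /lcoef -meanB; [|exact: i|exact: i].
by apply: eq_mean => t; rewrite mulrBl.
Qed.

(** On the circle through [z] the difference of the two functions is Lipschitz at
[z] and has vanishing Fourier coefficients. *)
Theorem lcoef_unique phi1 phi2 : holo0 phi1 -> holo0 phi2 ->
  (forall n, lcoef phi1 n = lcoef phi2 n) -> forall z, 0 < cabs z < 1 -> phi1 z = phi2 z.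
Proof.
move=> h1 h2 c12 z z01; have /andP[z0 z1] := z01.
have [t0 _ zt] : exists2 t, t \in `[0, 2 * pi] & z = (cabs z)%:C * cis t.
  by apply: polar; rewrite -cabs_gt0.
set r := cabs z in z01 z0 z1 zt.
pose psi w := phi1 w - phi2 w.
have hpsi : holo0 psi by move=> w w01; apply: cdiffB; [exact: h1|exact: h2].
apply/eqP; rewrite -subr_eq0 -/(psi z) zt; apply/eqP.
have cpsi t : econt rdist (fun t => psi (r%:C * cis t)) t by exact: holo0_rcont.
have [g cg gE] := hpsi z z01.
have [s s0 gs] := cg 1 ltr01.
have [M hM] : exists M, forall t, cabs (psi (r%:C * cis t)) <= M.
  have c : {within `[0, 2 * pi], continuous (fun t => cabs (psi (r%:C * cis t)))}.
    apply: continuous_in_subspaceT => t _; apply/rcontP => e e0.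
    have [s' s'0 H] := cpsi t _ e0; exists s' => // t' /H.
    by rewrite cabs_realB; apply: le_lt_trans; exact: cabs_sub_norm.
  have [t1 _ H] := EVT_max (ltW twopi_gt0) c; exists (cabs (psi (r%:C * cis t1))) => t.
  by have [t' t'i ->] := cis_surj (cabs_cis t); exact: H.
apply: (@fourier_zero _ _ ((cabs (g z) + 1) * r + 2 * M / s * r) cpsi).
  move=> n; have := lcoefE (- n) hpsi z01; rewrite opprK => ->.
  by rewrite lcoefB// c12 subrr mul0r.
move=> t.
have dz : cabs (r%:C * cis t - z) = r * cabs (cis t - cis t0).
  by rewrite zt -mulrBr cabsM cabs_real ger0_norm// ltW.
have M0 : 0 <= M := le_trans (cabs_ge0 _) (hM 0).
have [near|far] := ltP (cabs (r%:C * cis t - z)) s.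
  rewrite (gE (r%:C * cis t)) -zt addrAC subrr add0r cabsM dz.
  rewrite mulrDl -[leLHS]addr0; apply: lerD; last first.
    by rewrite !mulr_ge0// ?cabs_ge0// ?invr_ge0 ?(ltW s0) ?(ltW z0).
  rewrite mulrA; apply: ler_wpM2r; first exact: cabs_ge0.
  apply: ler_wpM2r; first exact: ltW.
  have := gs _ near; have := cabs_sub (g (r%:C * cis t)) (g z) => a b.
  by clear -a b; lra.
apply: le_trans (cabsB _ _) _; apply: le_trans (lerD (hM _) (hM _)) _.
rewrite mulrDl -[leLHS]add0r; apply: lerD.
  by rewrite mulr_ge0 ?cabs_ge0// mulr_ge0 ?(ltW z0)// addr_ge0 ?cabs_ge0.
rewrite dz in far.
have -> : 2 * M / s * r * cabs (cis t - cis t0) = (M + M) * (r * cabs (cis t - cis t0) / s).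
  by field; rewrite gt_eqF.
by rewrite ler_peMr ?addr_ge0// ler_pdivlMr// mul1r.
Qed.

(** Evaluate the mean on circles of radius tending to 0. *)
Lemma lcoef_pole phi (d m : nat) (C s : R) : holo0 phi -> 0 < s ->
  (forall z, 0 < cabs z < s -> cabs (phi z) <= C * (cabs z ^+ d)^-1) ->
  lcoef phi (- (d + m.+1)%N%:Z) = 0.
Proof.
move=> hphi s0 phiC.
apply/eqP; rewrite -cabs_eq0 eq_le cabs_ge0 andbT.
apply/ler_addgt0Pr => e e0; rewrite add0r.
pose K := 2 * `|C| + 1; have K0 : 0 < K by rewrite ltr_pwDr.
pose r := Order.min (Order.min (s / 2) (e / K)) (2^-1).
have r0 : 0 < r by rewrite !lt_min !divr_gt0// invr_gt0 ltr0Sn.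
have rs : r < s.
  by rewrite !gt_min ltr_pdivrMr// mulr_natr mulr2n ltrDl s0.
have re : r <= e / K by rewrite !ge_min lexx orbT.
have r1 : r < 1 by rewrite !gt_min invf_lt1 ?ltr1n ?orbT.
have r01 : 0 < r < 1 by rewrite r0.
have := lcoefE (- (d + m.+1)%N%:Z) hphi r01.
rewrite opprK => /(congr1 (fun w => cabs w)).
rewrite cabsM -exprz_inv -exprnP cabsX cabsV cabs_real gtr0_norm// => E.
have : cabs (lcoef phi (- (d + m.+1)%N%:Z)) * r^-1 ^+ (d + m.+1) <= 2 * (`|C| * (r ^+ d)^-1).
  rewrite -E; apply: mean_le.
    by apply: cont_meanable => t; apply: econtM; [exact: holo0_rcont|exact: rcont_cisz].
  move=> t; rewrite cabsM cisXz cabs_cis mulr1.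
  have := phiC (r%:C * cis t); rewrite (cabs_rcis _ (ltW r0)) r0 rs => /(_ isT) h.
  apply: le_trans h _; apply: ler_wpM2r; last exact: ler_norm.
  by rewrite invr_ge0 exprn_ge0// ltW.
rewrite exprVn ler_pdivrMr ?exprn_gt0// => h; apply: le_trans h _.
have -> : 2 * (`|C| / r ^+ d) * r ^+ (d + m.+1) = 2 * `|C| * r * r ^+ m.
  by rewrite exprD exprS; field; rewrite expf_neq0// gt_eqF.
apply: le_trans (_ : K * r <= _).
  rewrite -[leRHS]mulr1; apply: ler_pM.
  - by rewrite !mulr_ge0// ltW.
  - by rewrite exprn_ge0// ltW.
  - by apply: ler_wpM2r; [exact: ltW|rewrite lerDl].
  - by rewrite exprn_ile1// ltW.
by rewrite mulrC -ler_pdivlMr.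
Qed.

Lemma lcoef_limit phi v : holo0 phi ->
  (forall e, 0 < e -> exists2 s, 0 < s & forall z, 0 < cabs z < s -> cabs (phi z - v) < e) ->
  lcoef phi 0 = v.
Proof.
move=> hphi phiv.
have r2 : 0 < (2^-1 : R) < 1 by rewrite invr_gt0 ltr0Sn invf_lt1 ?ltr1n.
rewrite -[RHS](@mean_value _ phi 0 v 2^-1 1)//.
- by apply: eq_mean => t; rewrite oppr0 expr0z mulr1 add0r.
- by move=> z; rewrite subr0; exact: hphi.
- by move=> e /phiv[s s0 H]; exists s => // z; rewrite subr0; exact: H.
Qed.

Lemma cabs_third (A B : R[i]) (e : R) :
  cabs A <= 2 * (e / 3) -> cabs (A - B) < e / 3 -> cabs B <= e.
Proof.
have := cabs_sub B A; rewrite (cabsC B).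
by move: (cabs A) (cabs B) (cabs (A - B)) => x y z; lra.
Qed.

(** Evaluate both means on circles of radius tending to 1, where conjugation turns
[cis t ^ n] into [cis t ^ (- n)]. *)
Lemma lcoef_boundary phi1 phi2 n : holo0 phi1 -> holo0 phi2 ->
  (forall e, 0 < e -> exists2 r, r < 1 & forall z, r < cabs z < 1 -> cabs (phi1 z - (phi2 z)^*) < e) ->
  lcoef phi1 n = (lcoef phi2 (- n))^*.
Proof.
move=> h1 h2 b12; set c1 := lcoef phi1 n; set c2 := lcoef phi2 (- n).
pose F w : R[i] := c1 * w ^ n - c2^* * w ^ (- n).
have cF : econt cdist F 1.
  have cn k : econt cdist (fun w : R[i] => w ^ k) 1.
    by apply/cdiff_cont/cdiff_expz; exact: oner_neq0.
  by apply: econtB; apply: econtM => //; exact: econt_cst.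
apply/eqP; rewrite -subr_eq0 -cabs_eq0 eq_le cabs_ge0 andbT.
apply/ler_addgt0Pr => e e0; rewrite add0r.
have e3 : 0 < e / 3 by rewrite divr_gt0.
have [s s0 hs] := cF _ e3; have [r r1 hr] := b12 _ e3.
pose m := Order.max (Order.max r (1 - s)) 0.
have m1 : m < 1 by rewrite !gt_max r1 ltrBlDr ltrDl s0 ltr01.
pose rho := (m + 1) / 2.
have mr : m < rho by rewrite midf_lt.
have rho1 : rho < 1 by rewrite midf_lt.
have [rr sr rho0] : [/\ r < rho, 1 - s < rho & 0 < rho].
  by move: mr; rewrite !gt_max => /andP[/andP[-> ->] ->].
have rho01 : 0 < rho < 1 by rewrite rho0.
have Frho : cabs (F rho%:C) <= 2 * (e / 3).
  rewrite /F -(lcoefE _ h1 rho01).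
  have -> : c2^* * rho%:C ^ (- n) = mean (fun t => (phi2 (rho%:C * cis t))^* * cis t ^ (- n)).
    have -> : rho%:C ^ (- n) = (rho%:C ^ (- n) : R[i])^*.
      case: (- n) => k; first by rewrite [RHS]conjX conj_real.
      by rewrite NegzE -exprz_inv -exprnP [RHS]conjX conjV conj_real.
    rewrite -conjM -(lcoefE _ h2 rho01) -mean_conj; last first.
      by apply: cont_meanable => t; apply: econtM; [exact: holo0_rcont|exact: rcont_cisz].
    by apply: eq_mean => t; rewrite conjM conj_cisz opprK.
  rewrite -meanB; last 2 first.
  - by apply: cont_meanable => t; apply: econtM; [exact: holo0_rcont|exact: rcont_cisz].
  - by apply: cont_meanable => t; apply: econtM; [apply: econt_conj; exact: holo0_rcont|exact: rcont_cisz].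
  rewrite (@eq_mean _ _ (fun t => (phi1 (rho%:C * cis t) - (phi2 (rho%:C * cis t))^*) * cis t ^ (- n))); last first.
    by move=> t; rewrite mulrBl.
  apply: mean_le.
    apply: cont_meanable => t; apply: econtM; last exact: rcont_cisz.
    by apply: econtB; [exact: holo0_rcont|apply: econt_conj; exact: holo0_rcont].
  move=> t; rewrite cabsM cisXz cabs_cis mulr1; apply/ltW/hr.
  by rewrite (cabs_rcis _ (ltW _))// rr.
have F1 : F 1 = c1 - c2^* by rewrite /F !exp1rz !mulr1.
rewrite -F1.
apply: (cabs_third Frho); apply: hs.
rewrite /cdist -[1]/((1 : R)%:C) cabs_realB ltr_distl.
by rewrite sr /= (lt_trans rho1)// ltrDl.
Qed.

End LaurentCoefficients.

Section LaurentPolynomials.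
Context {R : realType}.
Implicit Types (z u w : R[i]) (n : int).

Lemma expfz_split (F : fieldType) (c a u : F) (m n : int) : a != 0 -> u != 0 ->
  c * (a * u) ^ m * (a * u) ^ (- n) = (c * a ^ (m - n)) * u ^ (m - n).
Proof. by move=> a0 u0; rewrite !expfzMl !expfzDr//; ring. Qed.

Lemma lcoef_monomial (c : R[i]) (m n : int) : lcoef (fun z => c * z ^ m) n = c * (m == n)%:R.
Proof.
have a0 : (2^-1 : R)%:C != 0 :> R[i] by rewrite -cabs_gt0 cabs_real normr_gt0 invr_eq0 pnatr_eq0.
rewrite /lcoef (@eq_mean _ _ (fun t => (c * (2^-1)%:C ^ (m - n)) * cis t ^ (m - n))); last first.
  by move=> t; apply: expfz_split; [exact: a0|exact: cis_neq0].
rewrite meanZ; last by apply: cont_meanable => t; exact: rcont_cisz.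
rewrite mean_cis subr_eq0; case: eqP => [->|_]; last by rewrite !mulr0.
by rewrite subrr expr0z !mulr1.
Qed.

Lemma lcoefD (phi1 phi2 : R[i] -> R[i]) n : holo0 phi1 -> holo0 phi2 ->
  lcoef (fun z => phi1 z + phi2 z) n = lcoef phi1 n + lcoef phi2 n.
Proof.
move=> h1 h2.
have h1' : holo0 (fun z => phi1 z + phi2 z) by move=> z z01; apply: cdiffD; [exact: h1|exact: h2].
have := lcoefB n h1' h2.
rewrite (_ : (fun z => _ - _) = phi1); last by apply/funext => z; rewrite addrK.
by move=> ->; rewrite subrK.
Qed.

Lemma holo0_monomial (c : R[i]) (m : int) : holo0 (fun z => c * z ^ m).
Proof.
move=> z /andP[z0 _]; apply: cdiffM; first exact: cdiff_cst.
by apply: cdiff_expz; rewrite -cabs_gt0.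
Qed.

Lemma holo0_sum N (c : nat -> R[i]) (m : nat -> int) :
  holo0 (fun z => \sum_(k < N) c k * z ^ m k).
Proof.
elim: N => [|N ih] z z01.
  by under eq_fun do rewrite big_ord0; exact: cdiff_cst.
under eq_fun do rewrite big_ord_recr /=.
by apply: cdiffD; [exact: ih|exact: holo0_monomial].
Qed.

Lemma lcoef_sum N (c : nat -> R[i]) (m : nat -> int) n :
  lcoef (fun z => \sum_(k < N) c k * z ^ m k) n = \sum_(k < N) c k * (m k == n)%:R.
Proof.
elim: N => [|N ih].
  rewrite big_ord0 -[RHS](mulr0 1) -[in RHS](mean_cst 0) mul1r; apply: eq_mean => t.
  by rewrite big_ord0 mul0r.
rewrite big_ord_recr /= -ih.
have -> : (fun z => \sum_(k < N.+1) c k * z ^ m k) =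
    (fun z => \sum_(k < N) c k * z ^ m k + c N * z ^ m N).
  by apply/funext => z; rewrite big_ord_recr.
rewrite lcoefD; [|exact: holo0_sum|exact: holo0_monomial].
by rewrite lcoef_monomial.
Qed.

Lemma holo0_laurent d (b : int -> R[i]) : holo0 (laurent d b).
Proof. exact: (@holo0_sum d.*2.+1 (fun k => b (k%:Z - d%:Z)) (fun k => k%:Z - d%:Z)). Qed.

Lemma lcoef_laurent d (b : int -> R[i]) n :
  lcoef (laurent d b) n = if `|n| <= d%:Z then b n else 0.
Proof.
rewrite /laurent (lcoef_sum d.*2.+1 (fun k => b (k%:Z - d%:Z)) (fun k => k%:Z - d%:Z)).
case: ifPn => [|nd].
  rewrite ler_norml => /andP[n1 n2].
  have [k kE] : exists k : nat, n + d%:Z = k%:Z.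
    by exists (absz (n + d%:Z)); rewrite gez0_abs// -lerBlDr sub0r.
  have kd : (k < d.*2.+1)%N.
    by rewrite ltnS -lez_nat -kE -addnn PoszD lerD2r.
  rewrite (bigD1 (Ordinal kd)) //= -kE addrK eqxx mulr1 big1 ?addr0// => j jk.
  case: eqP => [jn|]; last by rewrite mulr0.
  case/negP: jk; apply/eqP/val_inj => /=; apply/eqP; rewrite -eqz_nat -kE -jn subrK//.
rewrite big1// => j _; case: eqP => [jn|]; last by rewrite mulr0.
case/negP: nd; rewrite -jn ler_norml lerBlDr lerBrDr addNr /= -PoszD lez_nat.
by rewrite addnn -ltnS ltn_ord.
Qed.

Lemma expz_lipschitz u w n : cabs u = 1 -> cabs w = 1 ->
  cabs (u ^ n - w ^ n) <= (`|n|%N)%:R * cabs (u - w).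
Proof.
have pos (k : nat) : cabs u = 1 -> cabs w = 1 -> cabs (u ^+ k - w ^+ k) <= k%:R * cabs (u - w).
  move=> u1 w1; elim: k => [|k ih]; first by rewrite subrr cabs0 mul0r.
  have -> : u ^+ k.+1 - w ^+ k.+1 = u * (u ^+ k - w ^+ k) + (u - w) * w ^+ k by rewrite !exprS; ring.
  apply: le_trans (cabsD _ _) _; rewrite !cabsM u1 cabsX w1 expr1n mul1r mulr1.
  by rewrite -natr1 mulrDl mul1r lerD2r.
move=> u1 w1; case: n => k; first exact: pos.
have u0 : u != 0 by rewrite -cabs_gt0 u1.
have w0 : w != 0 by rewrite -cabs_gt0 w1.
have -> : `|Negz k|%N = k.+1 by [].
rewrite NegzE -!exprz_inv -!exprnP.
have -> : u^-1 ^+ k.+1 - w^-1 ^+ k.+1 = - (u ^+ k.+1 - w ^+ k.+1) / (u ^+ k.+1 * w ^+ k.+1).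
  by rewrite !exprVn; field; rewrite !expf_neq0.
rewrite cabsM cabsN cabsV cabsM !cabsX u1 w1 !expr1n mulr1 invr1 mulr1.
exact: pos.
Qed.

Lemma laurent_lipschitz d (b : int -> R[i]) : exists2 K, 0 <= K &
  forall u w, cabs u = 1 -> cabs w = 1 -> cabs (laurent d b u - laurent d b w) <= K * cabs (u - w).
Proof.
exists (\sum_(k < d.*2.+1) cabs (b (k%:Z - d%:Z)) * (`|k%:Z - d%:Z|%N)%:R).
  by apply: sumr_ge0 => k _; rewrite mulr_ge0// cabs_ge0.
move=> u w u1 w1; rewrite /laurent -sumrB mulr_suml.
elim/big_rec2: _ => [|k x y _ ih]; first by rewrite cabs0.
apply: le_trans (cabsD _ _) _; apply: lerD => //.
rewrite -mulrBr cabsM -mulrA; apply: ler_wpM2l; first exact: cabs_ge0.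
exact: expz_lipschitz.
Qed.

End LaurentPolynomials.

(** * The Cauchy integral of a Lipschitz density *)
Section LipschitzDensity.
Context {R : realType}.
Implicit Types (z u w : R[i]).
Variables (l : R[i] -> R) (K : R).
Hypothesis K0 : 0 <= K.
Hypothesis lip : forall u w, cabs u = 1 -> cabs w = 1 -> `|l u - l w| <= K * cabs (u - w).

Definition radial z : R[i] := z / (cabs z)%:C.

Lemma cabs_radial z : z != 0 -> cabs (radial z) = 1.
Proof.
move=> z0; have zp : 0 < cabs z by rewrite cabs_gt0.
by rewrite cabsM cabsV cabs_real gtr0_norm// mulfV// gt_eqF.
Qed.

Lemma radial_unit u : cabs u = 1 -> radial u = u.
Proof. by move=> u1; rewrite /radial u1 divr1. Qed.

(** The radial projection is at least as close to [z] as [u] is, whence the factor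
2. This bounds the integrand of [Psi] uniformly in [z]. *)
Lemma radial_nearest u z : cabs u = 1 -> z != 0 -> cabs z <= 1 ->
  cabs (u - radial z) <= 2 * cabs (u - z).
Proof.
move=> u1 z0 z1; have zp : 0 < cabs z by rewrite cabs_gt0.
have zc : (cabs z)%:C != 0 by rewrite -cabs_gt0 cabs_real gtr0_norm.
have -> : cabs (u - radial z) <= 2 * cabs (u - z) = true; last by [].
have A := cabs_tri u z (radial z).
have B := cabs_sub u z; rewrite u1 in B.
have C : cabs (z - radial z) = 1 - cabs z.
  have -> : z - radial z = radial z * ((cabs z)%:C - 1) by rewrite /radial; field.
  rewrite cabsM cabs_radial// mul1r -[1]/((1 : R)%:C) cabs_realB ler0_norm ?subr_le0//.
  by rewrite opprB.
by rewrite C in A; clear -A B; lra.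
Qed.

(** Subtracting the value at the nearest boundary point makes the integral
   meaningful on the circle itself, without changing it inside. *)
Definition Psi z : R[i] := (l (radial z))%:C +
  mean (fun t => (l (cis t) - l (radial z))%:C * (cis t / (cis t - z))).

Lemma cl_circle (t : R) : econt rdist (fun t => (l (cis t))%:C) t.
Proof.
move=> e e0; have [s s0 H] := rcont_cis t (divr_gt0 e0 (ltr_pwDr ltr01 K0)).
exists s => // t' /H h; rewrite cabs_realB.
apply: le_lt_trans (lip (cabs_cis _) (cabs_cis _)) _.
rewrite ltr_pdivlMr ?ltr_pwDr// in h; apply: le_lt_trans h.
by rewrite mulrC; apply: ler_wpM2l; [exact: cabs_ge0|rewrite lerDl].
Qed.

Lemma Psi_inside z : cabs z < 1 ->
  Psi z = mean (fun t => (l (cis t))%:C * (cis t / (cis t - z))).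
Proof. by move=> z1; rewrite /Psi (cauchy_shift cl_circle)// addrC subrK. Qed.

Lemma Psi_cdiff z : cabs z < 1 -> cdiff Psi z.
Proof.
move=> z1.
have [M lM] : exists M, forall t, t \in `[0, 2 * pi] -> `|l (cis t)| <= M := cl_bounded cl_circle.
have : cdiff (fun z => ((2 * pi)^-1)%:C * Lint 0 (2 * pi) (fun t => ((l (cis t))%:C * cis t) / (cis t - z))) z.
  apply: cdiffM; first exact: cdiff_cst.
  apply: (@cauchy_integral_cdiff _ _ _ _ _ _ _ M (1 - cabs z)) => //.
  - exact: itv_lty.
  - exact: cmeas_cis.
  - apply: cmeasM; last exact: cmeas_cis.
    by apply: cmeas_real; exact: (cl_measurable cl_circle).
  - by move=> t ti; rewrite cabsM cabs_cis mulr1 cabs_real; exact: lM.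
  - by rewrite subr_gt0.
  - by move=> t _; rewrite -[1](cabs_cis t); exact: cabs_sub.
apply: cdiff_near; exists (1 - cabs z); first by rewrite subr_gt0.
move=> w wz; rewrite Psi_inside; last first.
  by have := cabs_sub w z; clear -wz => h; lra.
by apply: eq_mean => t; rewrite mulrA.
Qed.

(** By sequences: [plemelj] is a statement of dominated convergence. *)
Lemma Psi_continuous u0 : cabs u0 = 1 -> forall e, 0 < e ->
  exists2 s, 0 < s & forall z, cabs z <= 1 -> cabs (z - u0) < s -> cabs (Psi z - Psi u0) < e.
Proof.
move=> u01 e e0; apply: contrapT => H.
have /choice[z_ zP] : forall n : nat, exists z, [/\ cabs z <= 1, cabs (z - u0) < n.+2%:R^-1 &
    e <= cabs (Psi z - Psi u0)].
  move=> n; apply: contrapT => N; apply: H; exists n.+2%:R^-1; first by rewrite invr_gt0 ltr0n.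
  by move=> z z1 zu; rewrite ltNge; apply/negP => h; apply: N; exists z.
have zn0 n : z_ n != 0.
  have [_ zu _] := zP n; rewrite -cabs_gt0.
  have := cabs_sub u0 (z_ n); rewrite u01 cabsC => A.
  have : n.+2%:R^-1 < 1 :> R by rewrite invf_lt1 ?ltr1n ?ltr0n.
  by move: zu A; move: (n.+2%:R^-1) (cabs (z_ n)) (cabs (z_ n - u0)) => x y w; clear; lra.
have zlim e' : 0 < e' -> exists N, forall n, (N <= n)%N -> cabs (z_ n - u0) < e'.
  move=> e'0; exists (Num.bound e'^-1) => n Nn.
  have [_ zu _] := zP n; apply: lt_trans zu _.
  rewrite invf_plt ?posrE ?ltr0n//.
  apply: lt_trans (archi_boundP _) _; first by rewrite invr_ge0 ltW.
  by rewrite ltr_nat (leq_trans _ (leqnSn _))// ltnS.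
have rad n : cabs (u0 - radial (z_ n)) <= 2 * cabs (u0 - z_ n).
  by apply: radial_nearest => //; case: (zP n).
have clip n : `|l (radial (z_ n)) - l u0| <= 2 * K * cabs (z_ n - u0).
  apply: le_trans (lip (cabs_radial (zn0 n)) u01) _.
  rewrite [2 * K]mulrC -mulrA; apply: ler_wpM2l => //.
  by rewrite cabsC (cabsC (z_ n)).
have clim e' : 0 < e' -> exists N, forall n, (N <= n)%N -> `|l (radial (z_ n)) - l u0| < e'.
  move=> e'0; have [N hN] := zlim (e' / (2 * K + 1)) (divr_gt0 e'0 (ltr_pwDr ltr01 (mulr_ge0 (ler0n _ 2) K0))).
  exists N => n /hN; rewrite ltr_pdivlMr ?ltr_pwDr ?mulr_ge0// => h.
  apply: le_lt_trans (clip n) _; apply: le_lt_trans h.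
  by rewrite mulrC; apply: ler_wpM2l; [exact: cabs_ge0|rewrite lerDl].
have b1 n t : `|l (cis t) - l (radial (z_ n))| <= 2 * K * cabs (cis t - z_ n).
  apply: le_trans (lip (cabs_cis _) (cabs_radial (zn0 n))) _.
  rewrite [2 * K]mulrC -mulrA; apply: ler_wpM2l => //.
  by apply: radial_nearest; rewrite ?cabs_cis//; case: (zP n).
have b2 t : `|l (cis t) - l u0| <= 2 * K * cabs (cis t - u0).
  apply: le_trans (lip (cabs_cis _) u01) _; apply: ler_wpM2r; first exact: cabs_ge0.
  by rewrite ler_peMl// ler1n.
have e2 : 0 < e / 2 by rewrite divr_gt0.
have [N1 h1] := plemelj (cl_measurable cl_circle) b1 b2 zlim clim e2.
have [N2 h2] := clim _ e2.
pose n := maxn N1 N2.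
have [_ _] := zP n; rewrite leNgt => /negP; apply.
have := h1 n (leq_maxl _ _); have := h2 n (leq_maxr _ _) => A B.
rewrite /Psi (radial_unit u01) opprD addrACA; apply: le_lt_trans (cabsD _ _) _.
by rewrite cabs_realB [ltRHS]splitr; exact: ltrD.
Qed.

(** From [Re_boundary_mean], as the Cauchy kernel has constant real part on the
circle. *)
Lemma Re_Psi u : cabs u = 1 ->
  complex.Re (Psi u) = (l u + complex.Re (mean (fun t => (l (cis t))%:C))) / 2.
Proof.
move=> u1; rewrite /Psi ReD (radial_unit u1).
rewrite (Re_boundary_mean (l := fun t => l (cis t)) cl_circle u1); last by move=> t ->.
have -> : complex.Re (l u)%:C = l u by [].
by field.
Qed.

End LipschitzDensity.

(** * Riesz and logarithmic kernels of planar measures *)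
Section PlaneKernels.
Context {R : realType}.
Notation T := (plane R).
Implicit Types (z w : R[i]) (p q : T).

Lemma cmeas_toC (D : set T) : cmeas D (@toC R).
Proof.
by split; apply: measurable_funTS; [exact: measurable_fst|exact: measurable_snd].
Qed.

Definition pball z (rho : R) : set T := [set p | cabs (toC p - z) < rho].

Lemma measurable_lt d (X : measurableType d) (f : X -> R) (c : R) :
  measurable_fun setT f -> measurable [set x | f x < c].
Proof.
move=> mf; rewrite -[X in measurable X]setTI.
have := mf measurableT `]-oo, c[%classic (measurable_itv _).
by congr (measurable (_ `&` _)); apply/seteqP; split => x /=; rewrite in_itv.
Qed.

Lemma pball_measurable z rho : measurable (pball z rho).
Proof.
apply: measurable_lt; apply: cmeas_abs; apply: cmeasB; first exact: cmeas_toC.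
exact: cmeas_cst.
Qed.

Lemma closed_disk_measurable rho : measurable (@toC R @^-1` closed_disk rho).
Proof.
rewrite (_ : _ @^-1` _ = ~` [set p | - cabs (toC p) < - rho]).
  apply/measurableC/measurable_lt; apply: measurableT_comp => //.
  by apply: cmeas_abs; exact: cmeas_toC.
apply/seteqP; split => p /=; rewrite /closed_disk /= ltrN2; first by move=> h; rewrite ltNge h.
by move=> /negP; rewrite -leNgt.
Qed.

(** A majorant of [1 / |p - z|] near [z], assembled from indicators of dyadic
disks, so that its integral is controlled by the measures of disks. *)
Definition dyadic z (eps : R) (p : T) : \bar R :=
  (\sum_(0 <= n <oo) (2 ^+ n.+1 / eps * \1_(pball z (eps / 2 ^+ n)) p)%:E)%E.

Lemma dyadic_term_ge0 z (eps : R) n p : 0 < eps ->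
  (0 <= (2 ^+ n.+1 / eps * \1_(pball z (eps / 2 ^+ n)) p)%:E)%E.
Proof. by move=> e0; rewrite lee_fin mulr_ge0// divr_ge0 ?exprn_ge0// ltW. Qed.

Lemma dyadic_ge0 z (eps : R) p : 0 < eps -> (0 <= dyadic z eps p)%E.
Proof. by move=> e0; apply: nneseries_ge0 => n _ _; exact: dyadic_term_ge0. Qed.

Lemma dyadic_ge_term z (eps : R) n p : 0 < eps -> pball z (eps / 2 ^+ n) p ->
  ((2 ^+ n.+1 / eps)%:E <= dyadic z eps p)%E.
Proof.
move=> e0 pz; apply: le_trans (nneseries_lim_ge n.+1 _); last first.
  by move=> k _ _; exact: dyadic_term_ge0.
rewrite big_nat_recr //= indicE mem_set// mulr1 leeDr//.
by apply: sume_ge0 => k _; exact: dyadic_term_ge0.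
Qed.

Lemma measurable_dyadic z (eps : R) (D : set T) : 0 < eps -> measurable D ->
  measurable_fun D (dyadic z eps).
Proof.
move=> e0 mD; apply: ge0_emeasurable_sum => // n; first by move=> x _ _; exact: dyadic_term_ge0.
move=> _; apply/measurable_EFinP/measurable_funM => //.
by apply: measurable_indic; exact: pball_measurable.
Qed.

Lemma dyadic_center z (eps : R) p : 0 < eps -> toC p = z -> dyadic z eps p = +oo%E.
Proof.
move=> e0 pz; apply/eqyP => A A0.
have [n hn] : exists n, A <= 2 ^+ n.+1 / eps.
  exists (Num.bound (A * eps)); rewrite ler_pdivlMr//; apply/ltW.
  apply: lt_trans (archi_boundP _) _; first by rewrite mulr_ge0 ?ltW.
  by rewrite -natrX ltr_nat (ltn_trans (ltn_expl _ (ltnSn 1)))// ltn_exp2l.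
apply: le_trans (dyadic_ge_term (n := n) e0 _); first by rewrite lee_fin.
by rewrite /pball /= pz subrr cabs0 divr_gt0// exprn_gt0.
Qed.

Lemma dyadic_ge z (eps : R) p : 0 < eps -> cabs (toC p - z) < eps ->
  ((cabs (toC p - z))^-1%:E <= dyadic z eps p)%E.
Proof.
move=> e0 pe; have [/eqP|d0] := boolP (cabs (toC p - z) == 0).
  by move=> ->; rewrite invr0; exact: dyadic_ge0.
set x := cabs _ in pe d0 *.
have x0 : 0 < x by rewrite lt_def d0 cabs_ge0.
have ex : exists n, eps / 2 ^+ n <= x.
  exists (Num.bound (eps / x)); rewrite ler_pdivrMr ?exprn_gt0// mulrC -ler_pdivrMr//.
  apply/ltW; apply: lt_trans (archi_boundP _) _; first by rewrite divr_ge0 ?ltW.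
  by rewrite -natrX ltr_nat ltn_expl.
have [n hn nmin] := ex_minnP ex.
case: n hn nmin => [|n] hn nmin.
  by move: hn; rewrite expr0 divr1 leNgt pe.
have hn' : x < eps / 2 ^+ n.
  by rewrite ltNge; apply/negP => /nmin; rewrite ltnn.
apply: le_trans (dyadic_ge_term e0 hn').
rewrite lee_fin -[leRHS]invrK lef_pV2 ?posrE// ?invf_div//.
by rewrite divr_gt0// exprn_gt0.
Qed.

Section Measure.
Variables (mu : {measure set T -> \bar R}) (C eps0 : R).
Hypothesis C0 : 0 <= C.

Definition ball_bound z := forall rho, 0 < rho -> rho < eps0 ->
  (mu (pball z rho) <= (C * rho ^+ 2)%:E)%E.

(** The disk of radius [eps / 2 ^ n] has measure at most [C * (eps / 2 ^ n) ^ 2],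
so the terms of the series are dominated by a geometric one. *)
Lemma dyadic_integral z (eps : R) (D : set T) : 0 < eps < eps0 -> measurable D ->
  ball_bound z -> (\int[mu]_(p in D) dyadic z eps p <= (4 * C * eps)%:E)%E.
Proof.
move=> /andP[e0 ee0] mD bz.
have mt n : measurable_fun D (fun p => (2 ^+ n.+1 / eps * \1_(pball z (eps / 2 ^+ n)) p)%:E).
  apply/measurable_EFinP/measurable_funM => //.
  by apply: measurable_indic; exact: pball_measurable.
rewrite integral_nneseries//; last by move=> n p _; exact: dyadic_term_ge0.
have tb n : (\int[mu]_(p in D) (2 ^+ n.+1 / eps * \1_(pball z (eps / 2 ^+ n)) p)%:E
    <= (geometric (2 * C * eps) (2^-1) n)%:E)%E.
  under eq_integral do rewrite EFinM.
  rewrite ge0_integralZl//; last 2 first.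
  - by apply/measurable_EFinP/measurable_indic; exact: pball_measurable.
  - by rewrite lee_fin divr_ge0 ?exprn_ge0// ltW.
  rewrite integral_indic//; last exact: pball_measurable.
  apply: (@le_trans _ _ ((2 ^+ n.+1 / eps)%:E * (C * (eps / 2 ^+ n) ^+ 2)%:E))%E.
    apply: lee_wpmul2l; first by rewrite lee_fin divr_ge0 ?exprn_ge0// ltW.
    apply: le_trans (bz (eps / 2 ^+ n) _ _).
    - apply: le_measure; rewrite ?inE; first exact: measurableI (pball_measurable _ _) mD.
        exact: pball_measurable.
      exact: subIsetl.
    - by rewrite divr_gt0// exprn_gt0.
    - apply: le_lt_trans ee0; rewrite ler_pdivrMr ?exprn_gt0//.
      by apply: ler_peMr; [exact: ltW|rewrite exprn_ege1// ler1n].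
  rewrite -EFinM lee_fin /geometric /= le_eqVlt; apply/orP; left; apply/eqP.
  have p0 : (2 ^+ n : R) != 0 by rewrite expf_neq0.
  by rewrite exprS exprVn; field; rewrite p0 gt_eqF.
apply: lime_le.
  by apply: is_cvg_nneseries => n _ _; apply: integral_ge0 => p _; exact: dyadic_term_ge0.
apply: nearW => N.
apply: (@le_trans _ _ (\sum_(0 <= n < N) (geometric (2 * C * eps) (2^-1) n)%:E)%E).
  by apply: lee_sum => n _; exact: tb.
rewrite sumEFin lee_fin.
have := @geometric_le_lim R N (2 * C * eps) (2^-1); rewrite /series /=.
have -> : (1 - 2^-1 : R)^-1 = 2 by field.
rewrite (_ : 4 * C * eps = 2 * C * eps * 2); last by ring.
apply.
- by rewrite !mulr_ge0// ltW.
- by rewrite invr_gt0.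
- by rewrite ger0_norm ?invr_ge0// invf_lt1// ltr1n.
Qed.

End Measure.

(** The logarithmic kernel, shifted so as to be nonnegative on a disk. *)
Definition lkernel (c : R) z w : \bar R := (log_kernel z w + c%:E)%E.

Lemma log_kernelE z w : z != w -> log_kernel z w = (- ln (cabs (z - w)))%:E.
Proof. by move=> zw; rewrite /log_kernel lne_EFin ?EFinN// cabs_gt0 subr_eq0. Qed.

Lemma log_kernel_diag z : log_kernel z z = +oo%E.
Proof. by rewrite /log_kernel subrr cabs0 le0_lneNy. Qed.

Lemma measurable_log_kernel d (X : measurableType d) (f g : X -> R[i]) :
  cmeas setT f -> cmeas setT g -> measurable_fun setT (fun x => log_kernel (f x) (g x)).
Proof.
move=> mf mg.
have mabs : measurable_fun setT (fun x => cabs (f x - g x)) by apply/cmeas_abs/cmeasB.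
rewrite (_ : (fun x => _) = (fun x => if cabs (f x - g x) == 0 then +oo%E
   else (- ln (cabs (f x - g x)))%:E)).
  apply: measurable_fun_ifT => //; first exact: measurable_fun_eqr.
  apply/measurable_EFinP; apply: measurableT_comp => //.
  exact: measurableT_comp.
apply/funext => x; rewrite cabs_eq0 subr_eq0; case: eqP => [->|/eqP fg].
  by rewrite log_kernel_diag.
by rewrite log_kernelE.
Qed.

Lemma log_kernel_le_inv (p : T) z : toC p != z ->
  (log_kernel (toC p) z <= (cabs (toC p - z))^-1%:E)%E.
Proof.
move=> pz; rewrite log_kernelE// lee_fin.
have x0 : 0 < cabs (toC p - z) by rewrite cabs_gt0 subr_eq0.
by rewrite -lnV ?posrE//; apply/ltW/ln_sublinear; rewrite invr_gt0.
Qed.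

Lemma log_kernel_dyadic (p : T) z (eps : R) : 0 < eps ->
  (log_kernel (toC p) z <= (eps^-1)%:E + dyadic z eps p)%E.
Proof.
move=> e0; have [pz|/eqP pz] := pselect (toC p = z).
  by rewrite dyadic_center// addey// leey.
apply: le_trans (log_kernel_le_inv pz) _.
have x0 : 0 < cabs (toC p - z) by rewrite cabs_gt0 subr_eq0.
have [xe|ex] := ltP (cabs (toC p - z)) eps.
  apply: le_trans (dyadic_ge e0 xe) _; rewrite leeDr// lee_fin invr_ge0 ltW//.
apply: (@le_trans _ _ (eps^-1)%:E); first by rewrite lee_fin lef_pV2 ?posrE.
by rewrite leeDl//; exact: dyadic_ge0.
Qed.

Lemma lkernel_ge0 (c rho : R) z w : 2 * rho <= expR c -> cabs z <= rho -> cabs w <= rho ->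
  (0 <= lkernel c z w)%E.
Proof.
move=> cr zr wr; rewrite /lkernel; have [->|/eqP zw] := pselect (z = w).
  by rewrite log_kernel_diag addye// leey.
rewrite log_kernelE// -EFinD lee_fin addrC subr_ge0 -[leRHS]expRK ler_ln ?posrE ?expR_gt0 ?cabs_gt0 ?subr_eq0//.
by apply: le_trans cr; apply: le_trans (cabsB _ _) _; rewrite mulr_natl mulr2n lerD.
Qed.

End PlaneKernels.

(** * The Cauchy transform *)
Section CauchyTransform.
Context {R : realType}.
Notation T := (plane R).
Implicit Types (z w : R[i]) (p q : T).
Variable sigma : probability T R.

Lemma integral_full (D : set T) (f : T -> \bar R) : measurable D -> sigma (~` D) = 0%E ->
  measurable_fun setT f -> (\int[sigma]_(p in D) f p = \int[sigma]_p f p)%E.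
Proof.
move=> mD D0 mf; rewrite integral_mkcond.
have mfD : measurable_fun setT (f \_ D) by apply/(measurable_restrictT _ mD)/measurable_funTS.
apply: ae_eq_integral => //; exists (~` D); split => //; first exact: measurableC.
move=> p /= h Dp; apply: h => _; rewrite patchE mem_set//.
Qed.

Lemma Cint_full (D : set T) (f : T -> R[i]) : measurable D -> sigma (~` D) = 0%E ->
  cmeas setT f -> Cint sigma D f = Cint sigma setT f.
Proof.
move=> mD D0 [mR mI]; rewrite /Cint; congr (_ +i* _); rewrite /Rintegral integral_full//;
  exact/measurable_EFinP.
Qed.

Definition cauchy_transform z : R[i] := Cint sigma setT (fun p => (z - toC p)^-1).

Lemma cmeas_cauchy_kernel z (D : set T) : cmeas D (fun p => (z - toC p)^-1).
Proof. by apply/cmeasV/cmeasB; [exact: cmeas_cst|exact: cmeas_toC]. Qed.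

Lemma measurable_inv_dist z (D : set T) : measurable_fun D (fun p => (cabs (toC p - z))^-1).
Proof.
apply: (measurableT_comp measurable_inv); apply: cmeas_abs.
by apply: cmeasB; [exact: cmeas_toC|exact: cmeas_cst].
Qed.

Definition near_part z (rho : R) p : R := \1_(pball z rho) p * (cabs (toC p - z))^-1.

Lemma near_part_ge0 z rho p : 0 <= near_part z rho p.
Proof. by rewrite mulr_ge0// invr_ge0 cabs_ge0. Qed.

Lemma measurable_near_part z rho (D : set T) : measurable_fun D (near_part z rho).
Proof.
apply: measurable_funM; last exact: measurable_inv_dist.
by apply: measurable_indic; exact: pball_measurable.
Qed.

Section Bounded.
Variables (C eps0 : R) (z : R[i]).
Hypothesis C0 : 0 <= C.
Hypothesis bz : ball_bound sigma C eps0 z.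

Lemma near_part_integral rho : 0 < rho < eps0 ->
  (\int[sigma]_p (near_part z rho p)%:E <= (4 * C * rho)%:E)%E.
Proof.
move=> r0; have rp : 0 < rho by case/andP: r0.
apply: le_trans (dyadic_integral C0 r0 measurableT bz).
apply: ge0_le_integral => //.
- by move=> p _; rewrite lee_fin near_part_ge0.
- by apply/measurable_EFinP; exact: measurable_near_part.
- exact: measurable_dyadic.
- move=> p _; rewrite /near_part indicE; have [pb|pb] := boolP (p \in pball z rho).
    by rewrite mul1r; apply: dyadic_ge => //; rewrite inE in pb.
  by rewrite mul0r; exact: dyadic_ge0.
Qed.

Lemma near_part_integrable rho : 0 < rho < eps0 ->
  sigma.-integrable setT (EFin \o near_part z rho).
Proof.
move=> r0; apply/integrableP; split; first by apply/measurable_EFinP; exact: measurable_near_part.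
under eq_integral do rewrite gee0_abs ?lee_fin ?near_part_ge0//.
by apply: le_lt_trans (near_part_integral r0) _; rewrite ltry.
Qed.

Lemma near_part_Rintegral rho : 0 < rho < eps0 ->
  Rintegral sigma setT (near_part z rho) <= 4 * C * rho.
Proof.
move=> r0; rewrite -lee_fin /Rintegral fineK; first exact: near_part_integral.
by apply: integrable_fin_num => //; exact: near_part_integrable.
Qed.

Lemma inv_dist_near rho p : 0 < rho ->
  (cabs (toC p - z))^-1 <= rho^-1 + near_part z rho p.
Proof.
move=> r0; rewrite /near_part indicE; have [pb|/negP pb] := boolP (p \in pball z rho).
  by rewrite mul1r lerDr invr_ge0 ltW.
have {}pb : rho <= cabs (toC p - z).
  by rewrite leNgt; apply/negP => h; apply: pb; rewrite inE.
by rewrite mul0r addr0 lef_pV2// posrE (lt_le_trans r0).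
Qed.

Lemma finite_cst_integrable (c : R) : sigma.-integrable setT (EFin \o (fun=> c)).
Proof.
apply: measurable_bounded_integrable => //; first by rewrite [X in (X < _)%E]probability_setT ltry.
by exists `|c|; split; rewrite ?num_real// => x cx y _ /=; exact: ltW.
Qed.

Lemma inv_dist_integrable : 0 < eps0 ->
  sigma.-integrable setT (EFin \o (fun p => (cabs (toC p - z))^-1)).
Proof.
move=> e0; have r0 : 0 < eps0 / 2 < eps0.
  by rewrite divr_gt0//= ltr_pdivrMr// mulr_natr mulr2n ltrDl.
have i2 : sigma.-integrable setT (EFin \o (fun p => (eps0 / 2)^-1 + near_part z (eps0 / 2) p)).
  rewrite (_ : _ \o _ = (EFin \o (fun=> (eps0 / 2)^-1)%R) \+ (EFin \o near_part z (eps0 / 2)%R))%E//.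
  by apply: integrableD => //; [exact: finite_cst_integrable|exact: near_part_integrable].
apply: (le_integrable measurableT _ _ i2).
  by apply/measurable_EFinP; exact: measurable_inv_dist.
move=> p _ /=; rewrite lee_fin !ger0_norm ?invr_ge0 ?cabs_ge0//.
  by apply: inv_dist_near; case/andP: r0.
by rewrite addr_ge0 ?near_part_ge0// invr_ge0; case/andP: r0 => /ltW.
Qed.

Lemma cauchy_kernel_integrable : 0 < eps0 -> cintegrable sigma setT (fun p => (z - toC p)^-1).
Proof.
move=> e0; apply: (cintegrable_le measurableT _ (inv_dist_integrable e0)).
  exact: cmeas_cauchy_kernel.
by move=> p _; rewrite cabsV cabsC.
Qed.

End Bounded.

(** The measures considered below satisfy this away from the origin, where
   their density may be unbounded. *)
Definition locally_bounded_at z0 (C eps0 : R) :=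
  [/\ 0 <= C, 0 < eps0 & forall z, cabs (z - z0) < eps0 -> ball_bound sigma C eps0 z].

(** Away from [z0] the resolvent identity gives a bound of order [|z - z0|]; nearby
the two kernels are estimated separately. *)
Lemma cauchy_kernel_diff z z0 (rho : R) p : 0 < rho -> cabs (z - z0) < rho ->
  cabs ((z - toC p)^-1 - (z0 - toC p)^-1) <=
  cabs (z - z0) / rho ^+ 2 + near_part z (2 * rho) p + near_part z0 (2 * rho) p.
Proof.
move=> r0 zr.
have np y : cabs (toC p - y) < 2 * rho -> near_part y (2 * rho) p = (cabs (toC p - y))^-1.
  by move=> h; rewrite /near_part indicE mem_set// mul1r.
have q0 : 0 <= cabs (z - z0) / rho ^+ 2 by rewrite divr_ge0 ?cabs_ge0// exprn_ge0// ltW.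
have small : cabs (toC p - z) < rho \/ cabs (toC p - z0) < rho ->
    cabs ((z - toC p)^-1 - (z0 - toC p)^-1) <=
    cabs (z - z0) / rho ^+ 2 + near_part z (2 * rho) p + near_part z0 (2 * rho) p.
  move=> h; have [h1 h2] : cabs (toC p - z) < 2 * rho /\ cabs (toC p - z0) < 2 * rho.
    have a := cabs_tri (toC p) z z0; have b := cabs_tri (toC p) z0 z.
    rewrite (cabsC z0) in b.
    by split; case: h => h; clear -h a b zr r0; lra.
  rewrite !np// -addrA; apply: le_trans (cabsB _ _) _; rewrite !cabsV (cabsC z) (cabsC z0 (toC p)).
  by rewrite lerDr.
have [lt1|ge1] := ltP (cabs (toC p - z)) rho; first by apply: small; left.
have [lt2|ge2] := ltP (cabs (toC p - z0)) rho; first by apply: small; right.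
have n1 : z - toC p != 0 by rewrite -cabs_gt0 cabsC (lt_le_trans r0).
have n2 : z0 - toC p != 0 by rewrite -cabs_gt0 cabsC (lt_le_trans r0).
have -> : (z - toC p)^-1 - (z0 - toC p)^-1 = - (z - z0) / ((z - toC p) * (z0 - toC p)).
  by field; rewrite n1 n2.
rewrite -addrA; apply: le_trans (_ : _ <= cabs (z - z0) / rho ^+ 2) _; last first.
  by rewrite lerDl addr_ge0// near_part_ge0.
rewrite cabsM cabsN cabsV cabsM; apply: ler_wpM2l; first exact: cabs_ge0.
rewrite lef_pV2 ?posrE ?mulr_gt0 ?cabs_gt0// ?exprn_gt0// expr2.
by apply: ler_pM; rewrite ?(ltW r0)// cabsC.
Qed.

(** The contribution of a small disk is small uniformly in [z], by
[near_part_Rintegral]; the rest depends continuously on [z]. *)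
Theorem cauchy_transform_cont z0 (C eps0 : R) : locally_bounded_at z0 C eps0 ->
  econt cdist cauchy_transform z0.
Proof.
move=> [C0 e0 bz] e ep.
have z00 : cabs (z0 - z0) < eps0 by rewrite subrr cabs0.
pose rho := Order.min (eps0 / 4) (e / (64 * (C + 1))).
have C1 : 0 < C + 1 by rewrite ltr_pwDr.
have r0 : 0 < rho by rewrite lt_min !divr_gt0// mulr_gt0.
have r1 : rho <= eps0 / 4 by rewrite ge_min lexx.
have r2 : rho * (64 * (C + 1)) <= e.
  by rewrite -ler_pdivlMr ?mulr_gt0// ge_min lexx orbT.
have r20 : 0 < 2 * rho < eps0 by rewrite mulr_gt0//=; clear -r1 e0; lra.
pose s := Order.min rho (rho ^+ 2 * (e / 8)).
have s0 : 0 < s by rewrite lt_min r0 mulr_gt0 ?exprn_gt0// divr_gt0.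
exists s => // z; rewrite /cdist => zs.
have zr : cabs (z - z0) < rho by apply: lt_le_trans zs _; rewrite ge_min lexx.
have zr2 : cabs (z - z0) / rho ^+ 2 <= e / 8.
  rewrite ler_pdivrMr ?exprn_gt0// mulrC; apply/ltW.
  by apply: lt_le_trans zs _; rewrite ge_min lexx orbT.
have ze : cabs (z - z0) < eps0 by apply: lt_le_trans zr _; clear -r1 e0; lra.
have bz1 := bz z ze; have bz0 := bz z0 z00.
rewrite /cauchy_transform -CintB//; last 2 first.
- exact: (cauchy_kernel_integrable C0 bz1).
- exact: (cauchy_kernel_integrable C0 bz0).
have ik := finite_cst_integrable (cabs (z - z0) / rho ^+ 2).
have i1 := near_part_integrable C0 bz1 r20; have i2 := near_part_integrable C0 bz0 r20.
have i12 : sigma.-integrable setT (EFin \o (fun p => cabs (z - z0) / rho ^+ 2 + near_part z (2 * rho) p)).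
  by rewrite (_ : _ \o _ = (EFin \o (fun=> cabs (z - z0) / rho ^+ 2)%R) \+ (EFin \o near_part z (2 * rho)%R))%E//; exact: integrableD.
have i123 : sigma.-integrable setT (EFin \o (fun p => cabs (z - z0) / rho ^+ 2 + near_part z (2 * rho) p + near_part z0 (2 * rho) p)).
  rewrite (_ : _ \o _ = (EFin \o (fun p => cabs (z - z0) / rho ^+ 2 + near_part z (2 * rho) p)%R) \+ (EFin \o near_part z0 (2 * rho)%R))%E//.
  exact: integrableD.
apply: le_lt_trans (Cint_le measurableT _ i123 _) _.
- apply: cintegrableB => //.
    exact: (cauchy_kernel_integrable C0 bz1).
  exact: (cauchy_kernel_integrable C0 bz0).
- by move=> p _; exact: cauchy_kernel_diff.
have s1 : fine (sigma [set: T]) = 1 by rewrite probability_setT.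
rewrite RintegralD// RintegralD// Rintegral_cst// s1 mulr1.
have A := near_part_Rintegral C0 bz1 r20; have B := near_part_Rintegral C0 bz0 r20.
have : C * rho <= (C + 1) * rho by apply: ler_wpM2r; [exact: ltW|rewrite lerDl].
rewrite (_ : 4 * C * (2 * rho) = 8 * (C * rho)) in A B; last by ring.
rewrite (_ : rho * (64 * (C + 1)) = 64 * ((C + 1) * rho)) in r2; last by ring.
move=> D; move: A B D r2 zr2 ep; move: (Rintegral _ _ _) (Rintegral _ _ _) (_ / _) (C * rho) ((C + 1) * rho).
by move=> x1 x2 x3 x4 x5; clear; lra.
Qed.

(** The kernel has no singularity on the complement of the null disk. *)
Theorem cauchy_transform_cdiff z0 (C eps0 s : R) : locally_bounded_at z0 C eps0 -> 0 < s ->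
  sigma (pball z0 s) = 0%E -> cdiff cauchy_transform z0.
Proof.
move=> [C0 e0 bz] s0 bs.
pose D := ~` pball z0 s.
have mD : measurable D by apply: measurableC; exact: pball_measurable.
have D0 : sigma (~` D) = 0%E by rewrite setCK.
have fD : (sigma D < +oo)%E by apply: le_lt_trans (probability_le1 sigma mD) _; rewrite ltry.
have : cdiff (fun z => - Cint sigma D (fun p => 1 / (toC p - z))) z0.
  apply: cdiffN; apply: (@cauchy_integral_cdiff _ _ _ _ _ _ _ 1 s) => //.
  - exact: cmeas_toC.
  - by move=> p _; rewrite cabs1.
  - by move=> p /= /negP; rewrite -leNgt.
apply: cdiff_near; exists (Order.min eps0 (s / 2)); first by rewrite lt_min e0 divr_gt0.
move=> z; rewrite lt_min => /andP[ze zs].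
rewrite /cauchy_transform -(Cint_full mD D0); last exact: cmeas_cauchy_kernel.
rewrite -[LHS]mulN1r -CintZ//.
  by apply: eq_Cint => p _; rewrite mulN1r mul1r -invrN opprB.
apply: (@cmeas_integrable _ _ _ _ _ _ _ (s / 2)^-1) => //.
  by apply: cmeasM; [exact: cmeas_cst|apply/cmeasV/cmeasB; [exact: cmeas_toC|exact: cmeas_cst]].
move=> p /= /negP; rewrite -leNgt => sp; rewrite mul1r cabsV.
have : s / 2 <= cabs (toC p - z).
  by have := cabs_tri (toC p) z z0; clear -sp zs; lra.
by move=> h; rewrite lef_pV2// posrE ?divr_gt0// (lt_le_trans _ h)// divr_gt0.
Qed.

Lemma cauchy_transform_decay (rho : R) z : 0 < rho -> 2 * rho <= cabs z ->
  sigma (~` (@toC R @^-1` closed_disk rho)) = 0%E -> cabs (cauchy_transform z) <= 4 / cabs z.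
Proof.
move=> r0 zr D0; set D := _ @^-1` _ in D0.
have mD : measurable D := closed_disk_measurable rho.
have z0 : 0 < cabs z by apply: lt_le_trans zr; rewrite mulr_gt0.
rewrite /cauchy_transform -(Cint_full mD D0); last exact: cmeas_cauchy_kernel.
have b p : D p -> cabs (z - toC p)^-1 <= 2 / cabs z.
  rewrite /D /closed_disk /= => pr.
  have A := cabs_sub z (toC p).
  have h : cabs z / 2 <= cabs (z - toC p) by clear -A pr zr; lra.
  by rewrite cabsV -[leRHS]invrK invf_div lef_pV2// posrE ?divr_gt0// (lt_le_trans _ h)// divr_gt0.
have fD : (sigma D < +oo)%E by apply: le_lt_trans (probability_le1 sigma mD) _; rewrite ltry.
apply: le_trans (Cint_le_cst _ fD _ b) _ => //.
  by apply: (@cmeas_integrable _ _ _ _ _ _ _ (2 / cabs z)) => //; exact: cmeas_cauchy_kernel.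
have : fine (sigma D) <= 1 by rewrite -lee_fin fineK ?probability_le1// ge0_fin_numE.
move=> h; apply: le_trans (_ : 2 * (2 / cabs z) * 1 <= _).
  by apply: ler_wpM2l => //; rewrite mulr_ge0// divr_ge0// ltW.
by rewrite mulr1 mulrA -natrM.
Qed.

End CauchyTransform.

(** * Planar measures with a radial density *)
Section Density.
Context {R : realType}.
Notation T := (plane R).
Implicit Types (z w : R[i]) (p q : T).

Lemma open_plane_measurable (U : set R[i]) : open U -> measurable (@toC R @^-1` U).
Proof.
move=> oU.
pose B (a1 a2 : rat) (n : nat) : set T := pball (ratr a1 +i* ratr a2) n.+1%:R^-1.
pose F a1 a2 n := if pselect (B a1 a2 n `<=` @toC R @^-1` U) is left _ then B a1 a2 n else set0.
have -> : @toC R @^-1` U = \bigcup_a1 \bigcup_a2 \bigcup_n F a1 a2 n.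
  apply/seteqP; split => [p Up|p [a1 _ [a2 _ [n _]]]]; last first.
    by rewrite /F; case: pselect => // s; exact: s.
  have /nbhsC[e e0 he] : nbhs (toC p) U by exact: open_nbhs_nbhs.
  pose n := Num.bound (2 / e).
  have ne : 2 / n.+1%:R < e.
    rewrite ltr_pdivrMr ?ltr0n// mulrC -ltr_pdivrMr//.
    apply: lt_trans (archi_boundP _) _; first by rewrite divr_ge0// ltW.
    by rewrite ltr_nat.
  set d : R := n.+1%:R^-1 in ne.
  have d0 : 0 < d by rewrite invr_gt0 ltr0n.
  have ap (x : R) : exists q : rat, `|x - ratr q| < d / 2.
    have [q] : exists q : rat, ratr q \in `]x - d / 2, x + d / 2[.
      by apply: rat_in_itvoo; lra.
    rewrite in_itv /= => /andP[a b]; exists q.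
    by rewrite ltr_norml; lra.
  have [a1 h1] := ap p.1; have [a2 h2] := ap p.2.
  have pB : B a1 a2 n p.
    apply: le_lt_trans (cabs_le_ReIm _) _ => /=.
    by rewrite -/d [ltRHS]splitr; exact: ltrD.
  exists a1 => //; exists a2 => //; exists n => //; rewrite /F.
  case: pselect => // nB; exfalso; apply: nB => p' p'B; apply: he.
  apply: le_lt_trans (cabs_tri _ (ratr a1 +i* ratr a2) _) _; rewrite (cabsC _ (toC p)).
  apply: lt_trans (ltrD p'B pB) _; rewrite -/d; move: ne; rewrite -/d.
  by clear; lra.
apply: bigcupT_measurable_rat => a1; apply: bigcupT_measurable_rat => a2.
apply: bigcupT_measurable => n; rewrite /F; case: pselect => // _.
exact: pball_measurable.
Qed.

Definition box z (rho : R) : set T :=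
  `]complex.Re z - rho, complex.Re z + rho[%classic `*` `]complex.Im z - rho, complex.Im z + rho[%classic.

Lemma area_box z (rho : R) : 0 <= rho -> area (box z rho) = ((2 * rho) ^+ 2)%:E.
Proof.
move=> r0; rewrite /area product_measure1E; [|exact: measurable_itv|exact: measurable_itv].
transitivity (@lebesgue_measure R `](complex.Re z - rho)%R, (complex.Re z + rho)%R[%classic *
  @lebesgue_measure R `](complex.Im z - rho)%R, (complex.Im z + rho)%R[%classic)%E; first by [].
rewrite !lebesgue_measure_itv /= !lte_fin.
case: ltP => h1; last first.
  have -> : rho = 0 by apply/eqP; rewrite eq_le r0 andbT; lra.
  by rewrite mul0e mulr0 expr0n.
case: ltP => h2; last by exfalso; lra.
by rewrite -!EFinB -EFinM; congr (_%:E); ring.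
Qed.

Lemma box_measurable z rho : measurable (box z rho).
Proof. by apply: measurableX; exact: measurable_itv. Qed.

Lemma pball_sub_box z rho : pball z rho `<=` box z rho.
Proof.
move=> p pz; rewrite /box /=.
have A := le_lt_trans (Re_le_cabs _) pz; have B := le_lt_trans (Im_le_cabs _) pz.
move: A B; rewrite ReD ReN ImD ImN /= !in_itv /= !ltr_norml => A B.
by split; [lra|lra].
Qed.

Lemma box_sub_pball z rho : box z (rho / 2) `<=` pball z rho.
Proof.
move=> p [/= A B]; rewrite /pball /=.
apply: le_lt_trans (cabs_le_ReIm _) _.
rewrite [ltRHS]splitr ReD ReN ImD ImN /=; move: A B; rewrite !in_itv /= => A B.
by apply: ltrD; rewrite ltr_norml; [lra|lra].
Qed.

Lemma area_pball_le z (rho : R) : 0 <= rho -> (area (pball z rho) <= (4 * rho ^+ 2)%:E)%E.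
Proof.
move=> r0; apply: (@le_trans _ _ (area (box z rho))).
  apply: le_measure; rewrite ?inE; [exact: pball_measurable|exact: box_measurable|].
  exact: pball_sub_box.
by rewrite area_box// lee_fin exprMn -natrX.
Qed.

Lemma area_pball_gt0 z (rho : R) : 0 < rho -> (0 < area (pball z rho))%E.
Proof.
move=> r0; apply: (@lt_le_trans _ _ (area (box z (rho / 2)))).
  by rewrite area_box ?divr_ge0 ?ltW// lte_fin exprn_gt0// mulr_gt0// divr_gt0.
apply: le_measure; rewrite ?inE; [exact: box_measurable|exact: pball_measurable|].
exact: box_sub_pball.
Qed.

Variable g : R -> R.
Hypothesis g_gt0 : forall s, 0 < s -> 0 < g s.
Hypothesis g_cont : forall s, 0 < s -> {for s, continuous g}.
Variables (E : set R[i]) (sigma : probability T R).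
Hypothesis mE : measurable (@toC R @^-1` E).
Hypothesis sigmaE : forall A, measurable A ->
  sigma A = (\int[area]_(p in A) (\1_(@toC R @^-1` E) p * g (cabs (toC p) ^+ 2))%:E)%E.

Lemma measurable_radial (D : set T) : measurable D -> (forall p, D p -> 0 < cabs (toC p)) ->
  measurable_fun D (fun p => g (cabs (toC p) ^+ 2)).
Proof.
move=> mD D0.
have mg : measurable_fun (`]0, +oo[%classic : set R) g.
  apply: open_continuous_measurable_fun; first exact: interval_open.
  by move=> s; rewrite inE /= in_itv /= andbT; exact: g_cont.
have mc : measurable_fun D (fun p => cabs (toC p) ^+ 2).
  by apply: measurable_funX; apply: cmeas_abs; exact: cmeas_toC.
have sub : (fun p => cabs (toC p) ^+ 2) @` D `<=` (`]0, +oo[%classic : set R).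
  by move=> _ [p Dp <-] /=; rewrite in_itv /= andbT exprn_gt0// D0.
exact: (measurable_comp (measurable_itv _) sub mg mc).
Qed.

Lemma measurable_density (D : set T) : measurable D -> (forall p, D p -> 0 < cabs (toC p)) ->
  measurable_fun D (fun p => (\1_(@toC R @^-1` E) p * g (cabs (toC p) ^+ 2))%:E).
Proof.
move=> mD D0; apply/measurable_EFinP/measurable_funM; last exact: measurable_radial.
exact: measurable_indic.
Qed.

Lemma density_pinched z0 : z0 != 0 -> exists lo hi : R, [/\ 0 < lo, 0 < hi &
  forall p, pball z0 (cabs z0 / 2) p -> 0 < cabs (toC p) /\ lo <= g (cabs (toC p) ^+ 2) <= hi].
Proof.
rewrite -cabs_gt0; set m := cabs z0 => m0.
have h : (m / 2) ^+ 2 <= (2 * m) ^+ 2.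
  by rewrite ler_pXn2r ?nnegrE ?mulr_ge0 ?divr_ge0 ?(ltW m0)//; lra.
have cg : {within `[(m / 2) ^+ 2, (2 * m) ^+ 2], continuous g}.
  apply: continuous_in_subspaceT => s; rewrite inE /= in_itv /= => /andP[s1 _].
  by apply: g_cont; apply: lt_le_trans s1; rewrite exprn_gt0// divr_gt0.
have [sM sMi hM] := EVT_max h cg; have [sm smi hm] := EVT_min h cg.
have pos s : s \in `[(m / 2) ^+ 2, (2 * m) ^+ 2] -> 0 < g s.
  rewrite in_itv /= => /andP[s1 _]; apply: g_gt0.
  by apply: lt_le_trans s1; rewrite exprn_gt0// divr_gt0.
exists (g sm), (g sM); split; [exact: pos|exact: pos|].
move=> p; rewrite /pball /= => pz.
have A := cabs_sub z0 (toC p); rewrite cabsC in A.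
have B := cabs_sub (toC p) z0.
have a1 : m / 2 < cabs (toC p) by move: A; rewrite -/m => A; lra.
have a2 : cabs (toC p) < 2 * m by move: B; rewrite -/m => B; lra.
have p0 : 0 < cabs (toC p) by apply: lt_trans a1; rewrite divr_gt0.
split => //.
have pi : cabs (toC p) ^+ 2 \in `[(m / 2) ^+ 2, (2 * m) ^+ 2].
  by rewrite in_itv /= !ler_pXn2r ?nnegrE ?mulr_ge0 ?divr_ge0 ?(ltW m0) ?(ltW p0) ?(ltW a1) ?(ltW a2).
by rewrite hm// hM.
Qed.

Lemma density_locally_bounded z0 : z0 != 0 -> exists C eps0, locally_bounded_at sigma z0 C eps0.
Proof.
move=> z0n; have [lo [hi [lo0 hi0 H]]] := density_pinched z0n.
have m0 : 0 < cabs z0 by rewrite cabs_gt0.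
exists (hi * 4), (cabs z0 / 4); split; [by rewrite mulr_ge0// ltW|by rewrite divr_gt0|].
move=> z zz rho r0 r1.
have sub : pball z rho `<=` pball z0 (cabs z0 / 2).
  move=> p pz; rewrite /pball /=; have := cabs_tri (toC p) z z0.
  by move: pz; rewrite /pball /= => a b; lra.
have Hz p : pball z rho p -> 0 < cabs (toC p) by move=> /sub /H[].
rewrite [X in (X <= _)%E](sigmaE (pball_measurable z rho)).
apply: (@le_trans _ _ (\int[area]_(p in pball z rho) cst hi%:E p)%E).
  apply: ge0_le_integral => //.
  - exact: pball_measurable.
  - move=> p pz; rewrite lee_fin mulr_ge0//.
    by have [_ /andP[a _]] := H p (sub _ pz); apply: le_trans a; exact: ltW.
  - by apply: measurable_density => //; exact: pball_measurable.
  - move=> p pz; rewrite lee_fin; have [_ /andP[a b]] := H p (sub _ pz).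
    have i1 : \1_(@toC R @^-1` E) p <= 1 :> R by rewrite indicE; case: (_ \in _).
    have i0 : 0 <= \1_(@toC R @^-1` E) p :> R by [].
    by rewrite -[leRHS]mul1r ler_pM// (le_trans _ a)// ltW.
rewrite integral_cst; last exact: pball_measurable.
apply: (@le_trans _ _ (hi%:E * (4 * rho ^+ 2)%:E)%E).
  by apply: lee_wpmul2l; [rewrite lee_fin ltW|apply: area_pball_le; exact: ltW].
by rewrite -EFinM mulrA.
Qed.

Lemma density_outside z (s : R) : (forall w, cabs (w - z) < s -> ~ E w) -> sigma (pball z s) = 0%E.
Proof.
move=> Ez; rewrite [LHS](sigmaE (pball_measurable z s)).
rewrite -[RHS](integral0 area (pball z s)); apply: eq_integral => p; rewrite inE => pz.
by rewrite indicE memNset ?mul0r// => /(Ez _ pz).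
Qed.

Lemma density_inside z0 (s : R) : z0 != 0 -> 0 < s -> (forall w, cabs (w - z0) < s -> E w) ->
  (0 < sigma (pball z0 s))%E.
Proof.
move=> z0n s0 Ez; have [lo [hi [lo0 hi0 H]]] := density_pinched z0n.
have m0 : 0 < cabs z0 by rewrite cabs_gt0.
pose rho := Order.min s (cabs z0 / 2).
have r0 : 0 < rho by rewrite lt_min s0 divr_gt0.
have sub1 : pball z0 rho `<=` pball z0 s.
  by move=> p pz; rewrite /pball /=; apply: lt_le_trans pz _; rewrite ge_min lexx.
have sub2 : pball z0 rho `<=` pball z0 (cabs z0 / 2).
  by move=> p pz; rewrite /pball /=; apply: lt_le_trans pz _; rewrite ge_min lexx orbT.
apply: (@lt_le_trans _ _ (sigma (pball z0 rho))); last first.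
  by apply: le_measure; rewrite ?inE //; exact: pball_measurable.
rewrite [X in (_ < X)%E](sigmaE (pball_measurable z0 rho)).
apply: (@lt_le_trans _ _ (\int[area]_(p in pball z0 rho) cst lo%:E p)%E).
  rewrite integral_cst; last exact: pball_measurable.
  by rewrite mule_gt0// area_pball_gt0.
apply: ge0_le_integral => //.
- exact: pball_measurable.
- by move=> p _; rewrite lee_fin ltW.
- by apply: measurable_density; [exact: pball_measurable|move=> p /sub2 /H[]].
- move=> p pz; have [_ /andP[a _]] := H p (sub2 _ pz).
  rewrite lee_fin indicE mem_set ?mul1r//; apply: Ez; exact: sub1.
Qed.

End Density.

(** * Energies of admissible measures *)
Section Energy.
Context {R : realType}.
Notation T := (plane R).
Implicit Types (z w : R[i]) (mu : probability T R).

(** For functions bounded below, where the integral may be [+oo]. It allows the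
logarithmic kernel to be replaced by a nonnegative one. *)
Lemma integral_shift d (X : measurableType d) (mu : probability X R) (D : set X) (f : X -> \bar R) (c : R) :
  measurable D -> mu D = 1%E -> measurable_fun D f -> (forall x, D x -> (0 <= f x + c%:E)%E) ->
  (\int[mu]_(x in D) f x = \int[mu]_(x in D) (f x + c%:E) - c%:E)%E.
Proof.
move=> mD D1 mf f0.
have fNy x : D x -> f x != -oo%E by move=> /f0; case: (f x).
have mfc : measurable_fun D (fun x => f x + c%:E)%E by apply: emeasurable_funD.
have ic : mu.-integrable D (fun=> c%:E).
  apply: measurable_bounded_integrable => //; first by rewrite [X in (X < _)%E]D1 ltry.
  by exists `|c|; split; rewrite ?num_real// => x cx y _ /=; exact: ltW.
have [fin|inf] := pselect (\int[mu]_(x in D) (f x + c%:E) < +oo)%E.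
  have ifc : mu.-integrable D (fun x => f x + c%:E)%E.
    apply/integrableP; split => //.
    rewrite (eq_integral (fun x => f x + c%:E)%E)// => x; rewrite inE => Dx.
    by rewrite gee0_abs//; exact: f0.
  rewrite -[X in (_ - X)%E](_ : (\int[mu]_(x in D) (cst c%:E) x)%E = _); last first.
    by rewrite integral_cst// [X in (_ * X)%E]D1 mule1.
  rewrite -integralB//; apply: eq_integral => x xD; rewrite /=.
  by rewrite -addeA -EFinD subrr adde0.
have {}inf : (\int[mu]_(x in D) (f x + c%:E) = +oo)%E by apply/eqP; rewrite eq_le leey leNgt; apply/negP.
rewrite inf addye//.
have nb : (\int[mu]_(x in D) (f^\- x)%E <= `|c|%:E)%E.
  apply: (@le_trans _ _ (\int[mu]_(x in D) cst `|c|%:E x)%E); last first.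
    by rewrite integral_cst// [X in (_ * X)%E]D1 mule1.
  apply: ge0_le_integral => //.
  - exact: measurable_funeneg.
  - move=> x Dx; rewrite /= funenegE ge_max; apply/andP; split; last by rewrite lee_fin.
    have := f0 x Dx; case: (f x) => [y| |] //=; rewrite -?EFinD ?lee_fin ?leNye//.
    by move=> h; have := ler_norm c; lra.
have pb : (\int[mu]_(x in D) (f^\+ x)%E = +oo)%E.
  apply/eqP; rewrite eq_le leey /= leNgt; apply/negP => h.
  suff : (\int[mu]_(x in D) (f x + c%:E) < +oo)%E by rewrite inf ltxx.
  apply: (@le_lt_trans _ _ (\int[mu]_(x in D) (f^\+ x + cst `|c|%:E x))%E).
    apply: ge0_le_integral => //.
    - apply: emeasurable_funD; [exact: measurable_funepos|exact: measurable_cst].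
    - move=> x Dx; apply: leeD; last by rewrite lee_fin ler_norm.
      by rewrite funeposE le_max lexx.
  rewrite ge0_integralD//; [|exact: measurable_funepos|by move=> x _; rewrite /= lee_fin].
  rewrite integral_cst// [X in (_ * X)%E]D1 mule1.
  by rewrite lte_add_pinfty// ltry.
rewrite integralE pb addye//; apply: contraTneq nb => /(congr1 oppe); rewrite oppeK /= => ->; by rewrite -ltNge ltry.
Qed.

Lemma tonelli_on (mu : probability T R) (D : set T) (f : T * T -> \bar R) : measurable D ->
  measurable_fun setT f -> (forall p, (D `*` D) p -> (0 <= f p)%E) ->
  (\int[mu]_(q in D) \int[mu]_(p in D) f (p, q) = \int[(mu \x mu)%E]_(x in D `*` D) f x)%E /\
  measurable_fun D (fun q => \int[mu]_(p in D) f (p, q))%E.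
Proof.
move=> mD mf f0.
have mDD : measurable (D `*` D) by exact: measurableX.
pose g := f \_ (D `*` D).
have g0 x : (0 <= g x)%E by rewrite /g patchE; case: ifPn => // /[!inE]; exact: f0.
have mg : measurable_fun setT g by apply/(measurable_restrictT _ mDD)/measurable_funTS.
have E q : D q -> (\int[mu]_(p in D) f (p, q) = fubini_G mu g q)%E.
  move=> Dq; rewrite /fubini_G [LHS]integral_mkcond; apply: eq_integral => p _.
  rewrite /g !patchE; have [pD|pD] := boolP (p \in D).
    by rewrite mem_set//; split => //; rewrite inE in pD.
  by rewrite memNset// => -[Dp _]; move/negP: pD; apply; rewrite inE.
have mG : measurable_fun setT (fubini_G mu g) := measurable_fun_fubini_tonelli_G _ mg g0.
split; last by apply: (eq_measurable_fun (fubini_G mu g)) => [q /[!inE] /E//|]; exact: measurable_funTS.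
rewrite [RHS]integral_mkcond -/g (fubini_tonelli2 _ mg g0).
rewrite (_ : (\int[mu]_(q in D) _)%E = (\int[mu]_(q in D) fubini_G mu g q)%E); last first.
  by apply: eq_integral => q /[!inE] /E.
rewrite integral_mkcond; apply: eq_integral => q _; rewrite patchE; case: ifPn => // qD.
rewrite /fubini_G; apply/esym/integral0_eq => p _; rewrite /g patchE memNset// => -[_ Dq].
by move/negP: qD; apply; rewrite inE.
Qed.

(** Here [|1 + x|^2 = 1 + y] with [y = 2 * Re x + |x|^2], so that [|y| <= 3 * |x|]
and [y >= - 1/2], and [ln (1 + y) >= y - 2 * y^2] in this range. *)
Lemma ln_cabs_1D (x : R[i]) : cabs x <= 6^-1 ->
  - ln (cabs (1 + x)) <= - complex.Re x + 9 * cabs x ^+ 2.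
Proof.
move=> x6; pose y := 2 * complex.Re x + cabs x ^+ 2.
have x0 := cabs_ge0 x; have Rx := Re_le_cabs x.
have xx : cabs x ^+ 2 <= cabs x * 6^-1 by rewrite expr2 ler_wpM2l.
have yE : cabs (1 + x) ^+ 2 = 1 + y.
  by rewrite cabs_sqr ReD ImD /= add0r /y cabs_sqr; ring.
have yb : `|y| <= 3 * cabs x.
  apply: le_trans (ler_normD _ _) _; rewrite normrM ger0_norm// [X in _ + X]ger0_norm ?exprn_ge0//.
  by lra.
have y2 : - 2^-1 <= y by move: yb; rewrite ler_norml => yb; lra.
have y1 : 0 < 1 + y by lra.
have c0 : 0 < cabs (1 + x).
  by rewrite lt_def cabs_ge0 andbT; apply: contraTneq y1 => c; rewrite -yE c expr0n ltxx.
have L : ln (1 + y) = ln (cabs (1 + x)) *+ 2 by rewrite -yE lnXn.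
have : y - 2 * y ^+ 2 <= ln (1 + y).
  have i0 : 0 < (1 + y)^-1 by rewrite invr_gt0.
  have := @le_ln1Dx R ((1 + y)^-1 - 1); rewrite (_ : 1 + ((1 + y)^-1 - 1) = (1 + y)^-1); last by ring.
  rewrite lnV ?posrE// => h.
  have {}h : - ln (1 + y) <= (1 + y)^-1 - 1 by apply: h; lra.
  have e1 : (1 + y)^-1 - 1 = - (y / (1 + y)) by field; rewrite gt_eqF.
  have e2 : y / (1 + y) = y - y ^+ 2 / (1 + y) by field; rewrite gt_eqF.
  have : y ^+ 2 / (1 + y) <= 2 * y ^+ 2.
    rewrite ler_pdivrMr//; have := sqr_ge0 y => q.
    have : 0 <= y ^+ 2 * (1 + 2 * y) by rewrite mulr_ge0//; lra.
    by lra.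
  lra.
have : y ^+ 2 <= 9 * cabs x ^+ 2.
  have -> : 9 * cabs x ^+ 2 = (3 * cabs x) ^+ 2 by ring.
  by rewrite -real_normK ?num_real// ler_pXn2r ?nnegrE ?mulr_ge0.
rewrite L mulr2n /y.
have := sqr_ge0 (cabs x); lra.
Qed.

Variables (W : R[i] -> R) (r c : R).
Hypothesis cr : 2 * r <= expR c.
Notation D := (closed_disk r).
Notation DD := (@toC R @^-1` closed_disk r).
Hypothesis mW : measurable_fun DD (fun p => W (toC p)).
Variable MW : R.
Hypothesis WM : forall p, DD p -> `|W (toC p)| <= MW.

Definition pair_kernel (x : T * T) : \bar R := lkernel c (toC x.1) (toC x.2).

Lemma cmeas_toC1 : cmeas setT (fun x : T * T => toC x.1).
Proof.
have [a b] := cmeas_toC (@setT T).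
by split; [exact: (measurableT_comp a measurable_fst)|exact: (measurableT_comp b measurable_fst)].
Qed.

Lemma cmeas_toC2 : cmeas setT (fun x : T * T => toC x.2).
Proof.
have [a b] := cmeas_toC (@setT T).
by split; [exact: (measurableT_comp a measurable_snd)|exact: (measurableT_comp b measurable_snd)].
Qed.

Lemma measurable_pair_kernel : measurable_fun setT pair_kernel.
Proof.
apply: emeasurable_funD; last exact: measurable_cst.
by apply: measurable_log_kernel; [exact: cmeas_toC1|exact: cmeas_toC2].
Qed.

Lemma pair_kernel_ge0 x : (DD `*` DD) x -> (0 <= pair_kernel x)%E.
Proof. by move=> [h1 h2]; exact: (lkernel_ge0 cr). Qed.

(** A double integral of a nonnegative kernel, which differs from the interaction
term of [energy] by the constant [c]: see [energyE]. *)
Definition interaction mu : \bar R := (\int[(mu \x mu)%E]_(x in DD `*` DD) pair_kernel x)%E.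

Lemma interaction_ge0 mu : (0 <= interaction mu)%E.
Proof. by apply: integral_ge0 => x; exact: pair_kernel_ge0. Qed.

Lemma interactionE mu :
  interaction mu = (\int[mu]_(q in DD) \int[mu]_(p in DD) lkernel c (toC p) (toC q))%E.
Proof.
by rewrite /interaction -(tonelli_on mu (closed_disk_measurable r) measurable_pair_kernel pair_kernel_ge0).1.
Qed.

Lemma W_integrable mu : mu.-integrable DD (EFin \o (fun p => W (toC p))).
Proof.
apply: measurable_bounded_integrable => //; first exact: closed_disk_measurable.
- by apply: le_lt_trans (probability_le1 mu (closed_disk_measurable r)) _; rewrite ltry.
- by exists MW; split; rewrite ?num_real// => x Mx p /= /WM h; exact: le_trans h (ltW Mx).
Qed.

Lemma energyE mu : mu DD = 1%E ->
  energy W D mu = ((Rintegral mu DD (fun p => W (toC p)))%:E + (interaction mu - c%:E))%E.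
Proof.
move=> D1; have mD := closed_disk_measurable r.
rewrite /energy; congr (_ + _)%E.
  by rewrite /Rintegral fineK//; apply: integrable_fin_num => //; exact: W_integrable.
have [tE mt] := tonelli_on mu mD measurable_pair_kernel pair_kernel_ge0.
rewrite interactionE.
have inner q : DD q -> (\int[mu]_(p in DD) log_kernel (toC p) (toC q) =
    \int[mu]_(p in DD) lkernel c (toC p) (toC q) - c%:E)%E.
  move=> Dq; apply: integral_shift => //.
    by apply: measurable_funTS; apply: measurable_log_kernel; [exact: cmeas_toC|exact: cmeas_cst].
  by move=> p Dp; exact: (lkernel_ge0 cr).
rewrite (_ : (\int[mu]_(q in DD) _)%E = (\int[mu]_(q in DD)
   (\int[mu]_(p in DD) lkernel c (toC p) (toC q) - c%:E))%E); last first.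
  by apply: eq_integral => q /[!inE] /inner.
rewrite (@integral_shift _ _ mu DD _ c)//; last 2 first.
- by apply: emeasurable_funB.
- move=> q Dq; rewrite -addeA -EFinN -EFinD addNr adde0.
  by apply: integral_ge0 => p Dp; exact: (lkernel_ge0 cr).
congr (_ - _)%E; apply: eq_integral => q _.
by rewrite -addeA -EFinN -EFinD addNr adde0.
Qed.

End Energy.

(** * Finiteness of the energy of the equilibrium measure *)
Section Competitor.
Context {R : realType}.
Notation T := (plane R).
Implicit Types (z w : R[i]).

Lemma conditional_probability (sigma : probability T R) (B : set T) : measurable B ->
  (0 < sigma B)%E -> exists nu : probability T R,
    forall A, nu A = (sigma (A `&` B) * (fine (sigma B))^-1%:E)%E.
Proof.
move=> mB B0; exists (mnormalize (mrestr sigma mB) sigma) => A.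
transitivity ((if (sigma (setT `&` B) == 0) || (sigma (setT `&` B) == +oo) then fun U => sigma U
  else fun U => sigma (U `&` B) * (fine (sigma (setT `&` B)))^-1%:E)%E A); first by [].
rewrite setTI; case: ifPn => // /orP[/eqP h|/eqP h].
  by move: B0; rewrite h ltxx.
by have := probability_le1 sigma mB; rewrite h leye_eq.
Qed.

Variables (sigma : probability T R) (r c : R) (z1 : R[i]) (C eps0 : R).
Hypothesis cr : 2 * r <= expR c.
Hypothesis bounded : locally_bounded_at sigma z1 C eps0.
Hypothesis B_gt0 : (0 < sigma (pball z1 eps0))%E.
Hypothesis B_sub : pball z1 eps0 `<=` @toC R @^-1` closed_disk r.
Hypothesis no_point_mass : forall p, sigma [set p] = 0%E.

(** The measure [sigma] conditioned on a small disk where it is dominated by area. *)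
Lemma finite_interaction_competitor :
  exists2 nu : probability T R, admissible (closed_disk r) nu & (interaction r c nu < +oo)%E.
Proof.
have [C0 e0 bb] := bounded.
pose B := pball z1 eps0; have mB : measurable B by exact: pball_measurable.
have mD := @closed_disk_measurable R r.
have [nu nuE] := conditional_probability mB B_gt0.
have sB1 := probability_le1 sigma mB.
have sBf : sigma B \is a fin_num by rewrite ge0_fin_numE//; apply: le_lt_trans sB1 _; rewrite ltry.
pose b := fine (sigma B); have b0 : 0 < b by rewrite fine_gt0// B_gt0 ltey_eq sBf.
have nu_le A : measurable A -> (nu A <= sigma A * b^-1%:E)%E.
  move=> mA; rewrite nuE lee_wpmul2r// ?lee_fin ?invr_ge0 ?(ltW b0)//.
  by apply: le_measure; rewrite ?inE//; exact: measurableI.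
exists nu.
  split => [|p]; last first.
    by rewrite nuE set1I; case: ifP => _; rewrite ?no_point_mass ?measure0 mul0e.
  rewrite nuE (setIidr B_sub) -/B -[in LHS](fineK sBf) -EFinM divff// gt_eqF//.
have nuB : nu (~` B) = 0%E by rewrite nuE setICl measure0 mul0e.
have nub p : B p -> ball_bound nu (C / b) eps0 (toC p).
  move=> Bp rho rho0 rhoe; apply: le_trans (nu_le _ (pball_measurable _ _)) _.
  have -> : (C / b * rho ^+ 2)%:E = ((C * rho ^+ 2)%:E * b^-1%:E)%E by rewrite -EFinM; congr EFin; ring.
  by rewrite lee_wpmul2r// ?lee_fin ?invr_ge0 ?(ltW b0)//; exact: bb.
have Cb0 : 0 <= C / b by rewrite divr_ge0// ltW.
pose M := ((eps0 / 2)^-1 + `|c|) + 4 * (C / b) * (eps0 / 2).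
have inner q : B q -> (\int[nu]_(p in @toC R @^-1` closed_disk r) lkernel c (toC p) (toC q) <= M%:E)%E.
  move=> Bq; have e20 : 0 < eps0 / 2 by lra.
  apply: (@le_trans _ _ (\int[nu]_(p in @toC R @^-1` closed_disk r)
    (cst ((eps0 / 2)^-1 + `|c|)%:E p + dyadic (toC q) (eps0 / 2) p))%E).
    apply: ge0_le_integral => //.
    - by move=> p Dp; apply: (lkernel_ge0 cr) => //; exact: B_sub.
    - apply: emeasurable_funD => //; apply: measurable_funTS.
      by apply: measurable_log_kernel; [exact: cmeas_toC|exact: cmeas_cst].
    - by apply: emeasurable_funD => //; exact: measurable_dyadic.
    - move=> p _; rewrite /lkernel EFinD -addeA [(_ + dyadic _ _ _)%E]addeC addeA.
      apply: leeD; last by rewrite lee_fin ler_norm.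
      exact: log_kernel_dyadic.
  rewrite ge0_integralD//; last 3 first.
  - by move=> p _; rewrite lee_fin addr_ge0// invr_ge0 ltW.
  - by move=> p _; exact: dyadic_ge0.
  - exact: measurable_dyadic.
  rewrite integral_cst// [M%:E]EFinD; apply: leeD.
    apply: (@le_trans _ _ (((eps0 / 2)^-1 + `|c|)%:E * 1)%E); last by rewrite mule1.
    by apply: lee_wpmul2l; rewrite ?lee_fin ?addr_ge0 ?invr_ge0 ?(ltW e20)//; exact: probability_le1.
  have h : 0 < eps0 / 2 < eps0 by rewrite e20 ltr_pdivrMr // ltr_pMr // ltr1n.
  exact: (dyadic_integral Cb0 h mD (nub q Bq)).
rewrite interactionE//.
have [_ mi] := tonelli_on nu mD (measurable_pair_kernel c) (pair_kernel_ge0 cr).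
rewrite (ge0_negligible_integral (N := ~` B))//; last 2 first.
- exact: measurableC.
- by move=> q Dq; apply: integral_ge0 => p Dp; exact: (lkernel_ge0 cr).
rewrite setDE setCK (setIidr B_sub) -/B.
apply: (@le_lt_trans _ _ (\int[nu]_(q in B) (cst M%:E q))%E).
  apply: ge0_le_integral => //.
  - by move=> q Bq; apply: integral_ge0 => p Dp; apply: (lkernel_ge0 cr) => //; exact: B_sub.
  - by apply: measurable_funS mi => //; exact: B_sub.
rewrite integral_cst//; apply: (@le_lt_trans _ _ (M%:E * 1)%E); last by rewrite mule1 ltry.
apply: lee_wpmul2l; last exact: probability_le1.
rewrite lee_fin /M; have e20 : 0 <= eps0 / 2 by lra.
apply: addr_ge0; first by rewrite addr_ge0 ?invr_ge0.
by apply: mulr_ge0 => //; apply: mulr_ge0.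
Qed.

End Competitor.

(** * First variation of the energy *)
Section Variation.
Context {R : realType}.
Notation T := (plane R).
Implicit Types (z w : R[i]).

Lemma pushforward_probability (sigma : probability T R) (h : T -> T) :
  measurable_fun setT h -> exists2 nu : probability T R,
    (forall A, nu A = sigma (h @^-1` A)) &
    (forall D f, measurable D -> measurable_fun D f -> (forall y, D y -> (0 <= f y)%E) ->
      (\int[nu]_(y in D) f y = \int[sigma]_(x in h @^-1` D) f (h x))%E).
Proof.
move=> mh; pose X := mfun_Sub (mem_set (mh : (fun f => measurable_fun setT f) h)).
exists (distribution sigma X) => // D f mD mf f0.
by rewrite /distribution ge0_integral_pushforward// => y /[!inE]; exact: f0.
Qed.

Variables (sigma : probability T R) (r c : R).
Hypothesis cr : 2 * r <= expR c.
Notation D := (closed_disk r).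
Notation DD := (@toC R @^-1` closed_disk r).
Hypothesis sigmaD : sigma DD = 1%E.
Hypothesis no_point_mass : forall p, sigma [set p] = 0%E.

Variable v : R[i] -> R[i].
Hypothesis v_lip : forall z w, cabs (v z - v w) <= cabs (z - w).
Hypothesis v_meas : cmeas setT (fun p : T => v (toC p)).
Hypothesis v_disk : forall t z, 0 <= t <= 6^-1 -> (cabs (z + t%:C * v z) <= r) = (cabs z <= r).

Definition displace t (p : T) : T :=
  (complex.Re (toC p + t%:C * v (toC p)), complex.Im (toC p + t%:C * v (toC p))).

Lemma toC_displace t p : toC (displace t p) = toC p + t%:C * v (toC p).
Proof. by rewrite /toC /displace /=; case: (_ + _). Qed.

Lemma measurable_displace t : measurable_fun setT (displace t).
Proof.
have [mre mim] : cmeas setT (fun p : T => toC p + t%:C * v (toC p)).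
  by apply: cmeasD; [exact: cmeas_toC|apply: cmeasM => //; exact: cmeas_cst].
exact/measurable_fun_pair.
Qed.

Definition quotient z w := (v z - v w) / (z - w).

Lemma quotient_le1 z w : cabs (quotient z w) <= 1.
Proof.
rewrite /quotient cabsM cabsV; have [->|/eqP zw] := pselect (z = w).
  by rewrite !subrr cabs0 mul0r.
by rewrite ler_pdivrMr ?mul1r// cabs_gt0 subr_eq0.
Qed.

Lemma displaced_difference t z w :
  (z + t%:C * v z) - (w + t%:C * v w) = (z - w) * (1 + t%:C * quotient z w).
Proof.
rewrite /quotient; have [->|/eqP zw] := pselect (z = w); first by rewrite !subrr mul0r.
have zw0 : z - w != 0 by rewrite subr_eq0.
by rewrite mulrDr mulr1 mulrCA [(z - w) * _]mulrC divfK//; ring.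
Qed.

Lemma displaced_small t z w : 0 <= t <= 6^-1 -> cabs (t%:C * quotient z w) <= 6^-1.
Proof.
move=> /andP[t0 t6]; rewrite cabsM cabs_real ger0_norm//.
by apply: le_trans t6; rewrite ler_piMr// quotient_le1.
Qed.

Lemma displaced_neq0 t z w : 0 <= t <= 6^-1 -> 1 + t%:C * quotient z w != 0.
Proof.
move=> /(displaced_small z w) h; rewrite -cabs_gt0.
have := cabs_sub 1 (- (t%:C * quotient z w)); rewrite opprK cabs1 cabsN.
move=> h2; apply: lt_le_trans h2; rewrite subr_gt0; apply: le_lt_trans h _.
by rewrite invf_lt1// ltr1n.
Qed.

Lemma displace_inj t : 0 <= t <= 6^-1 -> injective (displace t).
Proof.
move=> t6 p q /(congr1 (@toC R)); rewrite !toC_displace => /eqP.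
rewrite -subr_eq0 displaced_difference mulf_eq0 (negPf (displaced_neq0 _ _ t6)) orbF subr_eq0.
by case: p q => [p1 p2] [q1 q2] /eqP [-> ->].
Qed.

(** A displaced difference is [(z - w) * (1 + t * q)] with [q] the quotient of
[v z - v w] by [z - w]. The summand 1 on both sides keeps the correction
nonnegative, so that both sides can be integrated term by term. *)
Lemma displaced_lkernel t z w : 0 <= t <= 6^-1 ->
  (lkernel c (z + t%:C * v z)%R (w + t%:C * v w)%R + 1%:E <=
   lkernel c z w + (1 + 9 * t ^+ 2 - t * complex.Re (quotient z w))%:E)%E.
Proof.
move=> t6; have [->|/eqP zw] := pselect (z = w).
  by rewrite /lkernel !log_kernel_diag.
have zw0 : 0 < cabs (z - w) by rewrite cabs_gt0 subr_eq0.
have q0 : 0 < cabs (1 + t%:C * quotient z w) by rewrite cabs_gt0 displaced_neq0.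
rewrite /lkernel /log_kernel displaced_difference cabsM !lne_EFin ?mulr_gt0//.
rewrite -!EFinN -!EFinD lee_fin lnM ?posrE//.
have h := ln_cabs_1D (displaced_small z w t6).
have e : complex.Re (t%:C * quotient z w) = t * complex.Re (quotient z w).
  by rewrite ReM /= mul0r subr0.
have e2 : cabs (t%:C * quotient z w) ^+ 2 <= t ^+ 2.
  move/andP: t6 => [t0 _]; rewrite cabsM cabs_real ger0_norm// exprMn ler_piMr ?exprn_ge0//.
  by rewrite exprn_ile1 ?cabs_ge0// quotient_le1.
rewrite e in h.
have {}h : - ln (cabs (1 + t%:C * quotient z w)) <= - (t * complex.Re (quotient z w)) + 9 * t ^+ 2.
  by apply: le_trans h _; rewrite lerD2l ler_wpM2l.
move: h; set X := ln (cabs (1 + _)); set Y := ln _; set Z := t * _ => h; clear -h; lra.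
Qed.

Definition re_quotient (x : T * T) : R := complex.Re (quotient (toC x.1) (toC x.2)).

Lemma measurable_re_quotient : measurable_fun setT re_quotient.
Proof.
suff [] : cmeas setT (fun x : T * T => quotient (toC x.1) (toC x.2)) by [].
have [va vb] := v_meas.
apply: cmeasM; last by apply: cmeasV; apply: cmeasB; [exact: cmeas_toC1|exact: cmeas_toC2].
apply: cmeasB; split.
- exact: (measurableT_comp va measurable_fst).
- exact: (measurableT_comp vb measurable_fst).
- exact: (measurableT_comp va measurable_snd).
- exact: (measurableT_comp vb measurable_snd).
Qed.

Notation pair_measure := (sigma \x sigma)%E.

Lemma pair_measure1 : pair_measure (DD `*` DD) = 1%E.
Proof.
have mD := @closed_disk_measurable R r.
by rewrite product_measure1E// [X in (X * _)%E]sigmaD [X in (_ * X)%E]sigmaD mule1.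
Qed.

Lemma re_quotient_integrable : pair_measure.-integrable (DD `*` DD) (EFin \o re_quotient).
Proof.
apply: measurable_bounded_integrable.
- by apply: measurableX; exact: closed_disk_measurable.
- by rewrite [X in (X < _)%E]pair_measure1 ltry.
- by apply: measurable_funTS; exact: measurable_re_quotient.
- exists 1; split; rewrite ?num_real// => x x1 p _ /=.
  by apply: le_trans (ltW x1); apply: le_trans (Re_le_cabs _) (quotient_le1 _ _).
Qed.

Variables (W : R[i] -> R) (MW : R).
Hypothesis mW : measurable_fun DD (fun p => W (toC p)).
Hypothesis WM : forall p, DD p -> `|W (toC p)| <= MW.
Hypothesis finite_interaction : (interaction r c sigma < +oo)%E.
Hypothesis minimal : forall nu : probability T R, admissible D nu ->
  (energy W D sigma <= energy W D nu)%E.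

Lemma displaced_interaction t : 0 <= t <= 6^-1 -> (
  \int[pair_measure]_(x in DD `*` DD) pair_kernel c (displace t x.1, displace t x.2) + 1%:E <=
  interaction r c sigma + (1 + 9 * t ^+ 2 - t * Rintegral pair_measure (DD `*` DD) re_quotient)%:E)%E.
Proof.
move=> t6; have mD := @closed_disk_measurable R r.
have mDD : measurable (DD `*` DD) by exact: measurableX.
have fin : (pair_measure (DD `*` DD) < +oo)%E by rewrite [X in (X < _)%E]pair_measure1 ltry.
have DDt x : (DD `*` DD) x -> (DD `*` DD) (displace t x.1, displace t x.2).
  by move=> [h1 h2]; split; rewrite /= /closed_disk /= toC_displace v_disk.
have md : measurable_fun setT (fun x : T * T => (displace t x.1, displace t x.2)).
  apply/measurable_fun_pair => /=.
  - exact: (measurableT_comp (measurable_displace t) measurable_fst).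
  - exact: (measurableT_comp (measurable_displace t) measurable_snd).
have mk : measurable_fun (DD `*` DD) (fun x => pair_kernel c (displace t x.1, displace t x.2)).
  by apply: measurable_funTS; exact: (measurableT_comp (measurable_pair_kernel c) md).
have iq := re_quotient_integrable.
have icst (k : R) : pair_measure.-integrable (DD `*` DD) (EFin \o cst k).
  apply: measurable_bounded_integrable => //.
  by exists `|k|; split; rewrite ?num_real// => x kx y _ /=; exact: ltW.
have iqt : pair_measure.-integrable (DD `*` DD) (EFin \o (fun x => t * re_quotient x)).
  by have := integrableZl mDD t iq.
have ig : pair_measure.-integrable (DD `*` DD)
    (EFin \o (fun x => cst (1 + 9 * t ^+ 2) x - t * re_quotient x)).
  by have := integrableB mDD (icst (1 + 9 * t ^+ 2)) iqt.
have one : (\int[pair_measure]_(x in DD `*` DD) cst 1%:E x)%E = 1%E.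
  by rewrite integral_cst// [X in (_ * X)%E]pair_measure1 mule1.
rewrite -[X in (_ + X <= _)%E]one -ge0_integralD//; last by move=> x /DDt; exact: pair_kernel_ge0.
have -> : (1 + 9 * t ^+ 2 - t * Rintegral pair_measure (DD `*` DD) re_quotient)%:E =
    (\int[pair_measure]_(x in DD `*` DD) (cst (1 + 9 * t ^+ 2) x - t * re_quotient x)%:E)%E.
  rewrite -(fineK (integrable_fin_num mDD ig)); congr EFin.
  rewrite -/(Rintegral _ _ _) RintegralB// RintegralZl// Rintegral_cst//.
  by rewrite [X in fine X]pair_measure1 mulr1.
have pos x : 0 <= cst (1 + 9 * t ^+ 2) x - t * re_quotient x.
  move/andP: t6 => [t0 t6]; have := quotient_le1 (toC x.1) (toC x.2).
  move=> /(le_trans (Re_le_cabs _)); rewrite -/(re_quotient x) => h.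
  have : t * re_quotient x <= 1.
    apply: le_trans (ler_norm _) _; rewrite normrM -[leRHS]mulr1 ler_pM// ger0_norm//.
    by apply: le_trans t6 _; rewrite invf_le1// ler1n.
  by have := sqr_ge0 t; rewrite /cst => a b; lra.
rewrite -ge0_integralD//; last 4 first.
- by move=> x; exact: pair_kernel_ge0.
- by apply: measurable_funTS; exact: measurable_pair_kernel.
- by move=> x _; rewrite lee_fin.
- by move/integrableP: ig => [].
apply: ge0_le_integral => //.
- by move=> x /DDt h; rewrite adde_ge0// (pair_kernel_ge0 cr h).
- exact: emeasurable_funD.
- apply: emeasurable_funD; last by move/integrableP: ig => [].
  by apply: measurable_funTS; exact: measurable_pair_kernel.
- move=> x _; rewrite /pair_kernel /= !toC_displace.
  by apply: le_trans (displaced_lkernel _ _ t6) _; rewrite lexx.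
Qed.

(** Compare [sigma] with its image under the displacement, whose energy is an
integral over [sigma] again. *)
Lemma displaced_energy t : 0 <= t <= 6^-1 ->
  0 <= Rintegral sigma DD (fun p => W (toC p + t%:C * v (toC p))) -
       Rintegral sigma DD (fun p => W (toC p)) +
       9 * t ^+ 2 - t * Rintegral pair_measure (DD `*` DD) re_quotient.
Proof.
move=> t6; have mD := @closed_disk_measurable R r.
have md := measurable_displace t.
have DDt : displace t @^-1` DD = DD.
  by apply/seteqP; split => p /=; rewrite /closed_disk /= toC_displace v_disk.
have [nu nuE nuI] := pushforward_probability sigma md.
have nuD : nu DD = 1%E by rewrite nuE DDt.
have nu_adm : admissible D nu.
  split => // p; rewrite nuE.
  have [[q qp]|np] := pselect (exists q, displace t q = p).
    rewrite (_ : _ @^-1` _ = [set q])// -qp; apply/seteqP; split => x /=; last by move->.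
    exact: displace_inj.
  rewrite (_ : _ @^-1` _ = set0) ?measure0//; apply/seteqP; split => x //= xp.
  by apply: np; exists x.
have := minimal nu_adm; rewrite (energyE cr mW WM sigmaD) (energyE cr mW WM nuD).
have WE : Rintegral nu DD (fun p => W (toC p)) =
    Rintegral sigma DD (fun p => W (toC p + t%:C * v (toC p))).
  rewrite /Rintegral; congr fine.
  have sh (mu : probability T R) := @integral_shift _ _ _ mu DD _ MW.
  have bd p : DD p -> (0 <= (W (toC p))%:E + MW%:E)%E.
    move=> /WM; rewrite -EFinD lee_fin ler_norml => h; move: h; lra.
  have bd2 p : DD p -> (0 <= (W (toC p + t%:C * v (toC p))%R)%:E + MW%:E)%E.
    by move=> Dp; rewrite -toC_displace; apply: bd; rewrite /= /closed_disk /= toC_displace v_disk.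
  have mW2 : measurable_fun DD (fun p => W (toC p + t%:C * v (toC p))).
    rewrite (_ : (fun p => _) = (fun p => W (toC p)) \o displace t); last first.
      by apply/funext => p /=; rewrite toC_displace.
    by apply: (measurable_comp mD _ mW); [|exact: measurable_funTS];
      move=> _ [p Dp <-]; rewrite /= /closed_disk /= toC_displace v_disk.
  rewrite (sh _ _ mD nuD)//; last exact/measurable_EFinP.
  rewrite (sh _ _ mD sigmaD)//; last exact/measurable_EFinP.
  congr (_ - _)%E; rewrite nuI ?DDt//; last first.
    by apply: emeasurable_funD => //; exact/measurable_EFinP.
  by apply: eq_integral => p _; rewrite toC_displace.
rewrite WE.
have IE : interaction r c nu = (\int[pair_measure]_(x in DD `*` DD) pair_kernel c (displace t x.1, displace t x.2))%E.
  rewrite interactionE//.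
  have mk2 : measurable_fun setT (fun x : T * T => pair_kernel c (displace t x.1, displace t x.2)).
    apply: (measurableT_comp (measurable_pair_kernel c)).
    apply/measurable_fun_pair => /=.
    - exact: (measurableT_comp md measurable_fst).
    - exact: (measurableT_comp md measurable_snd).
  have k0 x : (DD `*` DD) x -> (0 <= pair_kernel c (displace t x.1, displace t x.2))%E.
    by move=> [h1 h2]; apply: (pair_kernel_ge0 cr); split; rewrite /= /closed_disk /= toC_displace v_disk.
  rewrite -(tonelli_on sigma mD mk2 k0).1.
  have [_ mG] := tonelli_on nu mD (measurable_pair_kernel c) (pair_kernel_ge0 cr).
  have G0 q : DD q -> (0 <= \int[nu]_(p in DD) pair_kernel c (p, q))%E.
    by move=> Dq; apply: integral_ge0 => p Dp; exact: (lkernel_ge0 cr).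
  transitivity (\int[sigma]_(q in displace t @^-1` DD)
    \int[nu]_(p in DD) pair_kernel c (p, displace t q))%E; first exact: (nuI _ _ mD mG G0).
  rewrite DDt; apply: eq_integral => q /[!inE] Dq.
  have Dq' : DD (displace t q) by rewrite /= /closed_disk /= toC_displace v_disk.
  rewrite nuI//; first by rewrite DDt.
    by apply: measurable_funTS; apply: emeasurable_funD => //; apply: measurable_log_kernel; [exact: cmeas_toC|exact: cmeas_cst].
  by move=> p Dp; exact: (lkernel_ge0 cr).
have := displaced_interaction t6; rewrite -IE.
have : interaction r c sigma \is a fin_num by rewrite ge0_fin_numE// interaction_ge0.
case: (interaction r c sigma) => // i _.
have := interaction_ge0 cr nu.
case: (interaction r c nu) => //= j _; rewrite -?EFinN -!EFinD !lee_fin.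
set A := Rintegral _ _ _; set B := Rintegral _ _ _; set C := Rintegral _ _ _; set K := t ^+ 2.
clearbody A B C K; move: (t) => s; lra.
Qed.

(** The displacement is a competitor at every small time, so the coefficient of
the first order in time cannot be negative. *)
Lemma first_variation_ge0 (omega : T -> R) (A M : R) :
  measurable_fun DD omega -> (forall p, DD p -> `|omega p| <= M) ->
  (forall t p, 0 <= t <= 6^-1 -> DD p ->
     W (toC p + t%:C * v (toC p)) <= W (toC p) + t * omega p + A * t ^+ 2) ->
  Rintegral pair_measure (DD `*` DD) re_quotient <= Rintegral sigma DD omega.
Proof.
move=> mo oM Wt; have mD := @closed_disk_measurable R r.
set B := Rintegral pair_measure _ _; set O := Rintegral sigma _ omega.
have sfin : (sigma DD < +oo)%E by rewrite sigmaD ltry.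
have key t : 0 < t <= 6^-1 -> B - O <= (9 + A) * t.
  move=> /andP[t0 t6]; have t06 : 0 <= t <= 6^-1 by rewrite (ltW t0).
  have := displaced_energy t06; rewrite -/B.
  have iW := W_integrable mW WM sigma.
  have io : sigma.-integrable DD (EFin \o omega).
    apply: measurable_bounded_integrable => //.
    by exists M; split; rewrite ?num_real// => x Mx p Dp /=; apply: le_trans (ltW Mx); exact: oM.
  have ic : sigma.-integrable DD (EFin \o cst (A * t ^+ 2)).
    apply: measurable_bounded_integrable => //.
    by exists `|A * t ^+ 2|; split; rewrite ?num_real// => x Mx p _ /=; exact: ltW.
  have ito : sigma.-integrable DD (EFin \o (fun p => t * omega p)) by have := integrableZl mD t io.
  have i2 : sigma.-integrable DD (EFin \o (fun p => W (toC p) + t * omega p)).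
    by have := integrableD mD iW ito.
  have i3 : sigma.-integrable DD (EFin \o (fun p => W (toC p) + t * omega p + cst (A * t ^+ 2) p)).
    by have := integrableD mD i2 ic.
  have i4 : sigma.-integrable DD (EFin \o (fun p => W (toC p + t%:C * v (toC p)))).
    apply: measurable_bounded_integrable => //.
      rewrite (_ : (fun p => _) = (fun p => W (toC p)) \o displace t); last first.
        by apply/funext => p /=; rewrite toC_displace.
      apply: (measurable_comp mD _ mW); last by apply: measurable_funTS; exact: measurable_displace.
      by move=> _ [p Dp <-]; rewrite /= /closed_disk /= toC_displace v_disk.
    exists MW; split; rewrite ?num_real// => x Mx p Dp /=; apply: le_trans (ltW Mx).
    by rewrite -toC_displace; apply: WM; rewrite /= /closed_disk /= toC_displace v_disk.
  have : Rintegral sigma DD (fun p => W (toC p + t%:C * v (toC p))) <=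
      Rintegral sigma DD (fun p => W (toC p) + t * omega p + cst (A * t ^+ 2) p).
    by apply: le_Rintegral => // p Dp; exact: Wt.
  rewrite !RintegralD// RintegralZl// Rintegral_cst// -/O.
  rewrite [X in fine X]sigmaD /= mulr1.
  set X1 := Rintegral _ _ _; set X2 := Rintegral _ _ _ => h1 h2.
  rewrite -(ler_pM2r t0) -mulrA -expr2.
  move: h1 h2; rewrite mulrDl mulrBl; set K := t ^+ 2.
  clearbody X1 X2 O B K; lra.
rewrite -subr_le0 leNgt; apply/negP => BO.
(* A time small enough for the first order to win over the second. *)
pose t := Num.min 6^-1 ((B - O) / (2 * (`|9 + A| + 1))).
have d0 : 0 < 2 * (`|9 + A| + 1) by rewrite mulr_gt0// ltr_wpDl.
have t0 : 0 < t by rewrite lt_min invr_gt0 ltr0n/= divr_gt0.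
have := key t; rewrite t0 ge_min lexx /= => /(_ isT).
rewrite leNgt => /negP; apply.
apply: (@le_lt_trans _ _ ((`|9 + A| + 1) * t)).
  by rewrite ler_wpM2r ?(ltW t0)//; apply: le_trans (ler_norm _) _; rewrite lerDl.
apply: (@le_lt_trans _ _ ((`|9 + A| + 1) * ((B - O) / (2 * (`|9 + A| + 1))))).
  by rewrite ler_wpM2l ?addr_ge0// ge_min lexx orbT.
have n0 : 0 < `|9 + A| + 1 by rewrite ltr_wpDl.
rewrite (_ : _ * (_ / _) = (B - O) / 2); last first.
  by rewrite invfM mulrCA; congr (_ * _); rewrite mulrCA mulfV ?gt_eqF// mulr1.
by rewrite ltr_pdivrMr// ltr_pMr// ltr1n.
Qed.

End Variation.

(** * The interaction term of the first variation *)
Section QuotientIntegral.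
Context {R : realType}.
Notation T := (plane R).
Implicit Types (z w : R[i]).
Variables (sigma : probability T R) (r : R).
Notation DD := (@toC R @^-1` closed_disk r).
Hypothesis sigmaD : sigma DD = 1%E.
Variables (v : R[i] -> R[i]) (C eps0 : R).
Hypothesis v_le1 : forall z, cabs (v z) <= 1.
Hypothesis v_meas : cmeas setT (fun p : T => v (toC p)).
Hypothesis C0 : 0 <= C.
Hypothesis eps0_gt0 : 0 < eps0.
Hypothesis bounded : forall z, v z != 0 -> ball_bound sigma C eps0 z.
Notation pair_measure := (sigma \x sigma)%E.

(** The quotient [(v z - v w) / (z - w)] is the sum of [v z / (z - w)] and of the
same expression with [z] and [w] exchanged. Each of the two is integrable
because [v] is supported where [sigma] is dominated by area. *)
Definition half_quotient (x : T * T) : R :=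
  complex.Re (v (toC x.1) * (toC x.1 - toC x.2)^-1).

Definition field_work (p : T) : R :=
  complex.Re (v (toC p) * cauchy_transform sigma (toC p)).

Lemma half_quotient_inner p :
  (\int[sigma]_q `|(half_quotient (p, q))%:E| <= ((eps0 / 2)^-1 + 4 * C * (eps0 / 2))%:E)%E.
Proof.
have e20 : 0 < eps0 / 2 by rewrite divr_gt0.
have e2 : 0 < eps0 / 2 < eps0 by rewrite e20 ltr_pdivrMr // ltr_pMr // ltr1n.
have K0 : 0 <= (eps0 / 2)^-1 + 4 * C * (eps0 / 2).
  by rewrite addr_ge0 ?invr_ge0 ?(ltW e20)// !mulr_ge0// ltW.
have [v0|/eqP v0] := pselect (v (toC p) = 0).
  rewrite (eq_integral (fun=> 0)%E) ?integral0 ?lee_fin// => q _.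
  by rewrite /half_quotient /= v0 mul0r normr0.
apply: (@le_trans _ _ (\int[sigma]_q (cst ((eps0 / 2)^-1)%:E q + (near_part (toC p) (eps0 / 2) q)%:E))%E).
  apply: ge0_le_integral => //.
  - apply/measurable_EFinP/measurableT_comp => //.
    have [] : cmeas setT (fun q : T => v (toC p) * (toC p - toC q)^-1) => //.
    by apply: cmeasM; [exact: cmeas_cst|exact: cmeas_cauchy_kernel].
  - by apply: emeasurable_funD => //; apply/measurable_EFinP; exact: measurable_near_part.
  - move=> q _; rewrite -EFinD lee_fin /=.
    apply: le_trans (inv_dist_near (toC p) q e20).
    apply: le_trans (Re_le_cabs _) _; rewrite cabsM cabsV cabsC.
    by rewrite ler_piMl// invr_ge0 cabs_ge0.
rewrite ge0_integralD//; last 3 first.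
- by move=> q _; rewrite lee_fin invr_ge0 ltW.
- by move=> q _; rewrite lee_fin near_part_ge0.
- by apply/measurable_EFinP; exact: measurable_near_part.
rewrite EFinD; apply: leeD.
  by rewrite integral_cst// [X in (_ * X)%E]probability_setT mule1.
exact: (near_part_integral C0 (bounded v0) e2).
Qed.

Lemma cmeas_half : cmeas setT (fun x : T * T => v (toC x.1) * (toC x.1 - toC x.2)^-1).
Proof.
have [va vb] := v_meas; apply: cmeasM; last first.
  by apply: cmeasV; apply: cmeasB; [exact: cmeas_toC1|exact: cmeas_toC2].
by split; [exact: (measurableT_comp va measurable_fst)|exact: (measurableT_comp vb measurable_fst)].
Qed.

Lemma measurable_half_quotient : measurable_fun setT half_quotient.
Proof. by have [] := cmeas_half. Qed.

Lemma half_quotient_sum :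
  (\int[sigma]_p \int[sigma]_q `|(half_quotient (p, q))%:E| < +oo)%E.
Proof.
set K := (eps0 / 2)^-1 + 4 * C * (eps0 / 2).
have ma : measurable_fun setT (fun x => `|(half_quotient x)%:E|%E).
  by apply/measurable_EFinP/measurableT_comp => //; exact: measurable_half_quotient.
apply: (@le_lt_trans _ _ (\int[sigma]_p cst K%:E p)%E); last first.
  by rewrite integral_cst// [X in (_ * X)%E]probability_setT mule1 ltry.
apply: ge0_le_integral => //.
- by move=> p _; exact: integral_ge0.
- by apply: (measurable_fun_fubini_tonelli_F _ ma).
- by move=> p _; exact: half_quotient_inner.
Qed.

Lemma half_quotient_integrable : pair_measure.-integrable setT (EFin \o half_quotient).
Proof.
apply/integrable12ltyP; first by apply/measurable_EFinP; exact: measurable_half_quotient.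
exact: half_quotient_sum.
Qed.

Lemma half_quotient_swap_integrable :
  pair_measure.-integrable setT (EFin \o (fun x => half_quotient (x.2, x.1))).
Proof.
apply/integrable21ltyP; last exact: half_quotient_sum.
apply/measurable_EFinP; apply: (measurableT_comp measurable_half_quotient).
by apply/measurable_fun_pair => /=; [exact: measurable_snd|exact: measurable_fst].
Qed.

Lemma half_quotient_section p :
  (\int[sigma]_q (half_quotient (p, q))%:E = (field_work p)%:E)%E.
Proof.
rewrite /field_work /cauchy_transform /half_quotient /=; have [v0|/eqP v0] := pselect (v (toC p) = 0).
  by rewrite (eq_integral (fun=> 0)%E) ?integral0 => [|q _]; rewrite v0 mul0r.
have ci := cauchy_kernel_integrable C0 (bounded v0) eps0_gt0.
rewrite -CintZ// /Cint /Rintegral /= fineK//.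
apply: integrable_fin_num => //.
by have [] := cintegrableZ measurableT (v (toC p)) ci.
Qed.

Lemma field_work_integrable : sigma.-integrable setT (EFin \o field_work).
Proof.
have := integrable_fubini_F half_quotient_integrable.
by apply: eq_integrable => // p _; rewrite /fubini_F /= half_quotient_section.
Qed.

(** By Fubini each half contributes the integral of [v] against the Cauchy
transform. *)
Lemma re_quotient_integral :
  Rintegral pair_measure (DD `*` DD) (re_quotient v) = 2 * Rintegral sigma DD field_work.
Proof.
have mD := @closed_disk_measurable R r.
have mDD : measurable (DD `*` DD) by exact: measurableX.
have nD : sigma (~` DD) = 0%E by rewrite probability_setC// [X in (1 - X)%E]sigmaD subee.
have nDD : pair_measure (~` (DD `*` DD)) = 0%E.
  have h : pair_measure setT = 1%E by rewrite -setXTT product_measure1E// [X in (X * _)%E]probability_setT [X in (_ * X)%E]probability_setT mule1.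
  rewrite -setTD measureD//; last by rewrite [X in (X < _)%E]h ltry.
  by rewrite setTI [X in (X - _)%E]h [X in (_ - X)%E]pair_measure1// subee.
have ia := half_quotient_integrable; have ib := half_quotient_swap_integrable.
have E x : re_quotient v x = half_quotient x + half_quotient (x.2, x.1).
  rewrite /re_quotient /quotient /half_quotient /= -ReD; congr complex.Re.
  by rewrite -[toC x.2 - _]opprB invrN mulrN mulrBl.
have iq : pair_measure.-integrable setT (EFin \o re_quotient v).
  have := integrableD measurableT ia ib; apply: eq_integrable => // x _.
  by rewrite /= E.
have -> : Rintegral pair_measure (DD `*` DD) (re_quotient v) = Rintegral pair_measure setT (re_quotient v).
  rewrite /Rintegral (negligible_integral (measurableC mDD) measurableT iq nDD).
  by rewrite setTD setCK.
have -> : Rintegral sigma DD field_work = Rintegral sigma setT field_work.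
  by rewrite /Rintegral (negligible_integral (measurableC mD) measurableT field_work_integrable nD) setTD setCK.
have Ea : Rintegral pair_measure setT half_quotient = Rintegral sigma setT field_work.
  rewrite /Rintegral -(integral12_prod_meas1 ia); congr fine.
  by apply: eq_integral => p _; rewrite /fubini_F /= half_quotient_section.
have Eb : Rintegral pair_measure setT (fun x => half_quotient (x.2, x.1)) = Rintegral sigma setT field_work.
  rewrite /Rintegral -(integral21_prod_meas1 ib); congr fine.
  by apply: eq_integral => p _; rewrite /fubini_G /= half_quotient_section.
have -> : re_quotient v = (fun x => half_quotient x + half_quotient (x.2, x.1)) by apply/funext.
by rewrite RintegralD// Ea Eb; ring.
Qed.

End QuotientIntegral.

(** * The external potential *)
Section Potential.
Context {R : realType}.
Notation T := (plane R).
Implicit Types (z w : R[i]) (r s : R).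

Lemma mean_value_bound (f : R -> R) (a b K : R) :
  (forall x, a <= x <= b -> derivable f x 1) -> (forall x, a <= x <= b -> `|derive1 f x| <= K) ->
  forall x y, a <= x <= b -> a <= y <= b -> `|f y - f x| <= K * `|y - x|.
Proof.
move=> df fK.
have main x y : a <= x <= b -> a <= y <= b -> x < y -> `|f y - f x| <= K * `|y - x|.
  move=> /andP[ax xb] /andP[ay yb] xy.
  have ab t : t \in `[x, y] -> a <= t <= b.
    by rewrite in_itv /= => /andP[xt ty]; rewrite (le_trans ax xt) (le_trans ty yb).
  have [|| t txy ->] := @MVT R f (derive1 f) x y xy.
  - move=> t txy; have := df t (ab t (subset_itv_oo_cc txy)).
    by move=> dt; split; [exact: dt|rewrite derive1E].
  - by apply: derivable_within_continuous => t /ab; exact: df.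
  by rewrite normrM ler_wpM2r//; apply/fK/ab; exact: subset_itv_oo_cc.
move=> x y xab yab; have [xy|yx|->] := ltgtP x y; first exact: main.
- by rewrite distrC [X in _ <= _ * X]distrC; exact: main.
- by rewrite !subrr normr0 mulr0.
Qed.

Lemma bounded_on_segment (f : R -> R) (a b : R) : {within `[a, b], continuous f} ->
  exists2 K, 0 <= K & forall x, a <= x <= b -> `|f x| <= K.
Proof.
move=> cf; have [ab|ba] := leP a b; last first.
  by exists 0 => // x /andP[ax xb]; have := le_lt_trans (le_trans ax xb) ba; rewrite ltxx.
have cn : {within `[a, b], continuous (fun x => `|f x|)}.
  by move=> x; apply: continuous_comp (cf x) _; exact: norm_continuous.
by have [c _ cM] := EVT_max ab cn; exists `|f c| => // x xab; apply: cM; rewrite in_itv.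
Qed.

Lemma horner_bounded (p : {poly R[i]}) r : exists2 M, 0 <= M & forall z, cabs z <= r -> cabs p.[z] <= M.
Proof.
elim/poly_ind: p => [|p b [M M0 pM]]; first by exists 0 => // z _; rewrite horner0 cabs0.
exists (M * `|r| + cabs b) => [|z zr]; first by rewrite addr_ge0 ?mulr_ge0 ?cabs_ge0.
rewrite !hornerE; apply: le_trans (cabsD _ _) _; rewrite lerD2r cabsM ler_pM ?cabs_ge0 ?pM//.
exact: le_trans (ler_norm _).
Qed.

Lemma horner_taylor (p : {poly R[i]}) r : exists2 C, 0 <= C & forall z h,
  cabs z <= r -> cabs h <= 1 -> cabs (p.[z + h] - p.[z] - (deriv p).[z] * h) <= C * cabs h ^+ 2.
Proof.
elim/poly_ind: p => [|p b [C C0 pC]].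
  by exists 0 => // z h _ _; rewrite deriv0 !horner0 mul0r !subr0 cabs0 mul0r.
have [M M0 pM] := horner_bounded (deriv p) r.
exists (C * (`|r| + 1) + M) => [|z h zr h1]; first by rewrite addr_ge0 ?mulr_ge0 ?addr_ge0.
rewrite derivD derivM derivX derivC addr0 mulr1 !hornerMXaddC hornerD hornerMX.
rewrite (_ : _ - _ = (p.[z + h] - p.[z] - (deriv p).[z] * h) * (z + h) + (deriv p).[z] * h ^+ 2); last by ring.
apply: le_trans (cabsD _ _) _; rewrite [leRHS]mulrDl lerD//; last first.
  by rewrite cabsM cabsX ler_wpM2r ?exprn_ge0 ?cabs_ge0 ?pM.
rewrite cabsM mulrAC; apply: ler_pM; rewrite ?cabs_ge0 ?pC//.
by apply: le_trans (cabsD _ _) _; rewrite lerD//; apply: le_trans zr (ler_norm _).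
Qed.

Variables (Phi : R -> R) (P : {poly R[i]}).
Hypothesis Phi_cont : {within `[0, +oo[, continuous Phi}.
Hypothesis Phi_C2 : forall s, 0 < s -> [/\ derivable Phi s 1, derivable (derive1 Phi) s 1
         & {for s, continuous (derive1 (derive1 Phi))}].

Lemma potentialE z : potential Phi P z = Phi (cabs z ^+ 2) - 2 * complex.Re P.[z].
Proof. by rewrite /potential mul_conj !ReD !ReN Re_conj /=; ring. Qed.

Lemma measurable_sqr_abs (D : set T) : measurable_fun D (fun p => cabs (toC p) ^+ 2).
Proof. by apply: measurable_funX; apply: cmeas_abs; exact: cmeas_toC. Qed.

Lemma cmeas_horner (p : {poly R[i]}) (D : set T) : cmeas D (fun q => p.[toC q]).
Proof.
elim/poly_ind: p => [|p b h].
  by under [X in cmeas _ X]eq_fun => q do rewrite horner0; exact: cmeas_cst.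
under [X in cmeas _ X]eq_fun => q do rewrite !hornerE.
by apply: cmeasD (cmeas_cst _ _); apply: cmeasM => //; exact: cmeas_toC.
Qed.

Lemma potential_measurable (D : set T) : measurable D ->
  measurable_fun D (fun p => potential Phi P (toC p)).
Proof.
move=> mD; rewrite (_ : (fun p => _) = (fun p => Phi (cabs (toC p) ^+ 2) - 2 * complex.Re P.[toC p])).
  apply: measurable_funB; last by apply: measurable_funM => //; case: (cmeas_horner P D).
  have mPhi : measurable_fun (`[0, +oo[%classic : set R) Phi.
    exact: subspace_continuous_measurable_fun.
  apply: (measurable_comp _ _ mPhi) => //; last exact: measurable_sqr_abs.
  by move=> _ [p _ <-]; rewrite /= in_itv /= andbT exprn_ge0// cabs_ge0.
by apply/funext => p; rewrite potentialE.
Qed.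

Lemma potential_bounded r : exists M, forall z, cabs z <= r -> `|potential Phi P z| <= M.
Proof.
have [M M0 PM] := horner_bounded P r.
have [K K0 PK] : exists2 K, 0 <= K & forall x, 0 <= x <= r ^+ 2 -> `|Phi x| <= K.
  apply: bounded_on_segment; apply: continuous_subspaceW Phi_cont => x /=.
  by rewrite !in_itv /= andbT => /andP[].
exists (K + 2 * M) => z zr; rewrite potentialE.
apply: le_trans (ler_normB _ _) _; rewrite lerD//.
  by apply: PK; rewrite exprn_ge0 ?cabs_ge0//= lerXn2r ?nnegrE ?cabs_ge0//; exact: le_trans (cabs_ge0 _) zr.
by rewrite normrM ger0_norm// ler_wpM2l//; apply: le_trans (Re_le_cabs _) (PM _ zr).
Qed.

Lemma Phi1_cont s : 0 < s -> {for s, continuous (derive1 Phi)}.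
Proof. by move=> /Phi_C2 [_ h _]; apply/differentiable_continuous/derivable1_diffP. Qed.

(** Mean value bound for [Phi t - Phi' x * t], whose derivative is of order
[|t - x|]. *)
Lemma Phi_taylor (a b : R) : 0 < a -> exists2 K, 0 <= K & forall x y, a <= x <= b -> a <= y <= b ->
  `|Phi y - Phi x - derive1 Phi x * (y - x)| <= K * `|y - x| ^+ 2.
Proof.
move=> a0; have pos x : a <= x <= b -> 0 < x by move=> /andP[ax _]; exact: lt_le_trans ax.
have [K K0 hK] : exists2 K, 0 <= K & forall x, a <= x <= b -> `|derive1 (derive1 Phi) x| <= K.
  apply: bounded_on_segment; apply: continuous_in_subspaceT => x; rewrite inE /= in_itv /= => /pos.
  by move=> /Phi_C2 [].
exists K => // x y xab yab.
have dd u : a <= u <= b -> derivable (derive1 Phi) u 1.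
  by move=> /pos u0; case: (Phi_C2 u0) => _ h _; exact: h.
have lip := @mean_value_bound (derive1 Phi) a b K dd hK.
pose f t := Phi t - derive1 Phi x * t.
have df t : a <= t <= b -> is_derive t 1 f (derive1 Phi t - derive1 Phi x).
  move=> /pos /Phi_C2 [dt _ _].
  have h1 : is_derive t 1 Phi (derive1 Phi t) by split; [exact: dt|rewrite derive1E].
  have h2 : is_derive t 1 (fun t => derive1 Phi x * t) (derive1 Phi x).
    by apply: (is_derive_eq (is_deriveZ _ (is_derive_id _ _))); rewrite /GRing.scale /= mulr1.
  exact: is_deriveB.
have sub t : Num.min x y <= t <= Num.max x y -> a <= t <= b.
  move/andP: xab => [ax xb]; move/andP: yab => [ay yb] /andP[t1 t2].
  by rewrite (le_trans _ t1) ?(le_trans t2) ?le_min ?ge_max ?ax ?xb.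
have near_x t : Num.min x y <= t <= Num.max x y -> `|t - x| <= `|y - x|.
  move=> /andP[]; rewrite ge_min le_max; case: (lerP x y) => xy.
    by rewrite ler_norml; move=> /orP[] ? /orP[] ?; apply/andP; split; lra.
  by rewrite ler_norml; move=> /orP[] ? /orP[] ?; apply/andP; split; lra.
have := @mean_value_bound f (Num.min x y) (Num.max x y) (K * `|y - x|) _ _ x y.
rewrite /f (_ : Phi y - _ - _ = Phi y - Phi x - derive1 Phi x * (y - x)); last by ring.
rewrite -mulrA -expr2; apply.
- by move=> t /sub /df [].
- move=> t tm; have [dt dE] := df _ (sub _ tm); rewrite derive1E dE.
  by apply: le_trans (lip x t xab (sub _ tm)) _; rewrite ler_wpM2l// near_x.
- by rewrite ge_min lexx le_max lexx.
- by rewrite ge_min lexx le_max lexx !orbT.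
Qed.

(** The gradient of the potential: its variation in the direction [h] is
[2 * Re (field z * h)]. *)
Definition field z : R[i] := z^* * (derive1 Phi (cabs z ^+ 2))%:C - (deriv P).[z].

Lemma potential_taylor (rho r : R) : 0 < rho -> exists2 A, 0 <= A & forall z h,
  rho <= cabs z <= r -> rho <= cabs (z + h) <= r -> cabs h <= 1 ->
  potential Phi P (z + h) <= potential Phi P z + 2 * complex.Re (field z * h) + A * cabs h ^+ 2.
Proof.
move=> rho0; have [K K0 hK] := @Phi_taylor (rho ^+ 2) (r ^+ 2) (exprn_gt0 2 rho0).
have [C C0 hC] := horner_taylor P r.
have [K1 K10 hK1] : exists2 K, 0 <= K & forall x, rho ^+ 2 <= x <= r ^+ 2 -> `|derive1 Phi x| <= K.
  apply: bounded_on_segment; apply: continuous_in_subspaceT => x; rewrite inE /= in_itv /= => /andP[h _].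
  by apply: Phi1_cont; apply: lt_le_trans h; exact: exprn_gt0.
exists (K * (2 * `|r| + 1) ^+ 2 + K1 + 2 * C).
  by rewrite !addr_ge0 ?mulr_ge0 ?exprn_ge0 ?addr_ge0 ?mulr_ge0.
move=> z h zr zhr h1.
have sq w : rho <= cabs w <= r -> rho ^+ 2 <= cabs w ^+ 2 <= r ^+ 2.
  move=> /andP[a b]; have w0 := cabs_ge0 w.
  by rewrite !lerXn2r ?nnegrE ?(ltW rho0)//; exact: le_trans w0 b.
have e1 : cabs (z + h) ^+ 2 - cabs z ^+ 2 = 2 * complex.Re (z^* * h) + cabs h ^+ 2.
  by rewrite !cabs_sqr ReM ReD ImD Re_conj Im_conj; ring.
have := hK _ _ (sq _ zr) (sq _ zhr); rewrite e1.
have Rzh : `|complex.Re (z^* * h)| <= `|r| * cabs h.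
  apply: le_trans (Re_le_cabs _) _; rewrite cabsM cabs_conj ler_wpM2r ?cabs_ge0//.
  by case/andP: zr => _ zr; exact: le_trans zr (ler_norm _).
have dsq : `|2 * complex.Re (z^* * h) + cabs h ^+ 2| ^+ 2 <= (2 * `|r| + 1) ^+ 2 * cabs h ^+ 2.
  rewrite -exprMn lerXn2r ?nnegrE// ?mulr_ge0 ?addr_ge0 ?mulr_ge0 ?cabs_ge0//.
  apply: le_trans (ler_normD _ _) _; rewrite [leRHS]mulrDl lerD//.
    by rewrite normrM ger0_norm// -mulrA ler_wpM2l.
  by rewrite ger0_norm ?exprn_ge0 ?cabs_ge0// mul1r expr2 ler_piMr ?cabs_ge0.
have p1 := hK1 _ (sq _ zr).
have hp := le_trans (Re_le_cabs _) (hC z h (proj2 (andP zr)) h1).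
move=> /(le_trans (ler_norm _)) ht.
have {dsq} := ler_wpM2l K0 dsq => dsq.
rewrite !potentialE /field mulrBl ReD ReN.
have -> : complex.Re (z^* * (derive1 Phi (cabs z ^+ 2))%:C * h) =
    derive1 Phi (cabs z ^+ 2) * complex.Re (z^* * h).
  by rewrite mulrAC mulrC ReM /= mul0r subr0.
move: hp; rewrite !ReD !ReN ler_norml => /andP[hp _].
have p2 : derive1 Phi (cabs z ^+ 2) * cabs h ^+ 2 <= K1 * cabs h ^+ 2.
  by rewrite ler_wpM2r ?exprn_ge0 ?cabs_ge0//; exact: le_trans (ler_norm _) p1.
move: ht dsq hp p2; set h2 := cabs h ^+ 2; set F := derive1 Phi _.
set X := complex.Re (z^* * h); set Y := complex.Re (_ * h).
set B := K * _; set L := (_ ^+ 2).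
clear -F; lra.
Qed.

End Potential.

(** * The field of the equilibrium measure vanishes inside its support *)
Section EquilibriumField.
Context {R : realType}.
Notation T := (plane R).
Implicit Types (z w : R[i]).

Lemma max0_lip (a b : R) : `|Num.max 0 a - Num.max 0 b| <= `|a - b|.
Proof.
have := ler_norm (a - b); have := ler_norm (- (a - b)); rewrite normrN.
move: `|a - b| => n h1 h2; rewrite ler_norml.
by case: (lerP 0 a); case: (lerP 0 b) => ? ?; apply/andP; split; lra.
Qed.

Lemma locally_bounded_shrink (sigma : probability T R) z C e e' : 0 < e' -> e' <= e ->
  locally_bounded_at sigma z C e -> locally_bounded_at sigma z C e'.
Proof.
move=> e'0 ee [C0 _ b]; split => // w wz rho rho0 rhoe.
by apply: b => //; [exact: lt_le_trans wz ee|exact: lt_le_trans rhoe ee].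
Qed.

Section Bump.
Variables (k z1 : R[i]) (eps : R).
Hypothesis k1 : cabs k = 1.
Hypothesis eps_gt0 : 0 < eps.

(** The Lipschitz constant is 1, as the variation requires. *)
Definition bump z : R := Num.max 0 (eps - cabs (z - z1)).
Definition push z : R[i] := k * (bump z)%:C.

Lemma bump_ge0 z : 0 <= bump z. Proof. by rewrite le_max lexx. Qed.

Lemma cabs_push z : cabs (push z) = bump z.
Proof. by rewrite cabsM k1 mul1r cabs_real ger0_norm ?bump_ge0. Qed.

Lemma bump_le z : bump z <= eps.
Proof. by rewrite ge_max (ltW eps_gt0) gerBl cabs_ge0. Qed.

Lemma push_lip z w : cabs (push z - push w) <= cabs (z - w).
Proof.
rewrite /push -mulrBr cabsM k1 mul1r cabs_realB; apply: le_trans (max0_lip _ _) _.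
rewrite (_ : _ - _ = cabs (w - z1) - cabs (z - z1)); last by ring.
apply: le_trans (cabs_sub_norm _ _) _.
by rewrite (_ : w - z1 - (z - z1) = w - z) ?(cabsC w)//; ring.
Qed.

Lemma bump_support z : bump z != 0 -> cabs (z - z1) < eps.
Proof. by apply: contraNT; rewrite -leNgt /bump -subr_le0 => h; apply/eqP/max_l. Qed.

Lemma measurable_bump : measurable_fun setT (fun p : T => bump (toC p)).
Proof.
apply: measurable_maxr => //; apply: measurable_funB => //; apply: cmeas_abs.
by apply: cmeasB; [exact: cmeas_toC|exact: cmeas_cst].
Qed.

Lemma cmeas_push : cmeas setT (fun p : T => push (toC p)).
Proof. by apply: cmeasM; [exact: cmeas_cst|apply: cmeas_real; exact: measurable_bump]. Qed.

Lemma pushed_near t z : 0 <= t <= 6^-1 -> cabs (z - z1) < eps -> cabs (z + t%:C * push z - z1) < 2 * eps.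
Proof.
move=> /andP[t0 t6] ze; rewrite addrAC; apply: le_lt_trans (cabsD _ _) _.
rewrite mulr_natl mulr2n ltr_leD// cabsM cabs_push cabs_real ger0_norm//.
apply: le_trans (_ : 1 * eps <= _); last by rewrite mul1r.
rewrite ler_pM ?bump_ge0 ?bump_le//; apply: le_trans t6 _.
by rewrite invf_le1// ler1n.
Qed.

End Bump.

Variables (Phi : R -> R) (P : {poly R[i]}).
Hypothesis Phi_cont : {within `[0, +oo[, continuous Phi}.
Hypothesis Phi_C2 : forall s, 0 < s -> [/\ derivable Phi s 1, derivable (derive1 Phi) s 1
         & {for s, continuous (derive1 (derive1 Phi))}].
Hypothesis dI_gt0 : forall s, 0 < s -> 0 < derive1 (Ifun Phi) s.

Lemma derive1_Ifun s : 0 < s -> derivable (Ifun Phi) s 1 /\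
  derive1 (Ifun Phi) s = derive1 Phi s + s * derive1 (derive1 Phi) s.
Proof.
move=> s0; have [_ h _] := Phi_C2 s0.
have h2 : is_derive s 1 (derive1 Phi) (derive1 (derive1 Phi) s) by split; [exact: h|rewrite [RHS]derive1E].
have [d1 d2] : is_derive s 1 (Ifun Phi) (derive1 Phi s + s * derive1 (derive1 Phi) s).
  apply: (is_derive_eq (is_deriveM (is_derive_id s 1) h2)).
  by rewrite /GRing.scale /= mulr1 addrC.
by split; [exact: d1|rewrite derive1E d2].
Qed.

Lemma gdens_gt0 s : 0 < s -> 0 < gdens Phi s.
Proof. by move=> s0; rewrite /gdens mulr_gt0 ?invr_gt0 ?pi_gt0// -(derive1_Ifun s0).2 dI_gt0. Qed.

Lemma gdens_cont s : 0 < s -> {for s, continuous (gdens Phi)}.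
Proof.
move=> s0; have [_ _ h] := Phi_C2 s0.
apply: cvgM; first exact: cvg_cst.
by apply: cvgD; [exact: (Phi1_cont Phi_C2)|apply: cvgM; [exact: cvg_id|exact: h]].
Qed.

Lemma derive1_Ifun_cont s : 0 < s -> {for s, continuous (derive1 (Ifun Phi))}.
Proof.
move=> s0; have [_ _ h] := Phi_C2 s0.
apply/rcontP; apply: (@econt_near _ _ _ (fun t => (derive1 Phi t + t * derive1 (derive1 Phi) t)%:C)).
- by rewrite /rdist subrr normr0.
- exists s => // t; rewrite /rdist ltr_norml => /andP[h1 _].
  by rewrite (derive1_Ifun _).2//; lra.
- apply/rcontP; apply: cvgD; first exact: (Phi1_cont Phi_C2).
  by apply: cvgM; [exact: cvg_id|exact: h].
Qed.

Variables (r : R) (E : set R[i]) (sigma : probability T R).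
Hypothesis r_gt0 : 0 < r.
Hypothesis mE : measurable (@toC R @^-1` E).
Hypothesis E_sub : forall z, E z -> cabs z <= r.
Hypothesis sigmaE : forall A, measurable A ->
  sigma A = (\int[area]_(p in A) (\1_(@toC R @^-1` E) p * gdens Phi (cabs (toC p) ^+ 2))%:E)%E.
Hypothesis sigma_equilibrium : equilibrium_measure (potential Phi P) (closed_disk r) sigma.
Notation DD := (@toC R @^-1` closed_disk r).
Notation W := (potential Phi P).

Lemma sigma_bounded z : z != 0 -> exists C eps0, locally_bounded_at sigma z C eps0.
Proof. exact: (density_locally_bounded gdens_gt0 gdens_cont mE sigmaE). Qed.

Definition residual z := field Phi P z - cauchy_transform sigma z.

Lemma field_cont z : z != 0 -> econt cdist (field Phi P) z.
Proof.
move=> z0; apply: econtB; last exact: cdiff_cont (cdiff_horner _ _).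
apply: econtM; first exact: econt_conj (@ccont_id _ z).
apply: (@econt_real _ _ _ (derive1 Phi) (fun z => cabs z ^+ 2)).
  by apply: (Phi1_cont Phi_C2); rewrite exprn_gt0// cabs_gt0.
apply: (@econt_near _ _ _ (fun z => z * z^*)).
- by rewrite /cdist subrr cabs0.
- by exists 1 => // w _; rewrite mul_conj.
- by apply: econtM; [exact: ccont_id|exact: econt_conj (@ccont_id _ z)].
Qed.

Lemma residual_cont z : z != 0 -> econt cdist residual z.
Proof.
move=> z0; have [C [e lb]] := sigma_bounded z0.
by apply: econtB; [exact: field_cont|exact: cauchy_transform_cont lb].
Qed.

(** By minimality, as a competitor of finite energy exists. *)
Lemma finite_interaction c z1 e1 : 2 * r <= expR c -> z1 != 0 -> 0 < e1 ->
  (forall w, cabs (w - z1) < e1 -> E w) -> (interaction r c sigma < +oo)%E.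
Proof.
move=> cr z10 e10 Ez1; have [[sD np] min] := sigma_equilibrium.
have [C [e0 lb]] := sigma_bounded z10.
pose e := Num.min e0 e1; have e_gt0 : 0 < e by rewrite lt_min e10 andbT; case: lb.
have lb' : locally_bounded_at sigma z1 C e.
  by apply: locally_bounded_shrink lb => //; rewrite ge_min lexx.
have Ee w : cabs (w - z1) < e -> E w.
  by move=> h; apply: Ez1; apply: lt_le_trans h _; rewrite ge_min lexx orbT.
have B0 := density_inside gdens_gt0 gdens_cont mE sigmaE z10 e_gt0 Ee.
have BD : pball z1 e `<=` DD by move=> p /Ee /E_sub.
have [nu nu_adm nu_fin] := finite_interaction_competitor cr lb' B0 BD np.
have [M WM] := potential_bounded P Phi_cont r.
have mD := @closed_disk_measurable R r.
have mW : measurable_fun DD (fun p => W (toC p)) by exact: potential_measurable.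
have WMp p : DD p -> `|W (toC p)| <= M by move=> Dp; exact: WM.
have := min nu nu_adm; rewrite (energyE cr mW WMp sD) (energyE cr mW WMp nu_adm.1).
have := interaction_ge0 cr nu; move: nu_fin; case: (interaction r c nu) => // i _ _.
have := interaction_ge0 cr sigma.
case: (interaction r c sigma) => [j|_|] //; first by rewrite ltry.
Qed.

(** Otherwise pushing the mass near [z1] along the conjugate of the residual
would lower the energy to first order. *)
Theorem residual_zero z1 e1 : z1 != 0 -> 0 < e1 ->
  (forall w, cabs (w - z1) < e1 -> E w) -> residual z1 = 0.
Proof.
move=> z10 e10 Ez1; apply/eqP; apply: contraT => H0.
have [[sD np] min] := sigma_equilibrium.
have mD := @closed_disk_measurable R r.
pose eta := cabs (residual z1); have eta0 : 0 < eta by rewrite cabs_gt0.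
have [C [e0 lb]] := sigma_bounded z10.
have e00 : 0 < e0 by case: lb.
have [del del0 Hdel] := residual_cont z10 (divr_gt0 eta0 (ltr0Sn _ 1)).
have z1_gt0 : 0 < cabs z1 by rewrite cabs_gt0.
have [eps [[eps0 eps1 epse] [epsE epsz epsd]]] : exists eps : R,
    [/\ 0 < eps, eps <= 1 & eps <= e0] /\ [/\ 2 * eps <= e1, 2 * eps <= cabs z1 / 2 & eps <= del].
  pose m := Num.min 1 (Num.min e0 (Num.min (e1 / 2) (Num.min (cabs z1 / 4) del))).
  have m0 : 0 < m by rewrite !lt_min ltr01 e00 del0 !divr_gt0.
  have [m1 m2] : m <= 1 /\ m <= e0 by rewrite !ge_min !lexx !orbT.
  have [m3 m4 m5] : [/\ m <= e1 / 2, m <= cabs z1 / 4 & m <= del] by rewrite !ge_min !lexx !orbT.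
  exists m; split; split => //.
    by rewrite mulrC -ler_pdivlMr.
  by rewrite mulrC -ler_pdivlMr// (le_trans m4)// -mulrA -invfM -natrM.
have half1 : eps / 2 < eps by rewrite ltr_pdivrMr // ltr_pMr // ltr1n.
have half2 : eps / 2 < 2 * eps by apply: lt_trans half1 _; rewrite ltr_pMl// ltr1n.
(* The direction in which the energy decreases fastest at [z1]. *)
pose k := - (residual z1)^* / eta%:C.
have k1 : cabs k = 1.
  by rewrite /k cabsM cabsV cabsN cabs_conj cabs_real gtr0_norm// divff// gt_eqF.
pose v := push k z1 eps.
have vb z : cabs (v z) = bump z1 eps z by exact: cabs_push.
have v0 z : v z != 0 -> cabs (z - z1) < eps.
  by rewrite -cabs_gt0 vb => h; apply: bump_support; rewrite gt_eqF.
have near_disk z : cabs (z - z1) < 2 * eps -> cabs z <= r.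
  by move=> h; apply/E_sub/Ez1; exact: lt_le_trans h epsE.
have v_disk t z : 0 <= t <= 6^-1 -> (cabs (z + t%:C * v z) <= r) = (cabs z <= r).
  move=> t6; have [vz|/eqP vz] := pselect (v z = 0); first by rewrite vz mulr0 addr0.
  rewrite !near_disk//; first by apply: lt_trans (v0 _ vz) _; rewrite ltr_pMl// ltr1n.
  exact: (pushed_near k1 eps0 t6 (v0 _ vz)).
pose rho := cabs z1 / 2; have rho0 : 0 < rho by rewrite divr_gt0.
have near_rho z : cabs (z - z1) < 2 * eps -> rho <= cabs z.
  move=> h; have := cabs_sub z1 (z1 - z); rewrite (_ : z1 - (z1 - z) = z); last by ring.
  move: epsz h; rewrite cabsC /rho; set x := cabs z1; lra.
have [A A0 taylor] := potential_taylor P Phi_C2 r rho0.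
(* Agrees with [field] where [v] does not vanish, and is continuous everywhere,
   hence measurable. *)
pose ftrunc z := z^* * (derive1 Phi (Num.max (rho ^+ 2) (cabs z ^+ 2)))%:C - (deriv P).[z].
have ftruncE z : cabs (z - z1) < 2 * eps -> ftrunc z = field Phi P z.
  move=> /near_rho h; rewrite /ftrunc /field max_r// lerXn2r ?nnegrE ?cabs_ge0//.
  exact: ltW.
pose omega (p : T) := 2 * complex.Re (ftrunc (toC p) * v (toC p)).
have cont_trunc : continuous (fun s => derive1 Phi (Num.max (rho ^+ 2) s)).
  move=> s; apply: continuous_comp; last by apply: (Phi1_cont Phi_C2); rewrite lt_max exprn_gt0.
  by apply: continuous_max; [exact: cst_continuous|exact: cvg_id].
have cm : cmeas DD (fun p : T => ftrunc (toC p) * v (toC p)).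
  apply: cmeasM; last first.
    have [a b] := cmeas_push k z1 eps; by split; exact: measurable_funTS.
  apply: cmeasB; last exact: cmeas_horner.
  apply: cmeasM; first by apply: cmeas_conj; exact: cmeas_toC.
  apply: cmeas_real; apply: measurable_funTS.
  apply: (measurableT_comp (continuous_measurable_fun cont_trunc)).
  exact: measurable_sqr_abs.
have mo : measurable_fun DD omega by apply: measurable_funM => //; case: cm.
have v_le1 z : cabs (v z) <= 1 by rewrite vb; apply: le_trans eps1; exact: bump_le.
have [K K0 hK] : exists2 K, 0 <= K & forall x, 0 <= x <= r ^+ 2 -> `|derive1 Phi (Num.max (rho ^+ 2) x)| <= K.
  by apply: bounded_on_segment; exact: continuous_subspaceT.
have [M M0 hM] := horner_bounded (deriv P) r.
have ob p : DD p -> `|omega p| <= 2 * (r * K + M).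
  move=> Dp; rewrite normrM ger0_norm// ler_wpM2l//.
  apply: le_trans (Re_le_cabs _) _; rewrite cabsM -[leRHS]mulr1 ler_pM ?cabs_ge0//.
  apply: le_trans (cabsB _ _) _; rewrite lerD ?hM// cabsM cabs_conj cabs_real ler_pM ?cabs_ge0// hK//.
  by rewrite exprn_ge0 ?cabs_ge0//= lerXn2r ?nnegrE ?cabs_ge0 ?(ltW r_gt0).
have Wt t (p : T) : 0 <= t <= 6^-1 -> DD p ->
    W (toC p + t%:C * v (toC p)) <= W (toC p) + t * omega p + A * t ^+ 2.
  move=> t6 Dp; have /andP[t0 t1] := t6; have [vz|/eqP vz] := pselect (v (toC p) = 0).
    by rewrite /omega vz !mulr0 !addr0 lerDl mulr_ge0// exprn_ge0.
  have near1 : cabs (toC p - z1) < 2 * eps by apply: lt_trans (v0 _ vz) _; rewrite ltr_pMl// ltr1n.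
  have near2 := pushed_near k1 eps0 t6 (v0 _ vz).
  have tv : cabs (t%:C * v (toC p)) <= t.
    by rewrite cabsM cabs_real ger0_norm// ler_piMr.
  have t1' : t <= 1 by apply: le_trans t1 _; rewrite invf_le1// ler1n.
  apply: le_trans (taylor (toC p) (t%:C * v (toC p)) _ _ (le_trans tv t1')) _.
  - by rewrite near_rho ?near_disk.
  - by rewrite near_rho ?near_disk.
  rewrite lerD//; last by rewrite ler_wpM2l// lerXn2r ?nnegrE ?cabs_ge0.
  by rewrite /omega ftruncE// mulrCA ReM /= mul0r subr0 mulrCA.
have cr : 2 * r <= expR (2 * r) by apply: le_trans (expR_ge1Dx _); rewrite lerDr.
have [MW WM] := potential_bounded P Phi_cont r.
have mW : measurable_fun DD (fun p => W (toC p)) by exact: potential_measurable.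
have WMp p : DD p -> `|W (toC p)| <= MW by move=> Dp; exact: WM.
have fin := finite_interaction cr z10 e10 Ez1.
have := first_variation_ge0 cr sD np (push_lip z1 eps k1) (cmeas_push k z1 eps) v_disk mW WMp fin min mo ob Wt.
have bnd z : v z != 0 -> ball_bound sigma C e0 z.
  by move=> /v0 h; case: lb => _ _; apply; exact: lt_le_trans h epse.
have C0 : 0 <= C by case: lb.
have vm : cmeas setT (fun p : T => v (toC p)) by exact: cmeas_push.
rewrite (re_quotient_integral sD v_le1 vm C0 e00 bnd).
have ifw := field_work_integrable v_le1 vm C0 e00 bnd.
have ifw2 : sigma.-integrable DD (EFin \o (fun p => 2 * field_work sigma v p)).
  by have := integrableZl mD 2 (integrableS measurableT mD (@subsetT _ _) ifw).
have io : sigma.-integrable DD (EFin \o omega).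
  apply: measurable_bounded_integrable => //; first by rewrite [X in (X < _)%E]sD ltry.
  by exists (2 * (r * K + M)); split; rewrite ?num_real// => x Mx p Dp /=; apply: le_trans (ltW Mx); exact: ob.
rewrite -RintegralZl//; last by apply: integrableS ifw.
rewrite -subr_ge0 -RintegralB//.
pose B := pball z1 (eps / 2); have mB : measurable B by exact: pball_measurable.
have i1 : sigma.-integrable DD (EFin \o \1_B).
  apply: measurable_bounded_integrable => //; first by rewrite [X in (X < _)%E]sD ltry.
  exists 1; split; rewrite ?num_real// => x x1 p _ /=; apply: le_trans (ltW x1).
  by rewrite ger0_norm// indicE lern1 leq_b1.
have iB : sigma.-integrable DD (EFin \o (fun p => - (eta * (eps / 2)) * \1_B p)).
  by have := integrableZl mD (- (eta * (eps / 2))) i1.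
rewrite leNgt => /negP; case.
apply: (@le_lt_trans _ _ (Rintegral sigma DD (fun p => - (eta * (eps / 2)) * \1_B p))); last first.
  rewrite (RintegralZl (- (eta * (eps / 2))) mD i1) /Rintegral integral_indic//.
  have BE : B `&` DD = B by apply/setIidPl => p h; apply: near_disk; exact: lt_trans h half2.
  rewrite BE mulNr oppr_lt0 mulr_gt0 ?mulr_gt0 ?divr_gt0//.
  have Bpos : (0 < sigma B)%E.
    apply: (density_inside gdens_gt0 gdens_cont mE sigmaE z10); first by rewrite divr_gt0.
    by move=> w h; apply: Ez1; apply: lt_le_trans epsE; exact: lt_trans h half2.
  by rewrite fine_gt0// Bpos; apply: le_lt_trans (probability_le1 _ mB) _; rewrite ltry.
apply: le_Rintegral => //.
  by have := integrableB mD io ifw2.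
move=> p Dp; apply: (@le_trans _ _ (- (eta * bump z1 eps (toC p)))); last first.
  rewrite mulNr lerN2 -mulrA ler_wpM2l ?(ltW eta0)// indicE.
  have [/[!inE] pB|_] := boolP (p \in B); last by rewrite mulr0 bump_ge0.
  rewrite mulr1 /bump le_max; apply/orP; right; move: pB; rewrite /B /pball /=.
  by move=> /ltW h; rewrite lerBrDr [leRHS]splitr lerD2l.
have E1 : omega p - 2 * field_work sigma v p =
    2 * complex.Re ((ftrunc (toC p) - cauchy_transform sigma (toC p)) * v (toC p)).
  rewrite /omega /field_work -mulrBr -ReN -ReD; congr (_ * complex.Re _).
  by rewrite [RHS]mulrBl; congr (_ - _); exact: mulrC.
rewrite E1; have [vz|/eqP vz] := pselect (v (toC p) = 0).
  have <- : cabs (v (toC p)) = bump z1 eps (toC p) by exact: vb.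
  by rewrite vz cabs0 !mulr0 oppr0.
have nz := v0 _ vz; have near1 : cabs (toC p - z1) < 2 * eps by apply: lt_trans nz _; rewrite ltr_pMl// ltr1n.
rewrite ftruncE// -/(residual (toC p)).
have kE : residual z1 * k = (- eta)%:C.
  have eta_neq0 : eta%:C != 0 :> R[i] by rewrite -cabs_gt0 cabs_real gtr0_norm.
  rewrite /k mulrA mulrN mul_conj mulNr expr2 [(cabs _ * cabs _)%:C]rmorphM /=.
  by rewrite -/eta mulfK// rmorphN.
have : complex.Re (residual (toC p) * k) <= - (eta / 2).
  rewrite -[residual (toC p)](subrK (residual z1)) mulrDl kE ReD /=.
  have : complex.Re ((residual (toC p) - residual z1) * k) <= eta / 2.
    apply: le_trans (ler_norm _) _; apply: le_trans (Re_le_cabs _) _.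
    rewrite cabsM k1 mulr1; apply/ltW/Hdel; exact: lt_le_trans nz epsd.
  have -> : - (eta / 2) = eta / 2 - eta by rewrite [X in _ - X]splitr opprD addrA subrr add0r.
  by rewrite lerD2r.
have ReZ (x : R[i]) (b : R) : complex.Re (x * b%:C) = complex.Re x * b by rewrite ReM /= mulr0 subr0.
move=> h; rewrite /v /push [residual _ * (k * _)]mulrA ReZ.
have := ler_wpM2r (bump_ge0 z1 eps (toC p)) h.
set b := bump _ _ _; set x := complex.Re _; rewrite mulNr mulrAC => h1.
by rewrite mulrC -ler_pdivlMr// mulNr.
Qed.

Lemma residual_zero_region (U : set R[i]) w : open U -> closure U = E -> E w -> w != 0 ->
  residual w = 0.
Proof.
move=> oU cU Ew w0; apply/eqP; rewrite -cabs_eq0 eq_le cabs_ge0 andbT.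
apply/ler_addgt0Pr => e e0; rewrite add0r.
have [s s0 hs] := residual_cont w0 e0.
have : closure U w by rewrite cU.
have c0 : 0 < Num.min s (cabs w) by rewrite lt_min s0 cabs_gt0.
move=> /(_ [set v | cabs (v - w) < Num.min s (cabs w)]) [|v [Uv]]; first by apply/nbhsC; exists (Num.min s (cabs w)).
rewrite /= lt_min => /andP[vs vw].
have v0 : v != 0 by apply: contraTneq vw => ->; rewrite sub0r cabsN ltxx.
have /nbhsC [e1 e10 Uv1] : nbhs v U by exact: open_nbhs_nbhs.
have rv : residual v = 0.
  by apply: (residual_zero v0 e10) => v' /Uv1 Uv'; rewrite -cU; exact: subset_closure.
by have := hs v vs; rewrite rv sub0r cabsN => /ltW.
Qed.

Lemma field_balance (U : set R[i]) w : open U -> closure U = E -> E w -> w != 0 ->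
  (Ifun Phi (cabs w ^+ 2))%:C = w * (deriv P).[w] + w * cauchy_transform sigma w.
Proof.
move=> oU cU Ew w0; have := residual_zero_region oU cU Ew w0.
move=> /eqP; rewrite /residual /field subr_eq0 subr_eq => /eqP h.
by rewrite -mulrDr [_ + cauchy_transform _ _]addrC -h mulrA mul_conj -rmorphM.
Qed.

Lemma cauchy_transform_outside w : closed E -> ~ E w -> w != 0 -> cdiff (cauchy_transform sigma) w.
Proof.
move=> cE nE w0; have [C [e lb]] := sigma_bounded w0.
have /nbhsC [s s0 hs] : nbhs w (~` E) by apply: open_nbhs_nbhs; split => //; exact: closed_openC.
apply: (cauchy_transform_cdiff lb s0); apply: (density_outside sigmaE) => v vw; exact: hs.
Qed.

Lemma cauchy_transform_far w : 2 * r <= cabs w -> cabs (cauchy_transform sigma w) <= 4 / cabs w.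
Proof.
move=> rw; have [[sD _] _] := sigma_equilibrium.
apply: cauchy_transform_decay rw _ => //.
by rewrite probability_setC ?[X in (1 - X)%E]sD ?subee//; exact: closed_disk_measurable.
Qed.

End EquilibriumField.

(** * Boundary behaviour of an exterior conformal map *)
Section ConformalMap.
Context {R : realType}.
Implicit Types (z w : R[i]).

Lemma bolzano (z_ : nat -> R[i]) (M : R) : (forall n, cabs (z_ n) <= M) ->
  exists w, forall e N, 0 < e -> exists2 n, (N <= n)%N & cabs (z_ n - w) < e.
Proof.
move=> zM; pose A : set (R * R) := `[- M, M]%classic `*` `[- M, M]%classic.
have cA : compact A by apply: compact_setX; exact: segment_compact.
pose x n : R * R := (complex.Re (z_ n), complex.Im (z_ n)).
have FA : (x @ \oo) A.
  exists 0%N => // n _; split; rewrite /= in_itv /= -ler_norml; apply: le_trans (zM n).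
  - exact: Re_le_cabs.
  - exact: Im_le_cabs.
have [p [_ cp]] := cA (x @ \oo) _ FA.
exists (p.1 +i* p.2) => e N e0.
have e20 : 0 < e / 2 by rewrite divr_gt0.
have FN : (x @ \oo) (x @` [set n | (N <= n)%N]).
  by exists N => // n Nn; exists n.
have [_ [[n Nn <-] [/= h1 h2]]] := cp _ _ FN (nbhsx_ballx p _ e20).
exists n => //; apply: le_lt_trans (cabs_le_ReIm _) _.
rewrite [ltRHS]splitr ltrD// ?ReD ?ImD ?ReN ?ImN distrC; [exact: h1|exact: h2].
Qed.

Variables (E : set R[i]) (f : R[i] -> sphere R) (a delta : R).
Hypothesis f_conformal : conformal_bijection (open_disk 1) (~` (Some @` E)) f.
Hypothesis f_0 : f 0 = None.
Hypothesis f_a : derive1 (chart \o sphere_inv \o f) 0 = a%:C.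
Hypothesis delta_gt0 : 0 < delta.
Hypothesis E_near0 : forall w, cabs w < delta -> E w.

(** The reciprocal [1 / f], a finite holomorphic function on the disk. *)
Definition kmap z : R[i] := chart (sphere_inv (f z)).

Lemma f_finite z w : cabs z < 1 -> f z = Some w -> ~ E w /\ w != 0.
Proof.
move=> z1 fz; have [_ [fun_f _ _]] := f_conformal.
have nE : ~ E w by move=> Ew; apply: (fun_f z z1); rewrite fz; exists w.
by split => //; apply/eqP => w0; apply: nE; apply: E_near0; rewrite w0 cabs0.
Qed.

Lemma kmapE z : cabs z < 1 -> f z = if kmap z == 0 then None else Some (kmap z)^-1.
Proof.
move=> z1; rewrite /kmap; case fz : (f z) => [w|]; last by rewrite /= eqxx.
have [_ w0] := f_finite z1 fz.
by rewrite /sphere_inv (negPf w0) /= invr_eq0 (negPf w0) invrK.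
Qed.

Lemma kmap_finite z w : w != 0 -> f z = Some w -> kmap z = w^-1.
Proof. by move=> w0 fz; rewrite /kmap fz /= (negPf w0). Qed.

Lemma kmap0 : kmap 0 = 0. Proof. by rewrite /kmap f_0. Qed.

Lemma kmap_inj z w : cabs z < 1 -> cabs w < 1 -> kmap z = kmap w -> z = w.
Proof.
move=> z1 w1 e; have [_ [_ inj _]] := f_conformal.
by apply: inj; rewrite ?inE// !kmapE// e.
Qed.

Lemma kmap_neq0 z : 0 < cabs z < 1 -> kmap z != 0.
Proof.
move=> /andP[z0 z1]; apply: contraTneq z0 => k0; rewrite -leNgt.
by rewrite (@kmap_inj z 0) ?kmap0// cabs0.
Qed.

Lemma kmap_notE z : 0 < cabs z < 1 -> ~ E (kmap z)^-1.
Proof.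
move=> h; have k0 := kmap_neq0 h; case/andP: h => _ z1.
by apply: (proj1 (f_finite z1 _)); rewrite kmapE// (negPf k0).
Qed.

Lemma kmap_onto w : ~ E w -> exists2 z, cabs z < 1 & kmap z = w^-1.
Proof.
move=> nE; have [_ [_ _ surj]] := f_conformal.
have [z z1 fz] : (f @` open_disk 1) (Some w) by apply: surj => -[w' Ew' [e]]; apply: nE; rewrite -e.
have [_ w0] := f_finite z1 fz; exists z => //; exact: kmap_finite fz.
Qed.

Lemma kmap_cdiff z : cabs z < 1 -> cdiff kmap z.
Proof.
move=> z1; have [hol _] := f_conformal.
have toc (g : R[i] -> R[i]) : derivable g z 1 -> cdiff g z.
  by move=> /derivable_cdiff [h [hc _] hE]; exists h.
case: (hol z z1) => -[fin der]; last exact: (toc _ der).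
have /nbhsC [e e0 he] := fin.
have := toc _ der.
have sm : exists2 s, 0 < s & forall x, cabs (x - z) < s -> kmap x = (chart (f x))^-1 /\ chart (f x) != 0.
  exists (Num.min e (1 - cabs z)); first by rewrite lt_min e0 subr_gt0.
  move=> x; rewrite lt_min => /andP[xe x1].
  have {}x1 : cabs x < 1.
    rewrite -[x](subrK z); apply: le_lt_trans (cabsD _ _) _; by move: x1; rewrite ltrBrDr.
  have := he x xe; have := @f_finite x ^~ x1; have := @kmap_finite x.
  case: (f x) => [w|] // kf ff _; have [_ w0] := ff w erefl.
  by rewrite (kf w w0 erefl).
have [s s0 hs] := sm.
have [_ c0] := hs z ltac:(by rewrite subrr cabs0).
move=> /(cdiffV c0); apply: cdiff_near; exists s => // w /hs [-> _] //.
Qed.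

Lemma kmap_slope : exists2 g, econt cdist g 0 /\ g 0 = a%:C & forall z, kmap z = g z * z.
Proof.
have [hol _] := f_conformal.
have d0 : derivable kmap 0 1.
  case: (hol 0 _) => [||[_ //]]; first by rewrite /open_disk /= cabs0 ltr01.
  move=> [fin _]; have /nbhsC [e e0 /(_ 0)] := fin.
  by rewrite subrr cabs0 f_0 => /(_ e0).
have [g [gc g0] gE] := derivable_cdiff d0.
exists g; first by split => //; rewrite g0.
by move=> z; rewrite gE kmap0 add0r subr0.
Qed.

Lemma kmap_bounded z : cabs z < 1 -> cabs (kmap z) <= delta^-1.
Proof.
move=> z1; have [->|/eqP z0] := pselect (z = 0); first by rewrite kmap0 cabs0 invr_ge0 ltW.
have h : 0 < cabs z < 1 by rewrite cabs_gt0 z0.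
rewrite -[leLHS]invrK lef_pV2 ?posrE ?invr_gt0 ?cabs_gt0 ?kmap_neq0// -cabsV leNgt.
by apply/negP => /E_near0; exact: kmap_notE.
Qed.

(** The image of a small disk about [z0] contains a disk about [kmap z0]; by
injectivity nothing else is mapped there. *)
Lemma kmap_open z0 (s : R) : 0 < s -> cabs z0 + s <= 1 ->
  exists2 e, 0 < e & forall z, cabs z < 1 -> cabs (kmap z - kmap z0) < e -> cabs z < cabs z0 + s.
Proof.
move=> s0 zs.
have near1 z : cabs (z - z0) < s -> cabs z < cabs z0 + s.
  by move=> h; rewrite -[z](subrK z0) addrC; apply: le_lt_trans (cabsD _ _) _; rewrite ltrD2l.
have lt1 z : cabs (z - z0) < s -> cabs z < 1 by move=> /near1 h; exact: lt_le_trans h zs.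
have z01 : cabs z0 < 1 by apply: lt1; rewrite subrr cabs0.
have [||e e0 he] := @open_mapping R kmap z0 s s0.
- by move=> z /lt1; exact: kmap_cdiff.
- by move=> z /lt1 z1; exact: kmap_inj.
exists e => // z z1 /he [z' z's kz].
by rewrite -(kmap_inj (lt1 _ z's) z1 kz); exact: near1.
Qed.

(** The values of the map leave every compact part of its image as the argument
tends to the circle, because the map is open and injective. *)
Theorem boundary_approach (N : R[i] -> Prop) :
  (forall w, E w -> exists2 e, 0 < e & forall v, ~ E v -> cabs (v - w) < e -> N v) ->
  exists2 rho, 0 < rho < 1 & forall z, rho < cabs z < 1 -> N (kmap z)^-1.
Proof.
move=> Nnear; apply: contrapT => no.
have seq n : exists z, 1 - n.+2%:R^-1 < cabs z < 1 /\ ~ N (kmap z)^-1.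
  apply: contrapT => none; apply: no; exists (1 - n.+2%:R^-1).
    by rewrite subr_gt0 invf_lt1// ltr1n/= gtrBl invr_gt0.
  by move=> z h; apply: contrapT => nN; apply: none; exists z.
have {seq} [z_ hz] := choice seq.
have z0 n : 0 < cabs (z_ n) < 1.
  have [/andP[h1 h2] _] := hz n; rewrite h2 andbT; apply: le_lt_trans h1.
  by rewrite subr_ge0 invf_le1// ler1n.
have z1 n : cabs (z_ n) < 1 by case/andP: (z0 n).
have [kap hk] := bolzano (fun n => kmap_bounded (z1 n)).
have late (s : R) : s < 1 -> exists n0, forall n, (n0 <= n)%N -> s < cabs (z_ n).
  move=> s1; have [m hm] : exists m : nat, (1 - s)^-1 <= m%:R.
    exists (Num.bound (1 - s)^-1); apply/ltW/archi_boundP.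
    by rewrite invr_ge0 subr_ge0 ltW.
  exists m => n mn; have [/andP[h _] _] := hz n; apply: le_lt_trans h.
  rewrite lerBrDr -lerBrDl; rewrite -[leRHS]invrK lef_pV2 ?posrE ?invr_gt0 ?subr_gt0//.
  by apply: le_trans hm _; rewrite ler_nat (leq_trans mn)// -addn2 leq_addr.
have inner zs : cabs zs < 1 -> kmap zs != kap.
  move=> zs1; apply/eqP => e.
  (* A cluster value in the image would be approached only from inside a smaller
     disk. *)
  pose s := (1 - cabs zs) / 2; have s0 : 0 < s by rewrite divr_gt0// subr_gt0.
  have zs2 : cabs zs + s < 1 by rewrite /s; move: zs1; set x := cabs zs => ?; lra.
  have [e' e0 he] := kmap_open s0 (ltW zs2).
  have [n0 hn0] := late _ zs2.
  have [n nn] := hk e' n0 e0; rewrite -e => /(he _ (z1 n)) /lt_trans /(_ (hn0 _ nn)).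
  by rewrite ltxx.
have kap0 : kap != 0 by rewrite eq_sym -kmap0; apply: inner; rewrite cabs0.
have [Ew|nEw] := pselect (E kap^-1); last first.
  by have [z zlt kz] := kmap_onto nEw; have := inner z zlt; rewrite kz invrK eqxx.
have [e e0 he] := Nnear _ Ew.
have := cdiff_cont (@cdiff_inv R kap kap0); move=> /(_ e e0) [s s0 hs].
have [n _ nk] := hk s 0%N s0.
have [_ nN] := hz n; apply: nN; apply: he; last exact: hs.
exact: kmap_notE (z0 n).
Qed.

End ConformalMap.

(** * The Laurent polynomial of the boundary values *)
Section BoundaryValues.
Context {R : realType}.
Implicit Types (z w u : R[i]).

(** Compactness of the circle, for properties of points inside. *)
Lemma circle_uniform (N : R[i] -> Prop) :
  (forall u, cabs u = 1 -> exists2 s, 0 < s & forall z, cabs z < 1 -> cabs (z - u) < s -> N z) ->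
  exists2 rho, 0 < rho < 1 & forall z, rho < cabs z < 1 -> N z.
Proof.
move=> loc; apply: contrapT => no.
have seq n : exists z, 1 - n.+2%:R^-1 < cabs z < 1 /\ ~ N z.
  apply: contrapT => none; apply: no; exists (1 - n.+2%:R^-1).
    by rewrite subr_gt0 invf_lt1// ltr1n/= gtrBl invr_gt0.
  by move=> z h; apply: contrapT => nN; apply: none; exists z.
have {seq} [z_ hz] := choice seq.
have zb n : cabs (z_ n) <= 1 by have [/andP[_ /ltW]] := hz n.
have [u hu] := bolzano zb.
have u1 : cabs u = 1.
  apply/eqP; rewrite eq_le !leNgt; apply/andP; split; apply/negP => h.
    have [n _ zn] := hu _ 0%N (ltac:(by rewrite subr_gt0) : 0 < cabs u - 1).
    have [/andP[_ z1] _] := hz n; have := cabs_sub u (z_ n); rewrite (cabsC u) => h2.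
    by move: (le_lt_trans h2 zn); rewrite ltrD2l ltrN2 => /(lt_trans z1); rewrite ltxx.
  pose e := (1 - cabs u) / 2; have e0 : 0 < e by rewrite divr_gt0// subr_gt0.
  have ei : 0 <= e^-1 by rewrite invr_ge0 ltW.
  have [n nN zn] := hu e (Num.bound e^-1) e0.
  have [/andP[z1 _] _] := hz n.
  have e1 : n.+2%:R^-1 <= e.
    rewrite -[leRHS]invrK lef_pV2 ?posrE ?invr_gt0//; apply: le_trans (ltW (archi_boundP ei)) _.
    by rewrite ler_nat (leq_trans nN)// -addn2 leq_addr.
  have := le_lt_trans (cabs_sub (z_ n) u) zn.
  move: z1 e1; rewrite /e; set x := cabs u; set y := cabs (z_ n); set t := _^-1; lra.
have [s s0 hs] := loc u u1; have [n _ zn] := hu s 0%N s0.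
by have [/andP[_ z1] nN] := hz n; apply: nN; exact: hs.
Qed.

Lemma cabs_sum (I : Type) (s : seq I) (F : I -> R[i]) :
  cabs (\sum_(i <- s) F i) <= \sum_(i <- s) cabs (F i).
Proof.
elim/big_rec2: _ => [|i x y _ h]; first by rewrite cabs0.
by apply: le_trans (cabsD _ _) _; rewrite lerD2l.
Qed.

Lemma horner_growth (q : {poly R[i]}) (d : nat) : (size q <= d)%N -> exists2 C, 0 <= C &
  forall w, 1 <= cabs w -> cabs (w * q.[w]) <= C * cabs w ^+ d.
Proof.
move=> qd; exists (\sum_(i < size q) cabs q`_i); first by apply: sumr_ge0 => i _; exact: cabs_ge0.
move=> w w1; rewrite horner_coef mulr_sumr; apply: le_trans (cabs_sum _ _) _.
rewrite mulr_suml; apply: ler_sum => i _.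
rewrite mulrCA -exprS cabsM cabsX ler_wpM2l ?cabs_ge0//.
by rewrite ler_weXn2l// (leq_trans _ qd).
Qed.

Variables (E : set R[i]) (f : R[i] -> sphere R) (a delta : R).
Hypothesis f_conformal : conformal_bijection (open_disk 1) (~` (Some @` E)) f.
Hypothesis f_0 : f 0 = None.
Hypothesis a_gt0 : 0 < a.
Hypothesis f_a : derive1 (chart \o sphere_inv \o f) 0 = a%:C.
Hypothesis delta_gt0 : 0 < delta.
Hypothesis E_near0 : forall w, cabs w < delta -> E w.

Variables (I : R -> R) (q : {poly R[i]}) (h : R[i] -> R[i]) (rho0 : R) (d : nat).
Hypothesis I_cont : forall s, 0 < s -> {for s, continuous I}.
Hypothesis q_size : (size q <= d)%N.
Hypothesis h_cdiff : forall w, ~ E w -> cdiff h w.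
Hypothesis h_cont : forall w, w != 0 -> econt cdist h w.
Hypothesis h_decay : forall w, rho0 <= cabs w -> cabs (h w) <= 4 / cabs w.
Hypothesis balance : forall w, E w -> w != 0 -> (I (cabs w ^+ 2))%:C = w * q.[w] + w * h w.

Notation k := (kmap f).

(** The function [w * q w + w * h w] at [w = f z]; on the boundary of [E] it agrees
with [I (|w|^2)], so up to the factor [w] it plays the role of a Schwarz
function. *)
Definition schwarz z := (k z)^-1 * q.[(k z)^-1] + (k z)^-1 * h (k z)^-1.

Lemma schwarz_holo : holo0 schwarz.
Proof.
move=> z z1; have k0 := kmap_neq0 f_conformal f_0 delta_gt0 E_near0 z1.
have z2 : cabs z < 1 by case/andP: z1.
have kc := cdiffV k0 (kmap_cdiff f_conformal delta_gt0 E_near0 z2).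
apply: cdiffD; apply: cdiffM => //.
- exact: (cdiff_comp kc (cdiff_horner _ _)).
- by apply: (cdiff_comp kc); apply: h_cdiff; exact: (kmap_notE f_conformal f_0 delta_gt0 E_near0).
Qed.

Lemma sqr_cabs_cont w : econt cdist (fun w => (cabs w ^+ 2)%:C) w.
Proof.
apply: (@econt_near _ _ _ (fun z => z * z^*)).
- by rewrite /cdist subrr cabs0.
- by exists 1 => // v _; rewrite mul_conj.
- by apply: econtM; [exact: ccont_id|exact: econt_conj (@ccont_id _ w)].
Qed.

(** On [E] the difference vanishes, and it is continuous there; about the origin
nothing is to be shown, since a disk about it consists of points of [E]. *)
Lemma schwarz_boundary e : 0 < e -> exists2 rho, 0 < rho < 1 &
  forall z, rho < cabs z < 1 -> cabs ((I (cabs (k z)^-1 ^+ 2))%:C - schwarz z) < e.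
Proof.
move=> e0; pose N v := cabs ((I (cabs v ^+ 2))%:C - (v * q.[v] + v * h v)) < e.
apply: (@boundary_approach _ E f delta f_conformal f_0 delta_gt0 E_near0 N) => w Ew.
have [->|/eqP w0] := pselect (w = 0).
  by exists delta => // v nE; rewrite subr0 => /E_near0.
have : econt cdist (fun v => (I (cabs v ^+ 2))%:C - (v * q.[v] + v * h v)) w.
  apply: econtB.
    apply: (econt_real (u := I)); last exact: sqr_cabs_cont.
    by apply: I_cont; rewrite exprn_gt0// cabs_gt0.
  apply: econtD; apply: econtM; try exact: ccont_id.
    exact: cdiff_cont (cdiff_horner _ _).
  exact: h_cont.
move=> /(_ e e0) [s s0 hs]; exists s => // v _ vw.
by have := hs v vw; rewrite (balance Ew w0) subrr subr0.
Qed.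

(** Near the origin [k z] is comparable with [a * z]. *)
Lemma schwarz_pole : exists C s, 0 < s /\
  forall z, 0 < cabs z < s -> cabs (schwarz z) <= C * (cabs z ^+ d)^-1.
Proof.
have [g [gc g0] gE] := kmap_slope f_conformal f_0 f_a.
have [C C0 hC] := horner_growth q_size.
have [s1 s10 hs1] := gc (a / 2) (divr_gt0 a_gt0 (ltr0Sn _ 1)).
(* Beyond this modulus the polynomial and the transform obey their bounds at
   infinity. *)
pose M := Num.max 1 rho0; have M1 : 1 <= M by rewrite le_max lexx.
have M0 : 0 < M by apply: lt_le_trans M1.
have Ma : 0 < (2 * a * M)^-1 by rewrite invr_gt0 !mulr_gt0.
exists ((C + 4) * (2 / a) ^+ d), (Num.min s1 (2 * a * M)^-1); split.
  by rewrite lt_min s10.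
move=> z /andP[z0]; rewrite lt_min => /andP[zs zM].
have [gl gu] : a / 2 <= cabs (g z) /\ cabs (g z) <= 2 * a.
  have := hs1 z; rewrite /cdist subr0 => /(_ zs); rewrite g0 => h1.
  have := le_lt_trans (cabs_sub_norm _ _) h1; rewrite cabs_real (gtr0_norm a_gt0) ltr_norml.
  by set x := cabs _ => /andP[? ?]; split; lra.
have g_gt0 : 0 < cabs (g z) by apply: lt_le_trans gl; rewrite divr_gt0.
have wE : cabs (k z)^-1 = (cabs (g z) * cabs z)^-1 by rewrite gE cabsV cabsM.
have wM : M <= cabs (k z)^-1.
  rewrite wE -[leLHS]invrK lef_pV2 ?posrE ?invr_gt0 ?mulr_gt0//.
  apply: le_trans (_ : 2 * a * (2 * a * M)^-1 <= _).
    by rewrite ler_pM ?cabs_ge0// ltW.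
  by rewrite invfM mulrA mulfV ?mul1r// gt_eqF// mulr_gt0.
have w1 := le_trans M1 wM.
have wu : cabs (k z)^-1 <= 2 / a * (cabs z)^-1.
  rewrite wE invfM ler_wpM2r ?invr_ge0 ?cabs_ge0// -[leRHS]invrK invf_div lef_pV2 ?posrE//.
  by rewrite divr_gt0.
have wd1 : 1 <= cabs (k z)^-1 ^+ d by rewrite exprn_ege1.
rewrite /schwarz; apply: le_trans (cabsD _ _) _.
apply: (@le_trans _ _ ((C + 4) * cabs (k z)^-1 ^+ d)).
  rewrite mulrDl lerD ?hC// cabsM.
  have hd := h_decay (le_trans (ltac:(by rewrite le_max lexx orbT) : rho0 <= M) wM).
  have c0 : 0 < cabs (k z)^-1 by apply: lt_le_trans w1.
  apply: le_trans (ler_wpM2l (cabs_ge0 _) hd) _.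
  by rewrite mulrC divfK ?gt_eqF// ler_pMr.
rewrite -mulrA ler_wpM2l ?addr_ge0// -exprVn -exprMn.
by rewrite lerXn2r ?nnegrE ?cabs_ge0// (le_trans (cabs_ge0 _) wu).
Qed.

Theorem schwarz_laurent : exists b : int -> R[i], (forall j, (b j)^* = b (- j)) /\
  forall z, 0 < cabs z < 1 -> schwarz z = laurent d b z.
Proof.
have hS := schwarz_holo.
have [C [s [s0 pole]]] := schwarz_pole.
have sym n : lcoef schwarz n = (lcoef schwarz (- n))^*.
  apply: lcoef_boundary => // e e0.
  have e20 : 0 < e / 2 by rewrite divr_gt0.
  have [rho /andP[r0 r1] hr] := schwarz_boundary e20.
  exists rho => // z /hr; set x := (I _)%:C => h1.
  rewrite (_ : schwarz z - _ = (x - schwarz z)^* - (x - schwarz z)); last first.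
    by rewrite conjB conj_real; ring.
  by rewrite [ltRHS]splitr; apply: le_lt_trans (cabsB _ _) _; rewrite cabs_conj ltrD.
have neg (n : int) : n < - d%:Z -> lcoef schwarz n = 0.
  move=> nd; have [m ->] : exists m : nat, n = - (d + m.+1)%N%:Z.
    exists (`|n| - d.+1)%N; lia.
  exact: (lcoef_pole _ hS s0 pole).
exists (lcoef schwarz); split.
  by move=> j; rewrite [in RHS]sym opprK.
apply: (lcoef_unique hS (@holo0_laurent _ d _)) => n; rewrite lcoef_laurent.
case: ifPn => //; rewrite -ltNge => nd.
have [n0|n0] := leP 0 n; last by apply: neg; lia.
by rewrite sym neg ?conjC0//; lia.
Qed.

End BoundaryValues.

(** * The outer function of the boundary values *)
Section OuterFunction.
Context {R : realType}.
Implicit Types (z w u : R[i]).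

Lemma laurent_cont (d : nat) (b : int -> R[i]) u : u != 0 -> econt cdist (laurent d b) u.
Proof.
move=> u0; rewrite /laurent; suff h n (c : nat -> R[i]) (m : nat -> int) :
    econt cdist (fun u => \sum_(j < n) c j * u ^ m j) u by exact: (h _ (fun j => b (j%:Z - d%:Z)) (fun j => j%:Z - d%:Z)).
elim: n => [|n IH].
  by apply: econt_near (econt_cst _ 0 _); [rewrite /cdist subrr cabs0|exists 1 => // w _; rewrite big_ord0].
apply: econt_near (econtD IH (econtM (econt_cst _ (c n) _) (cdiff_cont (cdiff_expz (m n) u0)))).
  by rewrite /cdist subrr cabs0.
by exists 1 => // w _; rewrite big_ord_recr.
Qed.

Lemma ln_lipschitz (s0 x y : R) : 0 < s0 -> s0 <= x -> s0 <= y -> `|ln x - ln y| <= s0^-1 * `|x - y|.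
Proof.
move=> s00; wlog xy : x y / y <= x.
  move=> hw sx sy; have [xy|/ltW yx] := leP y x; first exact: hw.
  by rewrite distrC [`|x - y|]distrC; exact: hw.
move=> sx sy; have x0 : 0 < x := lt_le_trans s00 sx; have y0 : 0 < y := lt_le_trans s00 sy.
rewrite !ger0_norm ?subr_ge0 ?ler_ln ?posrE//.
rewrite -ln_div ?posrE//; have xy0 : 0 < x / y by rewrite divr_gt0.
have := @le_ln1Dx R (x / y - 1); rewrite addrCA subrr addr0 => h.
apply: le_trans (h _) _; first by rewrite ltrBrDr addrC subrr.
rewrite (_ : x / y - 1 = y^-1 * (x - y)); last by rewrite mulrBr mulVf ?gt_eqF// mulrC.
rewrite ler_wpM2r ?subr_ge0//.
by rewrite lef_pV2 ?posrE.
Qed.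

Section IncreasingFunction.
Variable I : R -> R.
Hypothesis I_diff : forall s, 0 < s -> derivable I s 1.
Hypothesis dI_cont : forall s, 0 < s -> {for s, continuous (derive1 I)}.
Hypothesis dI_gt0 : forall s, 0 < s -> 0 < derive1 I s.

Lemma increasing_cont s : 0 < s -> {for s, continuous I}.
Proof. by move=> /I_diff h; apply/differentiable_continuous/derivable1_diffP. Qed.

(** The derivative has a positive minimum on the segment. *)
Lemma increasing_expand (s0 s1 : R) : 0 < s0 -> exists2 m, 0 < m &
  forall x y, s0 <= x -> x <= y -> y <= s1 -> m * (y - x) <= I y - I x.
Proof.
move=> s00; have [s01|s10] := leP s0 s1; last first.
  by exists 1 => // x y sx xy ys; move: (le_trans sx (le_trans xy ys)); rewrite leNgt s10.
have cw : {within `[s0, s1], continuous (derive1 I)}.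
  apply: continuous_in_subspaceT => x; rewrite inE /= in_itv /= => /andP[sx _].
  by apply: dI_cont; exact: lt_le_trans sx.
have [c /itvP cs cm] := EVT_min s01 cw.
exists (derive1 I c); first by apply: dI_gt0; apply: lt_le_trans s00 _; rewrite cs.
move=> x y sx; rewrite le_eqVlt => /orP[/eqP->|xy] ys; first by rewrite !subrr mulr0.
have pos t : x <= t -> 0 < t by move=> xt; exact: lt_le_trans s00 (le_trans sx xt).
have [|| t txy ->] := @MVT R I (derive1 I) x y xy.
- move=> t; rewrite in_itv /= => /andP[/ltW xt _].
  by split; [exact: I_diff (pos _ xt)|rewrite derive1E].
- by apply: derivable_within_continuous => t; rewrite in_itv /= => /andP[xt _]; exact: I_diff (pos _ xt).
move: txy; rewrite in_itv /= => /andP[/ltW xt /ltW ty].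
by rewrite ler_wpM2r ?subr_ge0 ?(ltW xy)// cm// in_itv /= (le_trans sx xt) (le_trans ty ys).
Qed.

Lemma increasing_expand_norm (s0 s1 : R) : 0 < s0 -> exists2 m, 0 < m &
  forall x y, s0 <= x <= s1 -> s0 <= y <= s1 -> m * `|x - y| <= `|I x - I y|.
Proof.
move=> /(@increasing_expand _ s1) [m m0 hm]; exists m => // x y /andP[sx xs] /andP[sy ys].
have [xy|/ltW yx] := leP x y.
  have := hm x y sx xy ys; rewrite distrC [`|I x - _|]distrC ger0_norm ?subr_ge0// => h.
  exact: le_trans h (ler_norm _).
have := hm y x sy yx xs; rewrite ger0_norm ?subr_ge0// => h.
exact: le_trans h (ler_norm _).
Qed.

Lemma increasing_le (x y : R) : 0 < x -> x <= y -> I x <= I y.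
Proof.
move=> x0 xy; have [m m0 hm] := @increasing_expand x y x0.
by rewrite -subr_ge0; apply: le_trans (hm x y (lexx _) xy (lexx _)); rewrite mulr_ge0 ?subr_ge0// ltW.
Qed.

Lemma increasing_inj (x y : R) : 0 < x -> 0 < y -> I x = I y -> x = y.
Proof.
move=> x0 y0 e; pose s0 := Num.min x y; pose s1 := Num.max x y.
have s00 : 0 < s0 by rewrite lt_min x0.
have [m m0 hm] := increasing_expand_norm s1 s00.
have := hm x y; rewrite e subrr normr0 !ge_min !le_max !lexx !orbT => /(_ isT isT).
by rewrite pmulr_rle0// normr_le0 subr_eq0 => /eqP.
Qed.

Variables (J : R -> R).
Hypothesis JK : forall s, 0 < s -> J (I s) = s.

Variables (k : R[i] -> R[i]) (a s0 s1 : R) (d : nat) (b : int -> R[i]) (rho0 : R).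
Hypothesis a_gt0 : 0 < a.
Hypothesis s0_gt0 : 0 < s0.
Hypothesis rho0_lt1 : rho0 < 1.
Hypothesis k_cdiff : forall z, cabs z < 1 -> cdiff k z.
Hypothesis k_neq0 : forall z, 0 < cabs z < 1 -> k z != 0.
Hypothesis k_slope : exists2 g, econt cdist g 0 /\ g 0 = a%:C & forall z, k z = g z * z.
Hypothesis k_range : forall z, rho0 < cabs z < 1 -> s0 <= cabs (k z)^-1 ^+ 2 <= s1.
Hypothesis k_boundary : forall e, 0 < e -> exists2 rho, rho < 1 &
  forall z, rho < cabs z < 1 -> cabs ((I (cabs (k z)^-1 ^+ 2))%:C - laurent d b z) < e.

Definition modulus u : R := J (complex.Re (laurent d b u)).

Lemma near_circle u (s rho : R) : cabs u = 1 -> 0 < s -> rho < 1 ->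
  exists2 z, rho < cabs z < 1 & cabs (z - u) < s.
Proof.
move=> u1 sp r1; pose t := Num.max (Num.max rho 2^-1) (1 - s / 2).
have t1 : t < 1 by rewrite !gt_max r1 invf_lt1// ltr1n gtrBl divr_gt0.
pose x := (1 + t) / 2.
have [tx x1] : t < x /\ x < 1 by rewrite /x; split; lra.
have [h1 [h2 h3]] : rho <= t /\ 2^-1 <= t /\ 1 - s / 2 <= t by rewrite !le_max !lexx !orbT.
have x0 : 0 <= x by lra.
exists (x%:C * u); first by rewrite cabsM u1 mulr1 cabs_real ger0_norm// x1 andbT; lra.
rewrite -{2}[u]mul1r -mulrBl cabsM u1 mulr1 (cabs_realB x 1) ler0_norm; lra.
Qed.

Lemma circle_approx u e : cabs u = 1 -> 0 < e ->
  exists2 x, s0 <= x <= s1 & cabs ((I x)%:C - laurent d b u) < e.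
Proof.
move=> u1 e0; have e20 : 0 < e / 2 by rewrite divr_gt0.
have u0 : u != 0 by rewrite -cabs_gt0 u1.
have [rho r1 hr] := k_boundary e20.
have [s sp hs] := @laurent_cont d b u u0 _ e20.
have m1 : Num.max rho rho0 < 1 by rewrite gt_max r1.
have [z] := near_circle u1 sp m1; rewrite gt_max => /andP[/andP[rz r0z] z1] zu.
exists (cabs (k z)^-1 ^+ 2); first by apply: k_range; rewrite r0z.
rewrite [ltRHS]splitr; apply: le_lt_trans (cabs_tri _ (laurent d b z) _) _.
by rewrite ltrD//; [apply: hr; rewrite rz|exact: hs].
Qed.

(** The Laurent polynomial is on the circle a limit of values of [I] on the segment
[s0, s1], hence a value of [I] itself. *)
Lemma modulusP u : cabs u = 1 ->
  s0 <= modulus u <= s1 /\ (I (modulus u))%:C = laurent d b u.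
Proof.
move=> u1; set L := laurent d b u.
have pos x : s0 <= x <= s1 -> 0 < x by move=> /andP[sx _]; exact: lt_le_trans sx.
have Im0 : complex.Im L = 0.
  apply/eqP; rewrite -normr_le0; apply/ler_addgt0Pl => e e0; rewrite addr0.
  have [x _ hx] := circle_approx u1 e0; apply/ltW; apply: le_lt_trans hx.
  by apply: le_trans (Im_le_cabs _); rewrite ImD ImN /= sub0r normrN.
have s01 : s0 <= s1.
  by have [x /andP[sx xs] _] := circle_approx u1 ltr01; exact: le_trans xs.
have Rex e : 0 < e -> exists2 x, s0 <= x <= s1 & `|I x - complex.Re L| < e.
  move=> /(circle_approx u1) [x xs hx]; exists x => //; apply: le_lt_trans hx.
  by apply: le_trans (Re_le_cabs _); rewrite ReD ReN.
have lo : I s0 <= complex.Re L.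
  apply/ler_addgt0Pr => e /Rex [x /andP[sx xs]]; rewrite ltr_norml => /andP[_ h].
  by have := increasing_le s0_gt0 sx; lra.
have hi : complex.Re L <= I s1.
  apply/ler_addgt0Pr => e /Rex [x /andP[sx xs]]; rewrite ltr_norml => /andP[h _].
  by have := increasing_le (lt_le_trans s0_gt0 sx) xs; lra.
have cI : {within `[s0, s1], continuous I}.
  apply: continuous_in_subspaceT => x; rewrite inE /= in_itv /= => /pos.
  exact: increasing_cont.
have [|s] := @IVT _ _ _ _ (complex.Re L) s01 cI.
  by rewrite min_l ?max_r ?lo// increasing_le.
rewrite in_itv /= => sI Is.
rewrite /modulus -/L -Is JK ?pos//; split => //.
by apply/eqP; rewrite eq_complex /= Is Im0 !eqxx.
Qed.

Lemma modulus_gt0 u : cabs u = 1 -> 0 < modulus u.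
Proof. by move=> /modulusP [/andP[h _] _]; exact: lt_le_trans h. Qed.

(** The function [I] expands distances on [s0, s1] at least by a constant factor,
so convergence of its values gives convergence of the arguments. *)
Lemma modulus_limit u0 e : cabs u0 = 1 -> 0 < e -> exists2 s, 0 < s &
  forall z, cabs z < 1 -> cabs (z - u0) < s -> `|cabs (k z)^-1 ^+ 2 - modulus u0| < e.
Proof.
move=> u1 e0; have u0N0 : u0 != 0 by rewrite -cabs_gt0 u1.
have [ms mI] := modulusP u1.
have [m m0 hm] := increasing_expand_norm s1 s0_gt0.
have e20 : 0 < m * e / 2 by rewrite divr_gt0// mulr_gt0.
have [rho r1 hr] := k_boundary e20.
have [s sp hs] := @laurent_cont d b u0 u0N0 _ e20.
exists (Num.min s (1 - Num.max rho rho0)).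
  by rewrite lt_min sp subr_gt0 gt_max r1.
move=> z z1; rewrite lt_min => /andP[zs zr].
have : Num.max rho rho0 < cabs z.
  have := cabs_sub u0 z; rewrite u1 (cabsC u0); move: zr; set x := Num.max _ _; set y := cabs (z - _); lra.
rewrite gt_max => /andP[rz r0z].
rewrite -(ltr_pM2l m0); apply: le_lt_trans (hm _ _ _ ms) _; first by apply: k_range; rewrite r0z.
rewrite -cabs_realB mI [ltRHS]splitr; apply: le_lt_trans (cabs_tri _ (laurent d b z) _) _.
by rewrite ltrD//; [apply: hr; rewrite rz|exact: hs].
Qed.

Definition log_modulus u : R := ln (modulus u).

Lemma log_modulus_lipschitz : exists2 K, 0 <= K & forall u w, cabs u = 1 -> cabs w = 1 ->
  `|log_modulus u - log_modulus w| <= K * cabs (u - w).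
Proof.
have [m m0 hm] := increasing_expand_norm s1 s0_gt0.
have [K K0 hK] := laurent_lipschitz d b.
exists (s0^-1 * (m^-1 * K)); first by rewrite !mulr_ge0 ?invr_ge0// ltW.
move=> u w u1 w1; have [us uI] := modulusP u1; have [ws wI] := modulusP w1.
case/andP: (us) => us0 _; case/andP: (ws) => ws0 _.
apply: le_trans (ln_lipschitz s0_gt0 us0 ws0) _; rewrite -!mulrA ler_wpM2l ?invr_ge0 ?(ltW s0_gt0)//.
rewrite ler_pdivlMl//; apply: le_trans (hm _ _ us ws) _.
by have := hK u w u1 w1; rewrite -uI -wI cabs_realB.
Qed.

Notation l := log_modulus.

Definition mean_log : R := complex.Re (mean (fun t => (l (cis t))%:C)).
Definition outer z : R[i] := k z / z * (a%:C * cexp (Psi l z)).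
Definition outer_const : R := a ^+ 2 * expR mean_log.

Lemma mean_log_meanable : meanable (fun t => (l (cis t))%:C).
Proof.
have [K K0 lip] := log_modulus_lipschitz.
by apply: cont_meanable => t; exact: cl_circle lip t.
Qed.

Lemma mean_log_real : mean (fun t => (l (cis t))%:C) = mean_log%:C.
Proof.
have := mean_conj mean_log_meanable; rewrite (@eq_mean _ _ (fun t => (l (cis t))%:C)); last first.
  by move=> t; rewrite conj_real.
rewrite /mean_log; move: (mean _) => w e.
apply/eqP; rewrite eq_complex /= eqxx /=; have := congr1 (@complex.Im R) e; rewrite Im_conj.
by move=> /eqP; rewrite -addr_eq0 -mulr2n mulrn_eq0.
Qed.

Lemma Psi0 : Psi l 0 = mean_log%:C.
Proof.
have [K K0 lip] := log_modulus_lipschitz.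
rewrite -mean_log_real (Psi_inside K0 lip) ?cabs0//; apply: eq_mean => t.
by rewrite subr0 divff ?mulr1// cis_neq0.
Qed.

(** The squared modulus is a product of three factors that converge at the circle:
[|k|^2] to [1 / modulus], [|z|^2] to 1, and [|exp (Psi z)|^2] to
[modulus * exp mean_log]. *)
Lemma outer_boundary e : 0 < e -> exists2 rho, 0 < rho < 1 &
  forall z, rho < cabs z < 1 -> cabs (outer z * (outer z)^* - outer_const%:C) < e.
Proof.
move=> e0; have [K K0 lip] := log_modulus_lipschitz.
apply: circle_uniform => u u1.
have u0 : u != 0 by rewrite -cabs_gt0 u1.
(* Extended by the expected limit, so that continuity at [u] expresses
   convergence from inside the disk. *)
pose F1 z : R[i] := if 0 < cabs z < 1 then (cabs (k z)^-1 ^+ 2)%:C else (modulus u)%:C.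
pose F2 z : R[i] := if cabs z <= 1 then Psi l z else Psi l u.
pose F z : R[i] := (F1 z)^-1 * ((z * z^*)^-1 * ((a ^+ 2)%:C * (cexp (F2 z) * (cexp (F2 z))^*))).
have F1u : F1 u = (modulus u)%:C by rewrite /F1 u1 ltxx andbF.
have F2u : F2 u = Psi l u by rewrite /F2 u1 lexx.
have mu0 : (modulus u)%:C != 0 :> R[i].
  by rewrite -cabs_gt0 cabs_real gtr0_norm ?modulus_gt0.
have c1 : econt cdist F1 u.
  move=> e' e'0; have [s sp hs] := modulus_limit u1 e'0.
  exists s => // z zu; rewrite F1u /F1; case: ifPn => [/andP[_ z1]|_]; last by rewrite subrr cabs0.
  by rewrite cabs_realB; exact: hs.
have c2 : econt cdist F2 u.
  move=> e' e'0; have [s sp hs] := Psi_continuous K0 lip u1 e'0.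
  exists s => // z zu; rewrite F2u /F2; case: ifPn => [z1|_]; last by rewrite subrr cabs0.
  exact: hs.
have cE : econt cdist (fun z => cexp (F2 z)) u.
  by apply: (econt_comp c2); exact: cdiff_cont (cdiff_cexp _).
have cF : econt cdist F u.
  apply: econtM; first by apply: econtV => //; rewrite F1u.
  apply: econtM.
    apply: econtV; first by rewrite mul_conj u1 expr1n oner_eq0.
    by apply: econtM; [exact: ccont_id|exact: econt_conj (@ccont_id _ u)].
  by apply: econtM; [exact: econt_cst|apply: econtM => //; exact: econt_conj].
have Fu : F u = outer_const%:C.
  rewrite /F F1u F2u !mul_conj u1 expr1n invr1 mul1r cabs_cexp (Re_Psi K0 lip u1) -/mean_log.
  have -> : expR ((l u + mean_log) / 2) ^+ 2 = modulus u * expR mean_log.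
    by rewrite -expRM_natl [_ * (_ / _)]mulrC divfK// expRD /log_modulus lnK ?posrE ?modulus_gt0.
  rewrite -(rmorphV (real_complex R)) ?unitfE ?gt_eqF ?modulus_gt0// -!rmorphM /outer_const; congr (_%:C).
  by field; rewrite gt_eqF// modulus_gt0.
have [s sp hs] := cF e e0.
exists (Num.min s 1); first by rewrite lt_min sp ltr01.
move=> z z1; rewrite lt_min => /andP[zu zu1].
have z0 : 0 < cabs z by have := cabs_sub u (u - z); rewrite u1 subKr (cabsC u); move: zu1; set x := cabs (z - u); lra.
have := hs z zu; rewrite Fu; congr (cabs (_ - _) < _).
rewrite /F /F1 /F2 z0 z1 (ltW z1) /= -mul_conj /outer.
move: (k z) (cexp (Psi l z)) => kz X; rewrite !conjM !conjV !conj_real !invfM !invrK.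
by rewrite expr2 rmorphM; ring.
Qed.

Lemma outer_holo : holo0 outer.
Proof.
have [K K0 lip] := log_modulus_lipschitz.
move=> z /andP[z0 z1]; apply: cdiffM.
  by apply: cdiffM; [exact: k_cdiff|apply: cdiff_inv; rewrite -cabs_gt0].
apply: cdiffM; first exact: cdiff_cst.
exact: (cdiff_comp (Psi_cdiff K0 lip z1) (cdiff_cexp _)).
Qed.

Lemma outer_neq0 z : 0 < cabs z < 1 -> outer z != 0.
Proof.
move=> h; case/andP: (h) => z0 _.
apply: mulf_neq0; apply: mulf_neq0; [exact: k_neq0| |  |exact: cexp_neq0].
  by rewrite invr_eq0 -cabs_gt0.
by rewrite -cabs_gt0 cabs_real gtr0_norm.
Qed.

Lemma outer_const_gt0 : 0 < outer_const.
Proof. by rewrite mulr_gt0 ?expR_gt0// exprn_gt0. Qed.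

Lemma outer_near0 : exists2 H, econt cdist H 0 /\ H 0 = outer_const%:C &
  forall z, z != 0 -> H z = outer z.
Proof.
have [g [gc g0] gE] := k_slope; have [K K0 lip] := log_modulus_lipschitz.
exists (fun z => g z * (a%:C * cexp (Psi l z))); last first.
  by move=> z z0; rewrite /outer gE mulfK.
split.
  apply: econtM => //; apply: econtM; first exact: econt_cst.
  have z1 : cabs (0 : R[i]) < 1 by rewrite cabs0.
  exact: cdiff_cont (cdiff_comp (Psi_cdiff K0 lip z1) (cdiff_cexp _)).
by rewrite g0 Psi0 cexp_real /outer_const expr2 -mulrA !rmorphM.
Qed.

(** The quotient of [outer_const] by [outer] has the conjugate boundary values
of [outer]; as both extend over the origin, their Laurent coefficients of
nonzero index vanish. *)
Theorem outer_const1 : outer_const = 1 /\ forall z, 0 < cabs z < 1 -> outer z = 1.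
Proof.
have hm := outer_holo; have c0 := outer_const_gt0.
have cN0 : outer_const%:C != 0 :> R[i] by rewrite -cabs_gt0 cabs_real gtr0_norm.
pose quot z := outer_const%:C / outer z.
have hq : holo0 quot.
  move=> z z1; apply: cdiffM; first exact: cdiff_cst.
  by apply: cdiffV; [exact: outer_neq0|exact: hm].
have [H [Hc H0] HE] := outer_near0.
have lim_outer : forall e, 0 < e -> exists2 s, 0 < s & forall z, 0 < cabs z < s -> cabs (outer z - outer_const%:C) < e.
  move=> e e0; have [s sp hs] := Hc e e0; exists s => // z /andP[z0 zs].
  by rewrite -HE -?cabs_gt0// -H0; apply: hs; rewrite /cdist subr0.
have lim_quot : forall e, 0 < e -> exists2 s, 0 < s & forall z, 0 < cabs z < s -> cabs (quot z - 1) < e.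
  have : econt cdist (fun z => outer_const%:C / H z) 0.
    by apply: econtM; [exact: econt_cst|apply: econtV => //; rewrite H0].
  move=> ec e e0; have [s sp hs] := ec e e0; exists s => // z /andP[z0 zs].
  have := hs z; rewrite /cdist subr0 HE -?cabs_gt0// H0 divff//; exact.
have no_pole phi v : holo0 phi ->
    (forall e, 0 < e -> exists2 s, 0 < s & forall z, 0 < cabs z < s -> cabs (phi z - v) < e) ->
    forall n : int, n < 0 -> lcoef phi n = 0.
  move=> hphi lim n n0; have [m ->] : exists m : nat, n = - (0 + m.+1)%N%:Z by exists (`|n| - 1)%N; lia.
  have [s sp hs] := lim 1 ltr01.
  have pole z : 0 < cabs z < s -> cabs (phi z) <= (cabs v + 1) * (cabs z ^+ 0)^-1.
    move=> zs; rewrite expr0 invr1 mulr1 -[phi z](subrK v) addrC; apply: le_trans (cabsD _ _) _.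
    by rewrite lerD2l ltW// hs.
  exact: (lcoef_pole _ hphi sp pole).
have bd n : lcoef quot n = (lcoef outer (- n))^*.
  apply: lcoef_boundary => // e e0.
  have e1 : 0 < Num.min (outer_const / 2) (e * (Num.min 1 (outer_const / 2))).
    have c2 : 0 < outer_const / 2 by rewrite divr_gt0.
    by rewrite lt_min c2 mulr_gt0// lt_min ltr01.
  have [rho /andP[r0 r1] hr] := outer_boundary e1.
  exists rho => // z rz; have := hr z rz; rewrite lt_min => /andP[h1 h2].
  have z1 : 0 < cabs z < 1 by case/andP: rz => a1 a2; rewrite a2 (lt_trans r0 a1).
  have mN0 := outer_neq0 z1.
  have -> : quot z - (outer z)^* = - (outer z * (outer z)^* - outer_const%:C) / outer z.
    rewrite /quot; move: mN0; move: (outer z) => X XN0; rewrite opprB mulrBl; congr (_ - _).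
    by rewrite mulrAC mulfV// mul1r.
  rewrite cabsM cabsN cabsV ltr_pdivrMr ?cabs_gt0//; apply: lt_le_trans h2 _.
  rewrite ler_wpM2l ?(ltW e0)//.
  have m2 : outer_const / 2 <= cabs (outer z) ^+ 2.
    move: h1; rewrite mul_conj cabs_realB ltr_norml => /andP[h1 _]; move: h1.
    set X := cabs _ ^+ 2; set C := outer_const; lra.
  rewrite ge_min; have [m1|m1] := leP 1 (cabs (outer z)) => //=.
  apply: le_trans m2 _; rewrite expr2 ler_piMl ?cabs_ge0//; exact: ltW.
have cst1 n : lcoef (fun=> 1 : R[i]) n = (0 == n)%:R.
  have := @lcoef_monomial R 1 0 n; rewrite mul1r => <-; congr (lcoef _ n).
  by apply/funext => z; rewrite expr0z mulr1.
have hcst : holo0 (fun=> 1 : R[i]) by move=> z _; exact: cdiff_cst.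
have q1 := lcoef_limit hq lim_quot.
have cE : outer_const = 1.
  have := bd 0; rewrite q1 oppr0 (lcoef_limit hm lim_outer) conj_real.
  by move=> /(congr1 (@complex.Re R)).
have eqn n : lcoef quot n = lcoef (fun=> 1) n.
  rewrite cst1; have [n0|n0|<-] := ltgtP 0 n; last by rewrite q1.
  - by rewrite bd (no_pole _ _ hm lim_outer) ?oppr_lt0// conjC0.
  - by rewrite (no_pole _ _ hq lim_quot).
split => // z z1; have := lcoef_unique hq hcst eqn z1.
by rewrite /quot cE div1r => h; apply: (can_inj invrK); rewrite invr1.
Qed.

End IncreasingFunction.
End OuterFunction.

(** * Continuity of maps to the sphere *)
Section SphereContinuity.
Context {R : realType}.
Implicit Types (z w : R[i]).

Lemma compact_cabs (K : set R[i]) : compact K -> exists M, forall w, K w -> cabs w <= M.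
Proof.
move=> cK; have cc : continuous (@Normc.normc R).
  move=> z B /nbhs_ballP [e /= e0 eB]; apply/nbhsC; exists e => // w wz.
  by apply: eB; apply: le_lt_trans wz; rewrite cabsC; exact: cabs_sub_norm.
have cI : compact ((@Normc.normc R) @` K).
  by apply: continuous_compact => //; exact: continuous_subspaceT.
have [M [_ hM]] := compact_bounded cI.
exists (M + 1) => w Kw; apply: le_trans (ler_norm _) _.
by apply: (hM (M + 1)); [rewrite ltrDl|exists w].
Qed.

Lemma sphere_cont_finite (A : set R[i]) (F : R[i] -> sphere R) z w : F z = Some w ->
  (forall e, 0 < e -> exists2 s, 0 < s & forall v, A v -> cabs (v - z) < s ->
     exists2 v', F v = Some v' & cabs (v' - w) < e) ->
  F @ within A (nbhs z) --> F z.
Proof.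
move=> Fz lim B; rewrite Fz => /= nB.
have /nbhsC [e e0 he] : nbhs w (Some @^-1` B) by [].
have [s s0 hs] := lim e e0.
suff : nbhs z [set v | A v -> B (F v)] by [].
apply/nbhsC; exists s => // v vz Av.
by have [v' -> vw] := hs v Av vz; exact: he.
Qed.

(** Neighbourhoods of infinity are complements of compact sets, which are bounded. *)
Lemma sphere_cont_infinite (A : set R[i]) (F : R[i] -> sphere R) z : F z = None ->
  (forall M, exists2 s, 0 < s & forall v, A v -> cabs (v - z) < s ->
     F v = None \/ exists2 v', F v = Some v' & M < cabs v') ->
  F @ within A (nbhs z) --> F z.
Proof.
move=> Fz lim B; rewrite Fz => -[K [cK _] KB].
have [M hM] := compact_cabs cK; have [s s0 hs] := lim M.
suff : nbhs z [set v | A v -> B (F v)] by [].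
apply/nbhsC; exists s => // v vz Av; apply: KB.
have [->|[v' -> vM]] := hs v Av vz; [by right|left].
by exists v' => // /hM; rewrite leNgt vM.
Qed.

End SphereContinuity.

(** * Cauchy integrals over the unit circle *)
Section CircleIntegrals.
Context {R : realType}.

(** The differential [du] contributes [i * u dt]. *)
Lemma circle_integral_mean (h g : R[i] -> R[i]) : (forall t, econt rdist (fun t => g (cis t)) t) ->
  (forall t, h (cis t) * cis t = g (cis t)) ->
  circle_integral h = 2 * pi%:C * (0 +i* 1) * mean (fun t => g (cis t)).
Proof.
move=> gc hg; have -> : circle_integral h = Lint 0 (2 * pi) (fun t => (0 +i* 1) * g (cis t)).
  rewrite /circle_integral /Lint /Cint; congr (_ +i* _); apply: eq_Rintegral => t _.
  - by rewrite -hg mulrCA.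
  - by rewrite -hg mulrCA.
rewrite /Lint CintZ//; last exact: cont_meanable.
rewrite /mean -/(Lint _ _ _) mulrA; congr (_ * _).
have p0 : (2 * pi)%:C != 0 :> R[i] by rewrite -cabs_gt0 cabs_real gtr0_norm ?twopi_gt0.
have -> : 2 * pi%:C = (2 * pi)%:C :> R[i] by rewrite rmorphM /= rmorph_nat.
by rewrite mulrAC (fmorphV (real_complex R)) divff// mul1r.
Qed.

End CircleIntegrals.

Lemma IinvK (R : realType) (Phi : R -> R) :
  (forall s, 0 < s -> derivable (Ifun Phi) s 1) ->
  (forall s, 0 < s -> {for s, continuous (derive1 (Ifun Phi))}) ->
  (forall s, 0 < s -> 0 < derive1 (Ifun Phi) s) ->
  forall s, 0 < s -> Iinv Phi (Ifun Phi s) = s.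
Proof.
move=> dI cI pI s s0; rewrite /Iinv pinvKV ?inE//=; last by rewrite in_itv /= s0.
move=> x y; rewrite !inE /= !in_itv /= !andbT => x0 y0 e.
exact: (increasing_inj dI cI pI x0 y0 e).
Qed.

(** * The boundary extension of the exponential of a Cauchy integral *)
Section OuterMap.
Context {R : realType}.
Implicit Types (z u w : R[i]).
Variables (l : R[i] -> R) (K a : R).
Hypothesis K0 : 0 <= K.
Hypothesis lip : forall u w, cabs u = 1 -> cabs w = 1 -> `|l u - l w| <= K * cabs (u - w).
Hypothesis a_gt0 : 0 < a.

Definition outer_value z : R[i] := a%:C * z^-1 * cexp (Psi l z).
Definition outer_map z : sphere R := if z == 0 then None else Some (outer_value z).

(** On the circle by [Psi_continuous]; at the origin because [exp (Psi z)] stays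
away from 0. *)
Lemma outer_map_continuous : {within closed_disk 1, continuous outer_map}.
Proof.
pose F := outer_map; pose g := outer_value.
suff Fc z : closed_disk 1 z -> F @ within (closed_disk 1) (nbhs z) --> F z.
  exact/subspace_continuousP.
move=> z1.
have [z0|/eqP z0] := pselect (z = 0).
  apply: sphere_cont_infinite; first by rewrite /F /outer_map z0 eqxx.
  move=> M; have z01 : cabs (0 : R[i]) < 1 by rewrite cabs0.
  have [s1 s10 hs1] := cdiff_cont (Psi_cdiff K0 lip z01) ltr01.
  pose kap := a * expR (complex.Re (Psi l 0) - 1).
  have kap0 : 0 < kap by rewrite mulr_gt0// expR_gt0.
  have M1 : 0 < `|M| + 1 by rewrite ltr_wpDl.
  exists (Num.min s1 (kap / (`|M| + 1))); first by rewrite lt_min s10 divr_gt0.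
  move=> v _; rewrite z0 subr0 lt_min => /andP[vs vM].
  have [->|v0] := eqVneq v 0; first by left; rewrite /F /outer_map eqxx.
  right; exists (g v); first by rewrite /F /outer_map (negPf v0).
  apply: (@lt_le_trans _ _ (kap / cabs v)).
    rewrite ltr_pdivlMr ?cabs_gt0//; apply: le_lt_trans (_ : (`|M| + 1) * cabs v < _).
      by rewrite ler_wpM2r ?cabs_ge0//; apply: le_trans (ler_norm _) _; rewrite lerDl.
    by rewrite mulrC -ltr_pdivlMr.
  rewrite /g /outer_value /kap cabsM cabs_cexp cabsM cabsV cabs_real gtr0_norm// mulrAC ler_wpM2l ?divr_ge0 ?cabs_ge0 ?(ltW a_gt0)//.
  rewrite ler_expR; have := hs1 v; rewrite /cdist subr0 => /(_ vs) /ltW /(le_trans (Re_le_cabs _)).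
  by rewrite ReD ReN ler_norml => /andP[h1 _]; rewrite addrC -lerBrDr.
apply: (@sphere_cont_finite _ _ _ _ (g z)); first by rewrite /F /outer_map (negPf z0).
(* Constant outside the disk, so that continuity at [z] only concerns the closed
   disk. *)
pose Psi2 v := if cabs v <= 1 then Psi l v else Psi l z.
have Psi2z : Psi2 z = Psi l z by rewrite /Psi2 ifT.
have c2 : econt cdist Psi2 z.
  have [z1'|z1'] := ltP (cabs z) 1.
    apply: econt_near (cdiff_cont (Psi_cdiff K0 lip z1')); first by rewrite /cdist subrr cabs0.
    exists (1 - cabs z); first by rewrite subr_gt0.
    move=> v vz; rewrite /Psi2 ifT// ltW// -[v](subrK z).
    by apply: le_lt_trans (cabsD _ _) _; rewrite -ltrBrDr.
  have zz : cabs z = 1 by apply/eqP; rewrite eq_le z1' andbT.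
  move=> e e0; have [s s0 hs] := Psi_continuous K0 lip zz e0.
  exists s => // v vz; rewrite Psi2z /Psi2; case: ifPn => [v1|_]; last by rewrite subrr cabs0.
  exact: hs.
have cg : econt cdist (fun v => a%:C * v^-1 * cexp (Psi2 v)) z.
  apply: econtM; last by apply: (econt_comp c2); exact: cdiff_cont (cdiff_cexp _).
  apply: econtM; [exact: econt_cst|exact: cdiff_cont (cdiff_inv z0)].
move=> e e0; have [s s0 hs] := cg e e0.
exists (Num.min s (cabs z)); first by rewrite lt_min s0 cabs_gt0.
move=> v v1; rewrite lt_min => /andP[vs vz].
have v0 : v != 0 by apply: contraTneq vz => ->; rewrite sub0r cabsN ltxx.
exists (g v); first by rewrite /F /outer_map (negPf v0).
by have := hs v vs; rewrite Psi2z /Psi2 ifT.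
Qed.

End OuterMap.

(** * The conformal map onto the exterior of the support *)

Theorem mainTheorem2 (R : realType)
    (Phi : R -> R)
    (Phi_cont : {within `[0, +oo[, continuous Phi})
    (Phi_C2 : forall s, 0 < s ->
       [/\ derivable Phi s 1, derivable (derive1 Phi) s 1
         & {for s, continuous (derive1 (derive1 Phi))}])
    (dI_gt0 : forall s, 0 < s -> 0 < derive1 (Ifun Phi) s)
    (dI_int : exists2 delta : R, 0 < delta &
       (@lebesgue_measure R).-integrable `]0, delta[
         (EFin \o derive1 (Ifun Phi)))
    (I_at0 : Ifun Phi s @[s --> 0^'+] --> 0)
    (d : nat) (d_ge1 : (1 <= d)%N)
    (P : {poly R[i]}) (alpha : nat -> R[i])
    (dP : deriv P = \poly_(j < d) alpha j.+1)
    (r : R) (r_gt0 : 0 < r)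
    (E : set R[i])
    (E_region : exists2 G, smooth_simple_closed_curve G &
       closed_region_bounded_by E G)
    (E_in_D : E `<=` (closed_disk r)°)
    (E_0 : E° 0)
    (sigma : probability (plane R) R)
    (sigma_density : forall A, measurable A ->
       sigma A = (\int[area]_(p in A)
         (\1_(toC @^-1` E) p * gdens Phi (complex.Re (toC p * (toC p)^*)))%:E)%E)
    (sigma_equilibrium :
       equilibrium_measure (potential Phi P) (closed_disk r) sigma)
    (f : R[i] -> sphere R)
    (f_conformal : conformal_bijection (open_disk 1) (~` (Some @` E)) f)
    (f_0 : f 0 = None)
    (a : R) (a_gt0 : 0 < a)
    (f_a : derive1 (chart \o sphere_inv \o f) 0 = a%:C) :
  exists b : int -> R[i],
    [/\ forall j : int, (`|j| <= d%:Z) -> (b j)^* = b (- j),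
        exists2 F, continuous_extension f F &
          forall u, cabs u = 1 ->
            exists2 w, F u = Some w &
              (Ifun Phi (cabs w ^+ 2))%:C = laurent d b u,
        forall zeta, cabs zeta < 1 ->
          f zeta =
            if zeta == 0 then None else
            Some (a%:C * zeta^-1 *
              cexp ((2 * pi%:C * (0 +i* 1))^-1 *
                circle_integral (fun u =>
                  log_Iinv_laurent Phi d b u / (u - zeta))))
      & a%:C =
          cexp (- (4 * pi%:C * (0 +i* 1))^-1 *
            circle_integral (fun u => log_Iinv_laurent Phi d b u / u))].
Proof.
have sigmaE A : measurable A -> sigma A = (\int[area]_(p in A)
    (\1_(@toC R @^-1` E) p * gdens Phi (cabs (toC p) ^+ 2))%:E)%E.
  move=> mA; rewrite (sigma_density _ mA); apply: eq_integral => p _.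
  by congr (_ * gdens _ _)%:E; rewrite mul_conj.
have [_ _ [U [oU _ _ _ [cU _]]]] := E_region.
have cE : closed E by rewrite -cU; exact: closed_closure.
have mE : measurable (@toC R @^-1` E).
  rewrite -[X in measurable X]setCK; apply: measurableC.
  by apply: (@open_plane_measurable R (~` E)); exact: closed_openC.
have E_sub z : E z -> cabs z <= r by move=> /E_in_D /interior_subset.
have /nbhsC [delta delta0 hdelta] : nbhs (0 : R[i]) E := E_0.
have E_near0 w : cabs w < delta -> E w by move=> h; apply: hdelta; rewrite subr0.
have E0 : E 0 by apply: E_near0; rewrite cabs0.
have out0 w : ~ E w -> w != 0 by apply: contra_notN => /eqP ->.
set I := Ifun Phi; set h := cauchy_transform sigma.
have h_cdiff w : ~ E w -> cdiff h w.
  by move=> nE; apply: (cauchy_transform_outside Phi_C2 dI_gt0 mE sigmaE cE nE); exact: out0.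
have h_cont w : w != 0 -> econt cdist h w.
  by move=> w0; have [C [e lb]] := sigma_bounded Phi_C2 dI_gt0 mE sigmaE w0; exact: cauchy_transform_cont lb.
have h_decay w : 2 * r <= cabs w -> cabs (h w) <= 4 / cabs w.
  exact: (cauchy_transform_far r_gt0 sigma_equilibrium).
have balance w : E w -> w != 0 -> (I (cabs w ^+ 2))%:C = w * (deriv P).[w] + w * h w.
  exact: (field_balance Phi_cont Phi_C2 dI_gt0 r_gt0 mE E_sub sigmaE sigma_equilibrium oU cU).
have q_size : (size (deriv P) <= d)%N by rewrite dP; exact: size_poly.
have I_diff s : 0 < s -> derivable I s 1 by move=> /(derive1_Ifun Phi_C2) [].
have dI_cont s : 0 < s -> {for s, continuous (derive1 I)} by exact: derive1_Ifun_cont.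
have I_cont := increasing_cont I_diff.
pose k := kmap f.
have kE := kmapE f_conformal delta0 E_near0.
have kN0 := kmap_neq0 f_conformal f_0 delta0 E_near0.
have k_diff := kmap_cdiff f_conformal delta0 E_near0.
have [b [bconj schwarzE]] := schwarz_laurent f_conformal f_0 a_gt0 f_a delta0 E_near0 I_cont q_size h_cdiff h_cont h_decay balance.
have k_boundary e : 0 < e -> exists2 rho, rho < 1 &
    forall z, rho < cabs z < 1 -> cabs ((I (cabs (k z)^-1 ^+ 2))%:C - laurent d b z) < e.
  move=> e0; have [rho /andP[rho0 rho1] hr] := schwarz_boundary f_conformal f_0 delta0 E_near0 I_cont h_cont balance e0.
  exists rho => // z zr; rewrite -schwarzE ?hr//.
  by case/andP: zr => h1 ->; rewrite (lt_trans rho0).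
have [rho1 /andP[rho1_0 rho1_1] upper] : exists2 rho, 0 < rho < 1 &
    forall z, rho < cabs z < 1 -> cabs (k z)^-1 <= r + 1.
  apply: (boundary_approach f_conformal f_0 delta0 E_near0 (N := fun v => cabs v <= r + 1)) => w Ew; exists 1 => // v _ vw.
  rewrite -[v](subrK w) addrC; apply: le_trans (cabsD _ _) _.
  by rewrite lerD ?E_sub// ltW.
have k_range z : rho1 < cabs z < 1 -> delta ^+ 2 <= cabs (k z)^-1 ^+ 2 <= (r + 1) ^+ 2.
  move=> zr; have z1 : 0 < cabs z < 1 by case/andP: zr => h1 ->; rewrite (lt_trans rho1_0).
  have r1 : 0 <= r + 1 by rewrite addr_ge0// ltW.
  rewrite !lerXn2r ?nnegrE ?cabs_ge0 ?(ltW delta0) ?upper// cabsV -[leLHS]invrK.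
  rewrite lef_pV2 ?posrE ?invr_gt0 ?cabs_gt0 ?kN0//.
  by apply: (kmap_bounded f_conformal f_0 delta0 E_near0); case/andP: z1.
have d20 : 0 < delta ^+ 2 by rewrite exprn_gt0.
have JK := IinvK I_diff dI_cont dI_gt0.
have k_slope := kmap_slope f_conformal f_0 f_a.
pose J := Iinv Phi; pose l := log_modulus J d b.
have modP := modulusP I_diff dI_cont dI_gt0 JK d20 rho1_1 k_range k_boundary.
have [K K0 lip] := log_modulus_lipschitz I_diff dI_cont dI_gt0 JK d20 rho1_1 k_range k_boundary.
have [c1 outer1] := outer_const1 I_diff dI_cont dI_gt0 JK a_gt0 d20 rho1_1 k_diff kN0 k_slope k_range k_boundary.
pose g := outer_value l a.
have fE z : 0 < cabs z < 1 -> f z = Some (g z).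
  move=> z1; have := outer1 z z1; rewrite kE; last by case/andP: z1.
  rewrite (negPf (kN0 z z1)) /outer /g /outer_value => e; congr Some.
  have k0 : k z != 0 := kN0 z z1.
  apply: (mulfI k0); rewrite mulfV// -e /k; ring.
have tpi0 : 2 * pi%:C * (0 +i* 1) != 0 :> R[i].
  rewrite !mulf_neq0 ?pnatr_eq0//; last by rewrite eq_complex /= oner_eq0 andbF.
  by rewrite -cabs_gt0 cabs_real gtr0_norm ?pi_gt0.
have mreal := mean_log_real I_diff dI_cont dI_gt0 JK d20 rho1_1 k_range k_boundary.
exists b; split => //.
- exists (outer_map l a); last first.
    move=> u u1; have u0 : u != 0 by rewrite -cabs_gt0 u1.
    rewrite /outer_map (negPf u0); exists (g u) => //.
    have [/andP[ml _] <-] := modP u u1; congr (I _)%:C.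
    have m0 : 0 < modulus J d b u by exact: lt_le_trans ml.
    rewrite /g /outer_value cabsM cabs_cexp cabsM cabsV u1 invr1 mulr1 cabs_real gtr0_norm// (Re_Psi K0 lip u1).
    rewrite exprMn -expRM_natl [_ * (_ / _)]mulrC divfK// expRD lnK ?posrE// mulrCA.
    by move: c1; rewrite /outer_const /mean_log => ->; rewrite mulr1.
  split; first exact: (outer_map_continuous K0 lip a_gt0).
  move=> z z1; rewrite /outer_map; case: eqP => [->|/eqP z0]; first by rewrite f_0.
  by rewrite fE// cabs_gt0 z0.
- move=> z z1; case: eqP => [->|/eqP z0]; first by rewrite f_0.
  rewrite fE ?cabs_gt0 ?z0// /g /outer_value; congr (Some (_ * cexp _)).
  pose G u := (l u)%:C * (u / (u - z)).
  have Gc t : econt rdist (fun t => G (cis t)) t.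
    apply: econtM; first exact: cl_circle lip t.
    apply: econtM; first exact: rcont_cis.
    apply: econtV; last by apply: econtB; [exact: rcont_cis|exact: econt_cst].
    by rewrite subr_eq0; apply: contraTneq z1 => <-; rewrite cabs_cis ltxx.
  rewrite (circle_integral_mean (g := G) Gc); last by move=> t; rewrite /G mulrA mulrAC.
  by rewrite mulKf// (Psi_inside K0 lip z1).
- rewrite (circle_integral_mean (g := fun u => (l u)%:C)); last 2 first.
  + by move=> t; exact: cl_circle lip t.
  + by move=> t; rewrite divfK ?cis_neq0.
  rewrite mreal; set m := mean_log J d b.
  have -> : - (4 * pi%:C * (0 +i* 1))^-1 * (2 * pi%:C * (0 +i* 1) * m%:C) = (- (m / 2))%:C :> R[i].
    have -> : 4 * pi%:C * (0 +i* 1) = 2 * (2 * pi%:C * (0 +i* 1)) :> R[i] by ring.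
    rewrite invfM mulNr mulrA divfK// rmorphN rmorphM (fmorphV (real_complex R)) rmorph_nat.
    by rewrite mulrC.
  rewrite cexp_real; congr (_%:C); apply/eqP.
  rewrite -(@eqrXn2 _ 2) ?expR_ge0 ?(ltW a_gt0)//; apply/eqP.
  rewrite -expRM_natl mulrN mulrC divfK// expRN.
  by apply: (mulIf (lt0r_neq0 (expR_gt0 m))); rewrite mulVf ?gt_eqF ?expR_gt0.
Qed.
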